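(* (a) Let $H$ be a complex line in the complex hyperbolic plane $\mathbb{C}H^{2}$ and let $N$ be a quadratically convex compact connected oriented (smooth) hypersurface of $\mathbb{C}H^2$ that is invariant by the reflection with respect to $H$. Let $U$ be the exterior of $N$ and $B:U\to U$ its outer billiard map. Then $B$ preserves $H\cap U$, and on $H\cap U$ it coincides with the usual outer billiard map in $H$ associated with the curve of positive geodesic curvature obtained by intersecting $N$ with $H$. (b) Let $N$ be a geodesic sphere of radius $R>0$ in $\mathbb{C}H^2$ with center $o$, with exterior $U$ and outer billiard map $B:U\to U$. Then any complex line $H$ through $o$ is preserved by $B$ (that is, $B$ preserves $H\cap U$). Thus there is a $\mathbb{CP}^{1}$-worth of hyperbolic planes of constant curvature $-4$ through $o$ (the complex lines through $o$), and on each of them $B$ is the usual outer billiard map played outside the disc of radius $R$ centered at $o$.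
   Context: $\mathbb{C}H^{2}$ denotes the complex hyperbolic plane (real dimension 4) with its Riemannian metric $\langle\cdot,\cdot\rangle$ of constant holomorphic sectional curvature $-4$ and complex structure $J$. It is the simply connected complete complex Riemannian manifold of real dimension 4 with $J$ and the curvature tensor $R$ parallel (a K\''ahler symmetric space) such that $\langle R(Ju,u)u,Ju\rangle=-4$ and $\langle R(v,u)u,v\rangle=-1$ for all unit vectors $u,v\in T_p\mathbb{C}H^2$ with $v$ perpendicular to both $u$ and $Ju$. For a unit tangent vector $u$, $\gamma_u:\mathbb{R}\to\mathbb{C}H^2$ is the unique geodesic with initial velocity $u$. A hypersurface $N$ is quadratically convex if its shape operator at each point is definite. In that case $\nu$ denotes the unit normal vector field on $N$ pointing inwards, that is, in the direction of the mean curvature vector field of $N$ (equivalently, the shape operator $S_p(x)=-\nabla_x\nu$ is positive definite for every $p\in N$, where $\nabla$ is the Levi-Civita connection of $\mathbb{C}H^2$). It is known (S. Alexander) that such a compact connected $N$ is the boundary of a convex body and is diffeomorphic to a sphere. The exterior $U$ of $N$ is the connected component of $\mathbb{C}H^{2}-N$ into which the opposite of the mean curvature vector field (i.e. $-\nu$) points. Let $F:N\times\mathbb{R}\to\mathbb{C}H^2$, $F(q,r)=\gamma_{J\nu(q)}(r)$. The restrictions of $F$ to $N\times(0,\infty)$ and to $N\times(-\infty,0)$ are diffeomorphisms onto $U$; hence the following outer billiard map is well defined: $B:U\to U$, $B(\gamma_{J\nu(p)}(-t))=\gamma_{J\nu(p)}(t)$ for $p\in N$ and $t>0$. A complex line in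 $\mathbb{C}H^2$ is a complete totally geodesic surface that is a complex submanifold (its tangent spaces are $J$-invariant); it is isometric to the real hyperbolic plane of constant curvature $-4$. The reflection with respect to a complex line $H$ is the isometry of $\mathbb{C}H^2$ that fixes $H$ pointwise and whose differential at points of $H$ is $-\mathrm{id}$ on the normal space of $H$ (such an isometry exists). Usual outer billiard map in $H$: given a smooth simple closed curve $c$ in $H$ with positive geodesic curvature with respect to its inward unit normal $n$ (tangent to $H$), each point $p\in H$ outside $c$ lies on exactly two geodesics of $H$ tangent to $c$; one of them is chosen, consistently according to an orientation of $H$, and $p$ is mapped to its reflection in the point of tangency $q$, i.e. the point $p'\neq p$ on this tangent geodesic at the same distance from $q$ as $p$. Here the chosen tangent geodesic is the one for which the unit speed geodesic going from $p$ to $q$ has velocity $Jn(q)$ at $q$. *)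

(* Defs.v *)
From HB Require Import structures.
From mathcomp Require Import all_boot all_order all_algebra.
From mathcomp Require Import all_classical all_reals all_analysis.
From mathcomp Require Import ring.

Set Implicit Arguments.
Unset Strict Implicit.
Unset Printing Implicit Defensive.

Import Order.TTheory GRing.Theory Num.Theory.
Import numFieldNormedType.Exports.

Local Open Scope classical_set_scope.
Local Open Scope ring_scope.

Section Smooth.
Variables (R : realType) (U W : normedModType R).

Fixpoint Ck (k : nat) (A : set U) (f : U -> W) : Prop :=
  if k is k'.+1 then
    (forall x, A x -> differentiable f x) /\
    (forall v, Ck k' A (fun x => 'd f x v))
  else forall x, A x -> {for x, continuous f}.

(* Meant for open A. *)
Definition smooth_on (A : set U) (f : U -> W) : Prop := forall k, Ck k A f.

End Smooth.

Section Model.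
Variable R : realType.

Definition dot n (u v : 'rV[R]_n) : R := \sum_i u ord0 i * v ord0 i.

(* The point x + i y of C^2 is the real row vector row_mx x y. *)
Local Notation V := 'rV[R]_(2 + 2).
Implicit Types (z p q u v w x y : V) (N H S A : set V).

(* Multiplication by i. *)
Definition J u : V := row_mx (- rsubmx u) (lsubmx u).

(* Ball model of the complex hyperbolic plane.  With the Hermitian product
   <u, z>_C = sum_j u_j * conj z_j = dot u z + i * dot u (J z), the metric is
   Re ((1 - |z|^2) <u, v>_C + <u, z>_C <z, v>_C) / (1 - |z|^2)^2,
   the Bergman metric scaled to have holomorphic sectional curvature -4. *)
Definition CH2 : set V := [set z | dot z z < 1].

Definition metric z u v : R :=
  ((1 - dot z z) * dot u v + dot u z * dot v z + dot u (J z) * dot v (J z))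
  / (1 - dot z z) ^+ 2.

(* Christoffel symbols of the Levi-Civita connection of the metric:
   (<u, z>_C v + <v, z>_C u) / (1 - |z|^2).  The lemmas christoffelC (no
   torsion) and metric_christoffel (compatibility) below characterize them. *)
Definition christoffel z u v : V :=
  (1 - dot z z)^-1 *:
  (dot u z *: v + dot u (J z) *: J v + dot v z *: u + dot v (J z) *: J u).

Lemma dotC n (u v : 'rV[R]_n) : dot u v = dot v u.
Proof. by apply: eq_bigr => i _; rewrite mulrC. Qed.

Lemma dotDl n (u v w : 'rV[R]_n) : dot (u + v) w = dot u w + dot v w.
Proof. by rewrite -big_split; apply: eq_bigr => i _; rewrite mxE mulrDl. Qed.

Lemma dotZl n a (u v : 'rV[R]_n) : dot (a *: u) v = a * dot u v.
Proof. by rewrite mulr_sumr; apply: eq_bigr => i _; rewrite mxE mulrA. Qed.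

Lemma dotDr n (u v w : 'rV[R]_n) : dot w (u + v) = dot w u + dot w v.
Proof. by rewrite dotC dotDl !(dotC w). Qed.

Lemma dotZr n a (u v : 'rV[R]_n) : dot v (a *: u) = a * dot v u.
Proof. by rewrite dotC dotZl (dotC v). Qed.

Lemma dotNr n (u v : 'rV[R]_n) : dot v (- u) = - dot v u.
Proof. by rewrite -scaleN1r dotZr mulN1r. Qed.

Lemma JD u v : J (u + v) = J u + J v.
Proof. by rewrite /J !linearD /= add_row_mx. Qed.

Lemma JZ a u : J (a *: u) = a *: J u.
Proof. by rewrite /J !linearZ /= scale_row_mx scalerN. Qed.

Lemma JJ u : J (J u) = - u.
Proof. by rewrite /J row_mxKl row_mxKr -opp_row_mx hsubmxK. Qed.

Lemma dotJ u v : dot (J u) (J v) = dot u v.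
Proof.
rewrite /dot !big_split_ord /= addrC; congr (_ + _); apply: eq_bigr => i _.
  by rewrite !row_mxEr !mxE.
by rewrite !row_mxEl !mxE mulrNN.
Qed.

Lemma dotJl u v : dot (J u) v = - dot u (J v).
Proof. by rewrite -(dotJ u) JJ dotNr opprK. Qed.

Lemma christoffelC z u v : christoffel z u v = christoffel z v u.
Proof. by rewrite /christoffel -addrA addrC addrA. Qed.

Lemma metric_christoffel z x u v : CH2 z ->
  is_derive (0 : R) (1 : R) (fun t : R => metric (z + t *: x) u v)
    (metric z (christoffel z x u) v + metric z u (christoffel z x v)).
Proof.
move=> zin.
have z1 : 1 - dot z z != 0 by rewrite subr_eq0 eq_sym lt_eqF.
pose N (t : R) := ((1 - dot z z) * dot u v + dot u z * dot v z
     + dot u (J z) * dot v (J z))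
  + t * (- 2 * dot z x * dot u v + dot u x * dot v z + dot u z * dot v x
     + dot u (J x) * dot v (J z) + dot u (J z) * dot v (J x))
  + t * t * (- dot x x * dot u v + dot u x * dot v x + dot u (J x) * dot v (J x)).
pose D (t : R) := (1 - dot z z) + t * (- 2 * dot z x) + t * t * (- dot x x).
have -> : (fun t : R => metric (z + t *: x) u v) = (fun t => N t * (D t * D t)^-1).
  apply/funext => t; rewrite /metric.
  have -> : 1 - dot (z + t *: x) (z + t *: x) = D t.
    by rewrite /D !(dotDl, dotDr, dotZl, dotZr) (dotC x z); ring.
  rewrite JD JZ !(dotDr, dotZr) -expr2; congr (_ / _).
  by rewrite /N /D; ring.
have quad (a b c : R) :
    is_derive (0 : R) (1 : R) (fun t : R => a + t * b + t * t * c) b.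
  have -> : (fun t : R => a + t * b + t * t * c)
          = (cst a + (@id R) * cst b) + (@id R) * (@id R) * cst c by [].
  by apply: is_derive_eq; rewrite /GRing.scale /=; ring.
have D0 : D 0 = 1 - dot z z by rewrite /D !(mul0r, addr0).
have N0 : N 0 = (1 - dot z z) * dot u v + dot u z * dot v z
    + dot u (J z) * dot v (J z) by rewrite /N !(mul0r, addr0).
have DD0 : (D * D) 0 != 0 by rewrite /= mulf_neq0 // D0.
have dN := quad _ _ _ : is_derive _ _ N _.
have dD := quad _ _ _ : is_derive _ _ D _.
have dDD := is_deriveV DD0 (is_deriveM dD dD).
have dG := is_deriveM dN dDD.
apply: (is_derive_eq dG); rewrite /= /GRing.scale /= /GRing.mul_fun /=.
rewrite ?D0 ?N0.
rewrite /metric /christoffel !(dotDl, dotDr, dotZl, dotZr, JD, JZ, JJ, dotJl, dotJ, dotNr).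
have DD : (D * D) 0 = (1 - dot z z) * (1 - dot z z) by rewrite -D0.
rewrite DD (dotC u x) (dotC v x) (dotC z x).
rewrite (dotC u (J x)) (dotC v (J x)) !dotJl.
by field; rewrite z1.
Qed.

(* Covariant derivative in the direction x of a vector field X defined near z. *)
Definition nabla (X : V -> V) z x : V := 'd X z x + christoffel z x (X z).

(* Covariant derivative of the velocity along a curve. *)
Definition cov_accel (c : R -> V) (t : R) : V :=
  derive1 (derive1 c) t + christoffel (c t) (derive1 c t) (derive1 c t).

Definition smooth_curve (c : R -> V) : Prop :=
  @smooth_on R R^o V setT c.

Definition is_geodesic (c : R -> V) : Prop :=
  [/\ smooth_curve c, forall t, CH2 (c t) & forall t, cov_accel c t = 0].

(* The geodesic with initial point p and initial velocity u; the default value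
   is irrelevant since such a geodesic exists and is unique. *)
Definition geod p u : R -> V :=
  xget (fun=> p) [set c : R -> V | [/\ is_geodesic c, c 0 = p & derive1 c 0 = u]].

(* Embedded smooth submanifolds of CH2 of codimension k. *)
Definition local_equation (k : nat) S p (W : set V) (f : V -> 'rV[R]_k) : Prop :=
  [/\ open W, W p, W `<=` CH2, smooth_on W f &
      (forall z, W z -> forall b, exists v, 'd f z v = b) /\
      (forall z, W z -> (S z <-> f z = 0))].

Definition submanifold (k : nat) S : Prop :=
  S `<=` CH2 /\ forall p, S p -> exists W f, @local_equation k S p W f.

Definition tangent (k : nat) S p : set V :=
  [set v | exists W f, @local_equation k S p W f /\ 'd f p v = 0].

Definition compact_connected_hypersurface N : Prop :=
  [/\ submanifold 1 N, N !=set0, compact N & connected N].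

Definition local_unit_normal N p (W : set V) (xi : V -> V) : Prop :=
  [/\ open W, W p, smooth_on W xi &
      forall q, N q -> W q ->
        metric q (xi q) (xi q) = 1 /\
        forall v, tangent 1 N q v -> metric q (xi q) v = 0].

Definition shape_operator (xi : V -> V) p x : V := - nabla xi p x.

Definition shape_posdef N xi p : Prop :=
  forall x, tangent 1 N p x -> x != 0 -> 0 < metric p (shape_operator xi p x) x.

Definition shape_negdef N xi p : Prop :=
  forall x, tangent 1 N p x -> x != 0 -> metric p (shape_operator xi p x) x < 0.

Definition quadratically_convex N : Prop :=
  forall p, N p -> exists W xi, local_unit_normal N p W xi /\
    (shape_posdef N xi p \/ shape_negdef N xi p).

(* nu is the smooth unit normal field on N for which the shape operator is
   positive definite; its values off N play no role. *)
Definition inward_normal N (nu : V -> V) : Prop :=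
  forall p, N p -> exists W xi, [/\ local_unit_normal N p W xi,
    forall q, N q -> W q -> xi q = nu q & shape_posdef N xi p].

(* The connected component of CH2 - N into which - nu points. *)
Definition exterior N (nu : V -> V) : set V :=
  [set x | exists p, N p /\ exists2 e : R, 0 < e &
     forall s, 0 < s < e ->
       connected_component (CH2 `\` N) (geod p (- nu p) s) x].

Definition tangent_flow (nu : V -> V) (qr : V * R) : V :=
  geod qr.1 (J (nu qr.1)) qr.2.

(* The first two clauses say that the rule in the third one is a well defined
   map from the exterior to itself. *)
Definition outer_billiard_map N (nu : V -> V) (B : V -> V) : Prop :=
  [/\ set_bij (N `*` [set t : R | 0 < t]) (exterior N nu) (tangent_flow nu),
      set_bij (N `*` [set t : R | t < 0]) (exterior N nu) (tangent_flow nu) &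
      forall p (t : R), N p -> 0 < t ->
        B (geod p (J (nu p)) (- t)) = geod p (J (nu p)) t].

Definition complex_line H : Prop :=
  [/\ submanifold 2 H, H !=set0, connected H,
      (forall p v, H p -> tangent 2 H p v -> tangent 2 H p (J v)) &
      (* complete and totally geodesic *)
      (forall p v t, H p -> tangent 2 H p v -> H (geod p v t))].

Definition isometry (s : V -> V) : Prop :=
  [/\ smooth_on CH2 s, set_bij CH2 CH2 s &
      forall z u v, CH2 z -> metric (s z) ('d s z u) ('d s z v) = metric z u v].

Definition reflection H (s : V -> V) : Prop :=
  [/\ isometry s, (forall p, H p -> s p = p) &
      (forall p w, H p -> (forall v, tangent 2 H p v -> metric p w v = 0) ->
        'd s p w = - w)].

(* Smooth simple closed curves in H, parametrized with period L. *)
Definition simple_closed_curve H (c : R -> V) (L : R) : Prop :=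
  [/\ 0 < L, smooth_curve c, (forall t, H (c t)),
      (forall t, c (t + L) = c t) &
      (forall s t, 0 <= s < L -> 0 <= t < L -> c s = c t -> s = t) /\
      (forall t, derive1 c t != 0)].

(* The complement in H of the curve c is the union of its outside, the
   unbounded component, and its inside. *)
Definition outside H (c : R -> V) : set V :=
  [set x | ~ exists2 rho : R, rho < 1 &
     connected_component (H `\` range c) x `<=` [set z | dot z z <= rho]].

Definition inside H (c : R -> V) : set V := (H `\` range c) `\` outside H c.

Definition inward_unit_normal_in H (c : R -> V) (n : V -> V) : Prop :=
  forall t, let q := c t in
    [/\ tangent 2 H q (n q), metric q (n q) (n q) = 1,
        metric q (n q) (derive1 c t) = 0 &
        exists2 e : R, 0 < e & forall s, 0 < s < e -> inside H c (geod q (n q) s)].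

(* Geodesic curvature with respect to n of a curve in a totally geodesic
   surface, whose connection is the restriction of that of CH2. *)
Definition geodesic_curvature (c : R -> V) (n : V -> V) (t : R) : R :=
  metric (c t) (cov_accel c t) (n (c t)) / metric (c t) (derive1 c t) (derive1 c t).

Definition convex_curve H (c : R -> V) (L : R) (n : V -> V) : Prop :=
  [/\ simple_closed_curve H c L, inward_unit_normal_in H c n &
      forall t, 0 < geodesic_curvature c n t].

(* Graph of the usual outer billiard map in H: y is the reflection of x in the
   point of tangency q. *)
Definition usual_outer_billiard H (c : R -> V) (n : V -> V) x y : Prop :=
  outside H c x /\
  exists q (t : R), [/\ range c q, 0 < t,
    x = geod q (J (n q)) (- t) & y = geod q (J (n q)) t].

(* C is a curve of positive geodesic curvature in H and the outer billiard map
   in H associated with it is the restriction of B to H `&` U. *)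
Definition usual_outer_billiard_on H C U (B : V -> V) : Prop :=
  exists c L n, [/\ convex_curve H c L n, range c = C,
    outside H c = H `&` U &
    forall x y, (H `&` U) x -> (usual_outer_billiard H c n x y <-> y = B x)].

Definition geodesic_sphere p (r : R) : set V :=
  [set x | exists2 u, metric p u u = 1 & x = geod p u r].

Definition circle_in H p (r : R) : set V :=
  [set x | exists u, [/\ tangent 2 H p u, metric p u u = 1 & x = geod p u r]].

Definition disc_in H p (r : R) : set V :=
  [set x | exists2 s : R, 0 <= s <= r & circle_in H p s x].

(* H is isometric to the Poincare disc of constant curvature -4. *)
Definition hyperbolic_plane_m4 H : Prop :=
  let D := [set w : 'rV[R]_2 | dot w w < 1] in
  exists phi : 'rV[R]_2 -> V,
    [/\ smooth_on D phi, set_bij D H phi &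
        forall w u v : 'rV[R]_2, D w ->
          metric (phi w) ('d phi w u) ('d phi w v)
          = dot u v / (1 - dot w w) ^+ 2].

(* Complex lines of the complex vector space (V, J), that is, the points of the
   complex projective line P(V). *)
Definition CP1 : set (set V) :=
  [set L | exists2 v, v != 0 &
     L = [set w | exists a b : R, w = a *: v + b *: J v]].

End Model.

(* Main.v *)
(** In complex notation the geodesic from p with unit velocity u is
p + (sinh t / (cosh t + k sinh t)) u with k = <u, p> / (1 - |p|^2), so that
complex lines are the intersections of the ball with affine complex lines.

Both parts reduce to the case of a complex line H such that nu is tangent to H
along N `&` H and that a tangent geodesic gamma_(J nu(q)) meets H only if q is in
H.  In (a), an isometry preserving N preserves nu, because it preserves second
derivatives along geodesics; hence the reflection s commutes with the tangent
flow F, and if F (q, t) is in H, that is, fixed by s, then s q = q by injectivity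
of F.  In (b), nu is tangent to the complex line through o and q, which meets H
only at o unless q is in H, and the tangent flow avoids o.

Under these assumptions the exterior U contains a large circle of H, and each
point x of this circle is F (c, t) for a unique c in N `&` H and a unique t > 0.
The resulting closed curve c is continuous by compactness.  It is smooth by
implicit differentiation of the equation G(q, x) = 0 which says that x lies on
the geodesic tangent to N at q: the derivative of G along N `&` H is minus the
curvature times a positive number, and c does not stop because geodesics cross the
circle transversally.  A geodesic leaves the disc bounded by the circle exactly
once, so that c is a simple parametrization of N `&` H.  The exterior contains a
neighborhood of the sphere at infinity, hence U `&` H is the outside of c, and nu
points inside because tangent geodesics stay locally on the other side of N. *)
From HB Require Import structures.
Require Import Defs.
From mathcomp Require Import all_boot all_order all_algebra.
From mathcomp Require Import all_classical all_reals all_analysis.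
From mathcomp Require Import ring lra.
Set Implicit Arguments.
Unset Strict Implicit.
Unset Printing Implicit Defensive.
Import Order.TTheory GRing.Theory Num.Theory.
Import numFieldNormedType.Exports.
Local Open Scope classical_set_scope.
Local Open Scope ring_scope.

(** * Differential calculus *)

(** [N] and [H] are known only through local equations, never through parametrizations, and this
    shapes the calculus. Tangential derivatives along [N] are taken on zeros of an equation supplied
    by the intermediate value theorem. The curve of tangency points is first shown continuous and
    then differentiated by hand: its increments satisfy two approximate linear equations, one from
    the equation of [N] and one from [gdir], whose triangular matrix is invertible. The resulting
    derivative is a smooth expression in the curve itself, so each order of smoothness yields the
    next.

    Convexity enters through one quantity, the covariant Hessian [Phi f] of an equation [f] of [N].
    It is the second derivative of [f] along a geodesic, and on tangent vectors of [N] it is minus a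
    positive factor times the second fundamental form. Its sign tells which of the two unit normals
    is [nu], and on which side of [N] the tangent geodesics start.

    The geodesics are given by a closed formula, so that most metric facts become rational
    identities in cosh t, sinh t and one complex number. *)

Section Calc.
Variables (R : realType).

Section Gen.
Variables (U W : normedModType R).

(** Registered as a bilinear map so that the derivative of bilinear maps gives the Leibniz rule
    [is_diff_scale]. *)
Lemma scale_is_bilinear : bilinear_for
  (GRing.Scale.Law.clone _ _ *:%R _) (GRing.Scale.Law.clone _ _ *:%R _)
  (@GRing.scale R W).
Proof.
split=> [u'|u] a x y /=; first by rewrite scalerDl scalerA.
by rewrite scalerDr !scalerA mulrC.
Qed.
HB.instance Definition _ := bilinear_isBilinear.Build R R W W _ _
  (@GRing.scale R W) scale_is_bilinear.

Lemma is_diff_scale (a da : U -> R) (f df : U -> W) x :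
  is_diff x a da -> is_diff x f df ->
  is_diff x (fun y => a y *: f y) (fun v => a x *: df v + da v *: f x).
Proof.
move=> Ha Hf.
pose b : {bilinear R -> W -> W} := @GRing.scale R W.
have bc : continuous (fun p : R * W => b p.1 p.2).
  by move=> p; apply: scale_continuous.
have Hp : is_diff (a x, f x) (fun p : R * W => b p.1 p.2)
  (fun v => b (a x) v.2 + b v.1 (f x)).
  apply: DiffDef; first exact: differentiable_bilin.
  by rewrite diff_bilin.
have Hq := is_diff_pair Ha Hf.
exact: is_diff_eq (is_diff_comp Hq Hp) _.
Qed.

Lemma diff_eps (f : U -> W) x (e : R) : differentiable f x -> 0 < e ->
  \forall h \near (0 : U), `|f (x + h) - f x - 'd f x h| <= e * `|h|.
Proof.
move=> df e0.
have /eqaddoP H := diff_locally df.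
apply: filterS (H e e0) => h.
suff -> : f (x + h) - f x - 'd f x h = (f \o shift x - (cst (f x) + 'd f x)) h by [].
by rewrite -addrA -opprD (addrC x).
Qed.

Lemma eps_is_diff (f : U -> W) (df : {linear U -> W}) x : continuous df ->
  (forall e : R, 0 < e ->
     \forall h \near (0 : U), `|f (x + h) - f x - df h| <= e * `|h|) ->
  is_diff x f df.
Proof.
move=> cdf H.
have E : f \o shift x = cst (f x) + df +o_ 0 id.
  apply/eqaddoP => e e0; apply: filterS (H e e0) => h.
  suff -> : f (x + h) - f x - df h = (f \o shift x - (cst (f x) + df)) h by [].
  by rewrite -addrA -opprD (addrC x).
have D := diff_unique cdf E.
by apply: DiffDef => //; apply/diff_locallyP; rewrite D.
Qed.

Lemma is_diff_near (f g df : U -> W) x :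
  (\forall y \near x, f y = g y) -> is_diff x f df -> is_diff x g df.
Proof.
move=> fg fd.
have fxgx : f x = g x by exact: nbhs_singleton fg.
have dfx : differentiable f x by apply: ex_diff.
have <- : 'd f x = df :> (U -> W) by apply: diff_val.
apply: eps_is_diff; first exact: diff_continuous.
move=> e e0.
have fg' : \forall h \near (0 : U), f (x + h) = g (x + h).
  have : x + h @[h --> (0 : U)] --> x.
    rewrite -[X in _ --> X]addr0; apply: cvgD; [exact: cvg_cst|exact: cvg_id].
  by move=> /(_ _ fg).
near=> h.
have <- : f (x + h) = g (x + h) by near: h.
by rewrite -fxgx; near: h; exact: diff_eps.
Unshelve. all: by end_near. Qed.

End Gen.

Lemma is_diff_ext (U W : normedModType R) (f g df dg : U -> W) x :
  is_diff x f df -> f =1 g -> df =1 dg -> is_diff x g dg.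
Proof. by move=> H /funext <- /funext <-. Qed.

(** Openness of [A] turns the equality on [A] into an equality near each point, so the derivatives
    agree on [A] as well and the induction goes on. *)
Lemma Ck_near (U W : normedModType R) k : forall (A : set U) (f g : U -> W),
  open A -> (forall x, A x -> f x = g x) -> Ck k A f -> Ck k A g.
Proof.
elim: k => [|k IH] A f g oA fg /=.
  move=> Hf x Ax; have gf : \forall y \near x, f y = g y.
    by apply: filterS (open_nbhs_nbhs (conj oA Ax)) => y /fg.
  have := Hf x Ax; rewrite /prop_for /continuous_at (fg x Ax).
  exact: cvg_trans (near_eq_cvg gf).
move=> [Hf Hd].
have D x : A x -> is_diff x g ('d f x).
  move=> Ax; apply: is_diff_near (differentiableP (Hf x Ax)).
  by apply: filterS (open_nbhs_nbhs (conj oA Ax)) => y /fg.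
split=> [x Ax|v]; first by case: (D x Ax).
refine (IH A (fun x => 'd f x v) (fun x => 'd g x v) oA _ (Hd v)) => x Ax.
by rewrite (@diff_val _ _ _ _ _ _ _ (D x Ax)).
Qed.

Lemma Ck_sub (U W : normedModType R) k : forall (A B : set U) (f : U -> W),
  B `<=` A -> Ck k A f -> Ck k B f.
Proof.
elim: k => [|k IH] A B f BA /=; first by move=> Hf x /BA /Hf.
by move=> [Hf Hd]; split=> [x /BA /Hf //|v]; apply: IH (Hd v).
Qed.

(** [Ck] is a pointwise condition on derivatives taken in the whole space, so smoothness may be
    collected from one neighbourhood per point. *)
Lemma Ck_cover (U W : normedModType R) k : forall (A : set U) (f : U -> W),
  (forall x, A x -> exists2 B, B x & Ck k B f) -> Ck k A f.
Proof.
elim: k => [|k IH] A f H /=; first by move=> x /H [B Bx]; apply.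
split=> [x /H [B Bx [+ _]]|v]; first exact.
by apply: IH => x /H [B Bx [_ HB]]; exists B => //; apply: HB.
Qed.

Lemma CkW (U W : normedModType R) k : forall (A : set U) (f : U -> W),
  Ck k.+1 A f -> Ck k A f.
Proof.
elim: k => [|k IH] A f /= [Hf Hd]; first by move=> x /Hf /differentiable_continuous.
by split=> // v; apply: IH.
Qed.

Lemma Ck_cont (U W : normedModType R) k (A : set U) (f : U -> W) x :
  Ck k A f -> A x -> {for x, continuous f}.
Proof. by elim: k => [|k IH]; [move=> H /H | move=> /CkW]. Qed.

(** The introduction rule for higher smoothness: the derivative is named by an explicit formula
    [df], to which an induction on the order applies. *)
Lemma CkS (U W : normedModType R) k (A : set U) (f : U -> W) (df : U -> U -> W) :
  open A -> (forall x, A x -> is_diff x f (df x)) ->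
  (forall v, Ck k A (fun x => df x v)) -> Ck k.+1 A f.
Proof.
move=> oA D H; split=> [x /D [] //|v].
apply: Ck_near (H v) => // x /D dfx.
by rewrite (diff_val (is_diff_def := dfx)).
Qed.

Lemma CkS_diff (U W : normedModType R) k (A : set U) (f : U -> W) x :
  Ck k.+1 A f -> A x -> is_diff x f ('d f x).
Proof. by case=> H _ /H /differentiableP. Qed.

Lemma Ckd (U W : normedModType R) k (A : set U) (f : U -> W) v :
  Ck k.+1 A f -> Ck k A (fun x => 'd f x v).
Proof. by case=> _; apply. Qed.

Lemma Ck_cst (U W : normedModType R) k : forall (A : set U) (c : W),
  open A -> Ck k A (fun=> c).
Proof.
elim: k => [|k IH] A c oA; first by move=> x _; apply: cvg_cst.
by apply: (CkS (df := fun=> cst 0)) => // v; apply: IH.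
Qed.

Lemma Ck_id (U : normedModType R) k (A : set U) : open A -> Ck k A (fun x : U => x).
Proof.
move=> oA; case: k => [|k]; first by move=> x _; apply: cvg_id.
by apply: (CkS (df := fun=> id)) => // v; apply: Ck_cst.
Qed.

Lemma Ck_add (U W : normedModType R) k : forall (A : set U) (f g : U -> W), open A ->
  Ck k A f -> Ck k A g -> Ck k A (fun x => f x + g x).
Proof.
elim: k => [|k IH] A f g oA.
  by move=> Hf Hg x Ax; apply: cvgD; [apply: Hf|apply: Hg].
move=> Hf Hg; apply: (CkS (df := fun x v => 'd f x v + 'd g x v)) => // [x Ax|v].
  by apply: is_diffD; [apply: CkS_diff Hf Ax|apply: CkS_diff Hg Ax].
by apply: IH => //; apply: Ckd.
Qed.

Lemma Ck_scale (U W : normedModType R) k : forall (A : set U) (a : U -> R) (f : U -> W),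
  open A -> Ck k A a -> Ck k A f -> Ck k A (fun x => a x *: f x).
Proof.
elim: k => [|k IH] A a f oA.
  by move=> Ha Hf x Ax; apply: cvgZ; [apply: Ha|apply: Hf].
move=> Ha Hf.
apply: (CkS (df := fun x v => a x *: 'd f x v + 'd a x v *: f x)) => // [x Ax|v].
  by apply: is_diff_scale; [apply: CkS_diff Ha Ax|apply: CkS_diff Hf Ax].
apply: Ck_add => //; apply: IH => //; [exact: CkW|exact: Ckd|exact: Ckd|exact: CkW].
Qed.

Lemma Ck_mul (U : normedModType R) k (A : set U) (a b : U -> R) : open A ->
  Ck k A a -> Ck k A b -> Ck k A (fun x => a x * b x).
Proof. exact: Ck_scale. Qed.

Lemma Ck_opp (U W : normedModType R) k (A : set U) (f : U -> W) : open A ->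
  Ck k A f -> Ck k A (fun x => - f x).
Proof.
move=> oA Hf; apply: (@Ck_near _ _ _ _ (fun x => (-1 : R) *: f x)) => // [x _|].
  by rewrite scaleN1r.
by apply: Ck_scale => //; apply: Ck_cst.
Qed.

Lemma Ck_sum (U W : normedModType R) k (A : set U) (I : finType) (f : I -> U -> W) :
  open A -> (forall i, Ck k A (f i)) -> Ck k A (fun x => \sum_i f i x).
Proof.
move=> oA H; elim: (index_enum I) => [|i s IH].
  apply: (@Ck_near _ _ _ _ (fun=> 0)) => // [x _|]; first by rewrite big_nil.
  exact: Ck_cst.
apply: (@Ck_near _ _ _ _ (fun x => f i x + \sum_(j <- s) f j x)) => // [x _|].
  by rewrite big_cons.
exact: Ck_add.
Qed.

Lemma is_diff_inv (U : normedModType R) (a da : U -> R) x : a x != 0 ->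
  is_diff x a da -> is_diff x (fun y => (a y)^-1) (fun v => - (a x) ^- 2 * da v).
Proof.
move=> a0 Ha; apply: DiffDef; first by apply: differentiableV => //; apply: ex_diff.
by rewrite (diffV (ex_diff (is_diff_def := Ha)) a0) (diff_val (is_diff_def := Ha)).
Qed.

Lemma Ck_inv (U : normedModType R) k : forall (A : set U) (a : U -> R), open A ->
  (forall x, A x -> a x != 0) -> Ck k A a -> Ck k A (fun x => (a x)^-1).
Proof.
elim: k => [|k IH] A a oA a0 Ha.
  by move=> x Ax; apply: cvgV; [apply: a0|apply: Ha].
apply: (CkS (df := fun x v => - (a x) ^- 2 * 'd a x v)) => // [x Ax|v].
  by apply: is_diff_inv; [apply: a0|apply: CkS_diff Ha Ax].
apply: Ck_mul => //; last exact: Ckd.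
apply: Ck_opp => //; apply: (@Ck_near _ _ _ _ (fun x => (a x)^-1 * (a x)^-1)) => //.
  by move=> x _; rewrite expr2 invfM.
by apply: Ck_mul => //; apply: IH => //; apply: CkW.
Qed.

Section Row.
Variables (n : nat) (W : normedModType R).
Implicit Types f : 'rV[R]_n -> W.

Lemma lin_rV_continuous (L : {linear 'rV[R]_n -> W}) : continuous L.
Proof.
have -> : (L : _ -> _) = fun v => \sum_i v ord0 i *: L (delta_mx 0 i).
  apply/funext => v; rewrite {1}[v]row_sum_delta linear_sum.
  by apply: eq_bigr => i _; rewrite linearZ.
apply: (@continuous_big _ _ +%R); first exact: add_continuous.
move=> i _ v.
exact: (@cvgZr_tmp _ _ _ _ _ (fun w : 'rV[R]_n => w ord0 i) _ _ (@coord_continuous _ _ _ _ _ v)).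
Qed.

(** [Ck] speaks of derivatives in fixed directions only; this expansion handles directions that move
    with the point. *)
Lemma diff_row_sum f x v :
  'd f x v = \sum_i v ord0 i *: 'd f x (delta_mx 0 i).
Proof.
rewrite {1}[v]row_sum_delta linear_sum.
by apply: eq_bigr => i _; rewrite linearZ.
Qed.
End Row.

Lemma is_diff_lin n (U W : normedModType R) (L : {linear 'rV[R]_n -> W})
    (f df : U -> 'rV[R]_n) x :
  is_diff x f df -> is_diff x (fun y => L (f y)) (fun v => L (df v)).
Proof.
move=> Hf; have HL : is_diff (f x) L L.
  apply: DiffDef; first exact/linear_differentiable/lin_rV_continuous.
  by rewrite diff_lin //; apply: lin_rV_continuous.
exact: is_diff_comp Hf HL.
Qed.

Lemma Ck_lin n (U W : normedModType R) (L : {linear 'rV[R]_n -> W}) k :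
  forall (A : set U) (f : U -> 'rV[R]_n),
  open A -> Ck k A f -> Ck k A (fun y => L (f y)).
Proof.
elim: k => [|k IH] A f oA Hf.
  move=> x Ax; apply: (@continuous_comp _ _ _ f L); first exact: Hf.
  exact: lin_rV_continuous.
apply: (CkS (df := fun x v => L ('d f x v))) => // [x Ax|v].
  exact: is_diff_lin (CkS_diff Hf Ax).
by apply: IH => //; apply: Ckd.
Qed.

(** A coordinate as a named function, so that it can carry a linear structure. *)
Definition rowcoord n (i : 'I_n) (v : 'rV[R]_n) : R := v ord0 i.
Lemma rowcoord_is_linear n (i : 'I_n) : linear (@rowcoord n i).
Proof. by move=> a u v; rewrite /rowcoord !mxE. Qed.
HB.instance Definition _ n i :=
  GRing.isLinear.Build R 'rV[R]_n R _ (@rowcoord n i) (@rowcoord_is_linear n i).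

Lemma Ck_coord n (U : normedModType R) (i : 'I_n) k (A : set U) (f : U -> 'rV[R]_n) :
  open A -> Ck k A f -> Ck k A (fun y => f y ord0 i).
Proof. exact: (Ck_lin (@rowcoord n i)). Qed.

Lemma is_diff_coord n (U : normedModType R) (i : 'I_n) (f df : U -> 'rV[R]_n) x :
  is_diff x f df -> is_diff x (fun y => f y ord0 i) (fun v => df v ord0 i).
Proof. exact: (is_diff_lin (@rowcoord n i)). Qed.

(** The chain rule differentiates [f] in the moving direction ['d g x v], which is resolved into the
    basis of the intermediate space; hence that space consists of row vectors. *)
Lemma Ck_comp n (U W : normedModType R) k :
  forall (A : set 'rV[R]_n) (B : set U) (f : 'rV[R]_n -> W) (g : U -> 'rV[R]_n),
  open B -> (forall x, B x -> A (g x)) -> Ck k A f -> Ck k B g ->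
  Ck k B (fun x => f (g x)).
Proof.
elim: k => [|k IH] A B f g oB gBA Hf Hg.
  move=> x Bx; apply: (@continuous_comp _ _ _ g f); first exact: Hg.
  exact: Hf (gBA x Bx).
apply: (CkS (df := fun x v => 'd f (g x) ('d g x v))) => // [x Bx|v].
  exact: is_diff_comp (CkS_diff Hg Bx) (CkS_diff Hf (gBA x Bx)).
apply: (@Ck_near _ _ _ _
  (fun x => \sum_i ('d g x v) ord0 i *: 'd f (g x) (delta_mx 0 i))) => // [x _|].
  by rewrite [RHS]diff_row_sum.
apply: Ck_sum => // i; apply: Ck_scale => //.
  by apply: Ck_coord => //; apply: Ckd.
by apply: (IH A B (fun z => 'd f z (delta_mx 0 i)) g) => //; [apply: Ckd|apply: CkW].
Qed.

Lemma is_diff_dot n (U : normedModType R) (f df g dg : U -> 'rV[R]_n) x :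
  is_diff x f df -> is_diff x g dg ->
  is_diff x (fun y => dot (f y) (g y)) (fun v => dot (df v) (g x) + dot (f x) (dg v)).
Proof.
move=> Hf Hg.
have H i : is_diff x (fun y => f y ord0 i * g y ord0 i)
   (fun v => df v ord0 i * g x ord0 i + f x ord0 i * dg v ord0 i).
  apply: is_diff_ext (is_diffM (is_diff_coord i Hf) (is_diff_coord i Hg)) _ _ => // v.
  by rewrite /= addrC /GRing.scale /= mulrC.
apply: (@is_diff_ext _ _ (\sum_i (fun y => f y ord0 i * g y ord0 i)) _
   (\sum_i (fun v => df v ord0 i * g x ord0 i + f x ord0 i * dg v ord0 i))).
- elim: (index_enum _) => [|i s IH]; first by rewrite !big_nil; apply: is_diff_cst.
  by rewrite !big_cons; apply: is_diffD.
- by move=> y; rewrite fct_sumE.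
- by move=> v; rewrite fct_sumE big_split.
Qed.

Lemma Ck_dot n (U : normedModType R) k (A : set U) (f g : U -> 'rV[R]_n) :
  open A -> Ck k A f -> Ck k A g -> Ck k A (fun x => dot (f x) (g x)).
Proof. by move=> oA Hf Hg; apply: Ck_sum => // i; apply: Ck_mul => //; apply: Ck_coord. Qed.

End Calc.

(** Brings both orders of a scalar product, with or without [J], to one form, so that [ring] and
    [field] see equal atoms. *)
Ltac dsym x y := rewrite ?(dotC y x) ?(dotC y (J x)) ?dotJl.

(** * Derivatives along curves and compatibility of the metric *)

Section Curves.
Variables (R : realType).
Notation V := 'rV[R]_(2 + 2).
Lemma J_is_linear : linear (@J R).
Proof. by move=> a u v; rewrite JD JZ. Qed.
HB.instance Definition _ := GRing.isLinear.Build R V V _ (@J R) J_is_linear.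

(** Bridge between differentials and derivatives of curves; through it the chain and Leibniz rules
    for [is_diff] carry over to curves. *)
Lemma is_diff_derive (W : normedModType R) (c : R -> W) (t : R) (v : W) :
  is_diff (t : R^o) (c : R^o -> W) (fun h : R^o => h *: v) <-> is_derive t 1 c v.
Proof.
split=> [H|[H1 H2]].
  have D : differentiable (c : R^o -> W) (t : R^o) by apply: ex_diff.
  apply: DeriveDef; first exact: (diff_derivable D).
  by rewrite deriveE // (diff_val (is_diff_def := H)) scale1r.
have D : differentiable (c : R^o -> W) (t : R^o) by apply/derivable1_diffP.
apply: DiffDef => //.
by rewrite (diff1E D) derive1E H2.
Qed.

Lemma is_derive_diff_comp (U W : normedModType R) (f : U -> W) (df : U -> W)
   (c : R -> U) (t : R) (v : U) :
  is_diff (c t) f df -> is_derive t 1 c v -> is_derive t 1 (fun s => f (c s)) (df v).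
Proof.
move=> Hf /is_diff_derive Hc.
have dl : forall h : R, df (h *: v) = h *: df v.
  by move=> h; rewrite -(diff_val (is_diff_def := Hf)) linearZ.
by apply/is_diff_derive; apply: is_diff_ext (is_diff_comp Hc Hf) _ _.
Qed.

Lemma is_derive_scale (W : normedModType R) (a : R -> R) (c : R -> W) (t : R) (a' : R) (c' : W) :
  is_derive t 1 a a' -> is_derive t 1 c c' ->
  is_derive t 1 (fun s => a s *: c s) (a t *: c' + a' *: c t).
Proof.
move=> /is_diff_derive Ha /is_diff_derive Hc; apply/is_diff_derive.
apply: is_diff_ext (is_diff_scale Ha Hc) _ _ => // h.
by rewrite scalerDr !scalerA (mulrC h).
Qed.

Lemma is_derive_dot n (c d : R -> 'rV[R]_n) (t : R) (c' d' : 'rV[R]_n) :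
  is_derive t 1 c c' -> is_derive t 1 d d' ->
  is_derive t 1 (fun s => dot (c s) (d s)) (dot c' (d t) + dot (c t) d').
Proof.
move=> /is_diff_derive Ha /is_diff_derive Hc; apply/is_diff_derive.
apply: is_diff_ext (is_diff_dot Ha Hc) _ _ => // h.
by rewrite dotZl dotZr -mulrDr.
Qed.

Lemma is_derive_lin n (W : normedModType R) (L : {linear 'rV[R]_n -> W})
   (c : R -> 'rV[R]_n) (t : R) (c' : 'rV[R]_n) :
  is_derive t 1 c c' -> is_derive t 1 (fun s => L (c s)) (L c').
Proof.
move=> /is_diff_derive Ha; apply/is_diff_derive.
apply: is_diff_ext (is_diff_lin L Ha) _ _ => // h.
by rewrite linearZ.
Qed.

Lemma is_derive_J (c : R -> V) (t : R) (c' : V) :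
  is_derive t 1 c c' -> is_derive t 1 (fun s => J (c s)) (J c').
Proof. exact: is_derive_lin. Qed.

Lemma is_derive_add (W : normedModType R) (c d : R -> W) (t : R) (c' d' : W) :
  is_derive t 1 c c' -> is_derive t 1 d d' ->
  is_derive t 1 (fun s => c s + d s) (c' + d').
Proof. exact: is_deriveD. Qed.

Lemma is_derive_mul (a b : R -> R) (t a' b' : R) :
  is_derive t 1 a a' -> is_derive t 1 b b' ->
  is_derive t 1 (fun s => a s * b s) (a' * b t + a t * b').
Proof. by move=> Ha Hb; apply: is_derive_eq (is_derive_scale Ha Hb) _; rewrite addrC. Qed.

Lemma is_derive_opp (W : normedModType R) (c : R -> W) (t : R) (c' : W) :
  is_derive t 1 c c' -> is_derive t 1 (fun s => - c s) (- c').
Proof. exact: is_deriveN. Qed.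

Lemma is_derive_inv (a : R -> R) (t a' : R) : a t != 0 ->
  is_derive t 1 a a' -> is_derive t 1 (fun s => (a s)^-1) (- (a t) ^- 2 * a').
Proof.
move=> a0 /is_diff_derive Ha; apply/is_diff_derive.
apply: is_diff_ext (is_diff_inv a0 Ha) _ _ => // h.
by rewrite /GRing.scale /= mulrCA.
Qed.

Lemma is_derive_const (W : normedModType R) (w : W) (t : R) : is_derive t 1 (fun _ : R => w) 0.
Proof. exact: is_derive_cst. Qed.

Implicit Types (p q u v w x y z : V) (c X Y : R -> V).

Lemma dotuJ u : dot u (J u) = 0.
Proof.
have : dot u (J u) = - dot u (J u) by rewrite -dotJl dotC.
by move=> H; lra.
Qed.

Lemma dot_ge0 n (u : 'rV[R]_n) : 0 <= dot u u.
Proof. by apply: sumr_ge0 => i _; rewrite -expr2 sqr_ge0. Qed.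

Lemma dot_eq0 n (u : 'rV[R]_n) : (dot u u == 0) = (u == 0).
Proof.
apply/idP/eqP => [|->]; last by rewrite /dot big1 // => i _; rewrite mxE mul0r.
rewrite psumr_eq0 => [/allP H|i _]; last by rewrite -expr2 sqr_ge0.
apply/rowP => i; have := H i (mem_index_enum _).
by rewrite -expr2 sqrf_eq0 mxE => /eqP.
Qed.

Lemma dot_gt0 n (u : 'rV[R]_n) : u != 0 -> 0 < dot u u.
Proof. by move=> u0; rewrite lt_neqAle eq_sym dot_eq0 u0 dot_ge0. Qed.

Lemma dot0l n (u : 'rV[R]_n) : dot 0 u = 0.
Proof. by rewrite -(scale0r 0) dotZl mul0r. Qed.
Lemma dot0r n (u : 'rV[R]_n) : dot u 0 = 0.
Proof. by rewrite dotC dot0l. Qed.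
Lemma dotNl n (u v : 'rV[R]_n) : dot (- u) v = - dot u v.
Proof. by rewrite dotC dotNr dotC. Qed.
Lemma JN u : J (- u) = - J u.
Proof. by rewrite -scaleN1r JZ scaleN1r. Qed.
Lemma J0 : J 0 = 0 :> V.
Proof. by rewrite -[X in J X](scale0r (0 : V)) JZ scale0r. Qed.

Definition dotE := (dotDl, dotDr, dotZl, dotZr, dotNl, dotNr, dot0l, dot0r, JD, JZ, JN, J0, JJ, dotJl, dotJ, dotuJ).

(** Metric compatibility along an arbitrary curve with varying fields; [metric_christoffel] treats
    straight lines and constant vectors. *)
Lemma metric_curve c X Y (t : R) (c' X' Y' : V) : CH2 (c t) ->
  is_derive t 1 c c' -> is_derive t 1 X X' -> is_derive t 1 Y Y' ->
  is_derive t 1 (fun s => metric (c s) (X s) (Y s))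
   (metric (c t) (X' + christoffel (c t) c' (X t)) (Y t)
    + metric (c t) (X t) (Y' + christoffel (c t) c' (Y t))).
Proof.
move=> zin Hc HX HY.
have z1 : 1 - dot (c t) (c t) != 0 by rewrite subr_eq0 eq_sym lt_eqF.
have HD : is_derive t 1 (fun s => 1 - dot (c s) (c s))
   (- (dot c' (c t) + dot (c t) c')).
  have H := is_derive_add (is_derive_const (1 : R) t) (is_derive_opp (is_derive_dot Hc Hc)).
  by apply: (is_derive_eq H); rewrite add0r.
have HcJ := is_derive_J Hc.
have HN := is_derive_add (is_derive_add (is_derive_mul HD (is_derive_dot HX HY))
  (is_derive_mul (is_derive_dot HX Hc) (is_derive_dot HY Hc)))
  (is_derive_mul (is_derive_dot HX HcJ) (is_derive_dot HY HcJ)).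
have HDD := is_derive_mul HD HD.
have HI := is_derive_inv (a := fun s => (1 - dot (c s) (c s)) * (1 - dot (c s) (c s)))
  (mulf_neq0 z1 z1) HDD.
have HM := is_derive_mul HN HI.
rewrite (_ : (fun _ => _) = (fun s => ((1 - dot (c s) (c s)) * dot (X s) (Y s)
   + dot (X s) (c s) * dot (Y s) (c s) + dot (X s) (J (c s)) * dot (Y s) (J (c s)))
    * ((1 - dot (c s) (c s)) * (1 - dot (c s) (c s)))^-1)); last first.
  by apply/funext => s; rewrite /metric expr2.
apply: (is_derive_eq HM).
move: z1; rewrite /metric /christoffel.
move: (c t) (X t) (Y t) => z x y z1.
rewrite !dotE.
dsym z c'; dsym z x; dsym z y; dsym x y; dsym c' x; dsym c' y; dsym X' y; dsym x Y'.
by field; rewrite z1.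
Qed.

End Curves.

(** * Geodesics of the ball model *)

Section Geodesic.
Variables (R : realType).
Notation V := 'rV[R]_(2 + 2).
Implicit Types (p q u v w x y z : V).

Definition ch (t : R) := (expR t + expR (- t)) / 2.
Definition sh (t : R) := (expR t - expR (- t)) / 2.

Lemma is_derive_fext (W : normedModType R) (f g : R -> W) (t : R) (v : W) :
  is_derive t 1 f v -> f =1 g -> is_derive t 1 g v.
Proof. by move=> H /funext <-. Qed.

Lemma is_derive_expN (t : R) : is_derive t 1 (fun s : R => expR (- s)) (- expR (- t)).
Proof.
have H := @is_derive1_comp R expR -%R t _ _ (is_derive_expR _) (is_derive_opp (is_derive_id t 1)).
by apply: (is_derive_eq H); rewrite mulrN1.
Qed.

Lemma is_derive_ch (t : R) : is_derive t 1 ch (sh t).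
Proof.
have H := is_derive_mul (is_derive_add (is_derive_expR t) (is_derive_expN t)) (is_derive_const (2^-1 : R) t).
by apply: (is_derive_eq H); rewrite mulr0 addr0.
Qed.

Lemma is_derive_sh (t : R) : is_derive t 1 sh (ch t).
Proof.
have H := is_derive_mul (is_derive_add (is_derive_expR t) (is_derive_opp (is_derive_expN t))) (is_derive_const (2^-1 : R) t).
by apply: (is_derive_eq H); rewrite mulr0 addr0 opprK.
Qed.

Lemma ch_sh (t : R) : ch t ^+ 2 - sh t ^+ 2 = 1.
Proof.
have : expR t * expR (- t) = 1 by rewrite expRxMexpNx_1.
by rewrite /ch /sh => H; transitivity (expR t * expR (- t)); [field|].
Qed.

Lemma ch_gt0 (t : R) : 0 < ch t.
Proof. by rewrite divr_gt0 // addr_gt0 // expR_gt0. Qed.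

Lemma ch0 : ch 0 = 1. Proof. by rewrite /ch oppr0 expR0; field. Qed.
Lemma sh0 : sh 0 = 0. Proof. by rewrite /sh oppr0 subrr mul0r. Qed.
Lemma shN t : sh (- t) = - sh t. Proof. by rewrite /sh opprK -mulNr opprB. Qed.

(** The complex multiple (a + i b) v. *)
Definition cs (a b : R) v : V := a *: v + b *: J v.

(** Suffixes 1 and 2 stand for real and imaginary parts. Below, [omd] is |om|^2, and [sg1] + i [sg2]
    is sinh t / om. *)
Definition k1 p u : R := dot u p / (1 - dot p p).
Definition k2 p u : R := dot u (J p) / (1 - dot p p).
Definition om1 p u t := ch t + k1 p u * sh t.
Definition om2 p u t := k2 p u * sh t.
Definition omd p u t := om1 p u t ^+ 2 + om2 p u t ^+ 2.
Definition sg1 p u t := sh t * om1 p u t / omd p u t.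
Definition sg2 p u t := - (sh t * om2 p u t) / omd p u t.

(* In complex notation om = cosh t + k sinh t with k = <u, p> / (1 - |p|^2), and
   the geodesic is p + (sinh t / om) u. *)
Definition geoE p u (t : R) : V := p + cs (sg1 p u t) (sg2 p u t) u.
(* Its velocity, om^-2 u. *)
Definition geoV p u (t : R) : V :=
  cs ((om1 p u t ^+ 2 - om2 p u t ^+ 2) / omd p u t ^+ 2)
     (- (2 * om1 p u t * om2 p u t) / omd p u t ^+ 2) u.

Section Unit.
Variables (p u : V).
Hypotheses (hp : CH2 p) (hu : metric p u u = 1).

Let P := 1 - dot p p.
Lemma CH2_gt0 z : CH2 z -> 0 < 1 - dot z z. Proof. by rewrite subr_gt0. Qed.
Let P0 : 0 < P. Proof. exact: CH2_gt0. Qed.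

(** Eliminates [dot u u] in favour of k, after which the facts on unit speed geodesics are rational
    identities in k, cosh t and sinh t. *)
Lemma unit_norm : dot u u = (1 - k1 p u ^+ 2 - k2 p u ^+ 2) * (1 - dot p p).
Proof.
move: hu; rewrite /metric -/P => h.
have Pn : P != 0 by rewrite gt_eqF.
have : P * dot u u + dot u p * dot u p + dot u (J p) * dot u (J p) = P ^+ 2.
  by apply: (mulIf (x := (P ^+ 2)^-1)); rewrite ?h ?mulfV ?invr_eq0 ?expf_neq0.
move=> E; apply: (mulfI Pn); rewrite /k1 /k2 -/P.
transitivity (P ^+ 2 - dot u p * dot u p - dot u (J p) * dot u (J p)); last by field.
by rewrite -E; ring.
Qed.

Lemma k_lt1 : k1 p u ^+ 2 + k2 p u ^+ 2 < 1.
Proof.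
have u0 : u != 0.
  apply/eqP => u0; move: hu; rewrite u0 /metric !dotE => /eqP.
  by rewrite !(mulr0, mul0r, addr0) eq_sym oner_eq0.
have := dot_gt0 u0; rewrite unit_norm pmulr_lgt0 //; lra.
Qed.

(** A zero of om would give cosh t = |k| |sinh t|, which |k| < 1 and cosh^2 t - sinh^2 t = 1
    exclude. *)
Lemma omd_gt0 t : 0 < omd p u t.
Proof.
have := k_lt1; have := ch_sh t; have := ch_gt0 t; rewrite /omd /om1 /om2.
move: (k1 p u) (k2 p u) (ch t) (sh t) => a b C S C0 CS ab.
rewrite lt_neqAle addr_ge0 ?sqr_ge0 // andbT eq_sym; apply/negP.
rewrite paddr_eq0 ?sqr_ge0 // !sqrf_eq0 => /andP[/eqP h1 /eqP h2].
have : C ^+ 2 = (a ^+ 2 + b ^+ 2) * S ^+ 2.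
  by rewrite mulrDl -!exprMn h2 expr0n addr0 -[LHS]sqrrN; congr (_ ^+ 2); lra.
have : 0 <= S ^+ 2 by exact: sqr_ge0.
by nra.
Qed.

Lemma geoE0 : geoE p u 0 = p.
Proof. by rewrite /geoE /sg1 /sg2 sh0 !mul0r oppr0 mul0r /cs !scale0r !addr0. Qed.

Lemma geoV0 : geoV p u 0 = u.
Proof.
rewrite /geoV /omd /om1 /om2 sh0 ch0 !mulr0 addr0 expr0n addr0 subr0 expr1n.
by rewrite expr1n divr1 oppr0 mul0r /cs scale1r scale0r addr0.
Qed.

(** As [omd] is positive, this keeps the curve in the ball; later it measures how close a geodesic
    is to the sphere at infinity. *)
Lemma geoE_norm t : 1 - dot (geoE p u t) (geoE p u t) = (1 - dot p p) / omd p u t.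
Proof.
have D0 : omd p u t != 0 by rewrite gt_eqF // omd_gt0.
have Pn : P != 0 by rewrite gt_eqF.
have E1 : dot u p = k1 p u * P by rewrite /k1 -/P mulfVK.
have E2 : dot u (J p) = k2 p u * P by rewrite /k2 -/P mulfVK.
rewrite /geoE /cs !dotE (dotC p u) (dotC p (J u)) !dotJl E1 E2 unit_norm -/P.
rewrite (_ : dot p p = 1 - P); last by rewrite /P; ring.
(* Writing a factor 1 as cosh^2 t - sinh^2 t makes the identity homogeneous, hence provable without
   relating cosh t and sinh t. *)
transitivity (P * (ch t ^+ 2 - sh t ^+ 2) / omd p u t); last by rewrite ch_sh mulr1.
rewrite /sg1 /sg2.
move: D0; rewrite /omd /om1 /om2.
move: (k1 p u) (k2 p u) (ch t) (sh t) (P) => a b C S Q D0.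
by field; rewrite D0.
Qed.

Lemma geoE_in t : CH2 (geoE p u t).
Proof. by rewrite /CH2 /= -subr_gt0 geoE_norm divr_gt0 ?omd_gt0. Qed.

Lemma is_derive_om1 (t : R) : is_derive t 1 (om1 p u) (sh t + k1 p u * ch t).
Proof.
have H := is_derive_add (is_derive_ch t) (is_derive_mul (is_derive_const (k1 p u) t) (is_derive_sh t)).
by apply: (is_derive_eq H); rewrite mul0r add0r.
Qed.

Lemma is_derive_om2 (t : R) : is_derive t 1 (om2 p u) (k2 p u * ch t).
Proof.
have H := is_derive_mul (is_derive_const (k2 p u) t) (is_derive_sh t).
by apply: (is_derive_eq H); rewrite mul0r add0r.
Qed.

Lemma is_derive_omd (t : R) : is_derive t 1 (omd p u)
  (2 * (om1 p u t * (sh t + k1 p u * ch t) + om2 p u t * (k2 p u * ch t))).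
Proof.
have H := is_derive_add (is_derive_mul (is_derive_om1 t) (is_derive_om1 t))
  (is_derive_mul (is_derive_om2 t) (is_derive_om2 t)).
rewrite (_ : omd p u = fun s => om1 p u s * om1 p u s + om2 p u s * om2 p u s).
  by apply: (is_derive_eq H); ring.
by apply/funext => s; rewrite /omd !expr2.
Qed.

Lemma is_derive_cs (a b : R -> R) (t a' b' : R) v : is_derive t 1 a a' -> is_derive t 1 b b' ->
  is_derive t 1 (fun s => cs (a s) (b s) v) (cs a' b' v).
Proof.
move=> Ha Hb.
have H := is_derive_add (is_derive_scale Ha (is_derive_const v t)) (is_derive_scale Hb (is_derive_const (J v) t)).
by apply: (is_derive_eq H); rewrite !scaler0 !add0r.
Qed.

Lemma is_derive_geoE (t : R) : is_derive t 1 (geoE p u) (geoV p u t).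
Proof.
have D0 : omd p u t != 0 by rewrite gt_eqF // omd_gt0.
have HI := is_derive_inv D0 (is_derive_omd t).
have H1 := is_derive_mul (is_derive_mul (is_derive_sh t) (is_derive_om1 t)) HI.
have H2 := is_derive_mul (is_derive_opp (is_derive_mul (is_derive_sh t) (is_derive_om2 t))) HI.
have H := is_derive_add (is_derive_const p t) (is_derive_cs u H1 H2).
apply: (is_derive_eq H); rewrite add0r /geoV; congr (cs _ _ u).
- transitivity ((om1 p u t ^+ 2 - om2 p u t ^+ 2) * (ch t ^+ 2 - sh t ^+ 2) / omd p u t ^+ 2);
    last by rewrite ch_sh mulr1.
  move: D0; rewrite /omd /om1 /om2.
  move: (k1 p u) (k2 p u) (ch t) (sh t) => a b C S D0.
  by field; rewrite D0.
- transitivity (- (2 * om1 p u t * om2 p u t) * (ch t ^+ 2 - sh t ^+ 2) / omd p u t ^+ 2);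
    last by rewrite ch_sh mulr1.
  move: D0; rewrite /omd /om1 /om2.
  move: (k1 p u) (k2 p u) (ch t) (sh t) => a b C S D0.
  by field; rewrite D0.
Qed.

(** This and [geoE_S] give the Hermitian product of velocity and position, all that [christoffel]
    needs along the curve. *)
Lemma geoE_C (t : R) : dot (geoV p u t) (geoE p u t) =
   (om1 p u t * (sh t + k1 p u * ch t) + om2 p u t * (k2 p u * ch t)) * P / omd p u t ^+ 2.
Proof.
have D0 : omd p u t != 0 by rewrite gt_eqF // omd_gt0.
have Pn : P != 0 by rewrite gt_eqF.
have E1 : dot u p = k1 p u * P by rewrite /k1 -/P mulfVK.
have E2 : dot u (J p) = k2 p u * P by rewrite /k2 -/P mulfVK.
rewrite /geoE /geoV /cs !dotE E1 E2 unit_norm -/P /sg1 /sg2.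
move: D0; rewrite /omd /om1 /om2.
move: (k1 p u) (k2 p u) (ch t) (sh t) (P) => a b C S Q D0.
by field; rewrite D0.
Qed.

Lemma geoE_S (t : R) : dot (geoV p u t) (J (geoE p u t)) =
   (om1 p u t * (k2 p u * ch t) - om2 p u t * (sh t + k1 p u * ch t)) * P / omd p u t ^+ 2.
Proof.
have D0 : omd p u t != 0 by rewrite gt_eqF // omd_gt0.
have Pn : P != 0 by rewrite gt_eqF.
have E1 : dot u p = k1 p u * P by rewrite /k1 -/P mulfVK.
have E2 : dot u (J p) = k2 p u * P by rewrite /k2 -/P mulfVK.
rewrite /geoE /geoV /cs !dotE E1 E2 unit_norm -/P /sg1 /sg2.
move: D0; rewrite /omd /om1 /om2.
move: (k1 p u) (k2 p u) (ch t) (sh t) (P) => a b C S Q D0.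
by field; rewrite D0.
Qed.

Lemma is_derive_geoV (t : R) : is_derive t 1 (geoV p u)
  (- christoffel (geoE p u t) (geoV p u t) (geoV p u t)).
Proof.
have D0 : omd p u t != 0 by rewrite gt_eqF // omd_gt0.
have Pn : P != 0 by rewrite gt_eqF.
have HDD := is_derive_mul (is_derive_omd t) (is_derive_omd t).
have HI := is_derive_inv (a := fun s => omd p u s * omd p u s) (mulf_neq0 D0 D0) HDD.
have H1 := is_derive_mul (is_derive_add (is_derive_mul (is_derive_om1 t) (is_derive_om1 t))
   (is_derive_opp (is_derive_mul (is_derive_om2 t) (is_derive_om2 t)))) HI.
have H2 := is_derive_mul (is_derive_opp (is_derive_mul (is_derive_const (2 : R) t)
   (is_derive_mul (is_derive_om1 t) (is_derive_om2 t)))) HI.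
have H := is_derive_cs u H1 H2.
apply: (is_derive_fext (is_derive_eq H _)) => [|s]; last first.
  by rewrite /geoV !expr2 !mulrA.
rewrite /christoffel geoE_C geoE_S geoE_norm /geoV -/P.
rewrite /cs !JD !JZ JJ.
move: D0; rewrite /omd /om1 /om2.
move: (k1 p u) (k2 p u) (ch t) (sh t) (P) Pn => a b C S Q Qn D0.
move: (J u) => Ju; apply/rowP => i; rewrite !mxE.
move: (u ord0 i) (Ju ord0 i) => x y; rewrite !mul0r !add0r.
by field; rewrite D0 Qn.
Qed.

End Unit.

Lemma Ck_exp k : forall (a : R), Ck k setT (fun t : R^o => expR (a * t) : R).
Proof.
elim: k => [|k IH] a.
  move=> x _; apply: (@continuous_comp R R R (fun t : R => a * t) (@expR R)); last exact: continuous_expR.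
  by apply: cvgM; [exact: cvg_cst|exact: cvg_id].
apply: (@CkS R R^o R k setT _ (fun t h => h *: (a * expR (a * t)))) => [|x _|v].
- exact: openT.
- apply/is_diff_derive.
  have H := @is_derive1_comp R expR (fun t => a * t) x _ _ (is_derive_expR _)
    (is_derive_mul (is_derive_const a x) (is_derive_id x 1)).
  by apply: (is_derive_eq H); ring.
- apply: Ck_mul; [exact: openT|apply: Ck_cst; exact: openT|].
  by apply: Ck_mul; [exact: openT|apply: Ck_cst; exact: openT|].
Qed.

Lemma Ck_ch k : Ck k setT (ch : R^o -> R).
Proof.
apply: (@Ck_near _ _ _ _ _ (fun t : R^o => 2^-1 * (expR (1 * t) + expR (-1 * t)))) => [|t _|].
- exact: openT.
- by rewrite mul1r mulN1r mulrC.
- by repeat first [apply: Ck_exp | apply: Ck_cst; exact: openT | apply: Ck_mul; [exact: openT| |] | apply: Ck_add; [exact: openT| |]].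
Qed.

Lemma Ck_sh k : Ck k setT (sh : R^o -> R).
Proof.
apply: (@Ck_near _ _ _ _ _ (fun t : R^o => 2^-1 * (expR (1 * t) + - expR (-1 * t)))) => [|t _|].
- exact: openT.
- by rewrite mul1r mulN1r mulrC.
- by repeat first [apply: Ck_exp | apply: Ck_cst; exact: openT | apply: Ck_mul; [exact: openT| |] | apply: Ck_add; [exact: openT| |] | apply: Ck_opp; first exact: openT].
Qed.

Lemma smooth_geoE p u : CH2 p -> metric p u u = 1 -> smooth_curve (geoE p u).
Proof.
move=> hp hu k.
have oT : open (setT : set R^o) by exact: openT.
have H1 : Ck k setT (om1 p u : R^o -> R).
  by apply: Ck_add => //; [apply: Ck_ch|apply: Ck_mul => //; [apply: Ck_cst|apply: Ck_sh]].
have H2 : Ck k setT (om2 p u : R^o -> R).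
  by apply: Ck_mul => //; [apply: Ck_cst|apply: Ck_sh].
have HD : Ck k setT ((fun t => (omd p u t)^-1) : R^o -> R).
  apply: Ck_inv => // [t _|]; first by rewrite gt_eqF // omd_gt0.
  by apply: Ck_add => //; apply: Ck_mul.
apply: Ck_add => //; first exact: Ck_cst.
apply: Ck_add => //; (apply: Ck_scale => //; last exact: Ck_cst); apply: Ck_mul => //.
  by apply: Ck_mul => //; apply: Ck_sh.
by apply: Ck_opp => //; apply: Ck_mul => //; apply: Ck_sh.
Qed.

Lemma is_derive1 (W : normedModType R) (c : R -> W) (t : R) (v : W) : is_derive t 1 c v -> derive1 c t = v.
Proof. by rewrite derive1E => -[_]. Qed.

Lemma geoE_geodesic p u : CH2 p -> metric p u u = 1 -> is_geodesic (geoE p u).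
Proof.
move=> hp hu; split; [exact: smooth_geoE|exact: geoE_in|] => t.
have E : derive1 (geoE p u) = geoV p u.
  by apply/funext => s; apply: is_derive1 (is_derive_geoE hp hu s).
by rewrite /cov_accel E (is_derive1 (is_derive_geoV hp hu t)) addNr.
Qed.

Lemma smooth_derive1 (c : R -> V) : smooth_curve c ->
  (forall t : R, is_derive t 1 c (derive1 c t)) /\ smooth_curve (derive1 c).
Proof.
move=> Hc; have D (t : R) : is_derive t 1 c (derive1 c t).
  have [/(_ t I) H _] := Hc 1%N.
  by apply: DeriveDef; [apply/derivable1_diffP|rewrite derive1E].
split=> // k; have [H /(_ 1) H1] := Hc k.+1.
apply: (@Ck_near _ _ _ _ _ (fun x : R^o => 'd c x 1)) => // [|x _]; first exact: openT.
by have /is_diff_derive/(@diff_val _ _ _ _ _ _ _) -> := D x; rewrite scale1r.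
Qed.

(** The geodesic equation as a first order system, the form suited to a Gronwall argument. *)
Definition geodesic_system (c v : R -> V) := forall t : R,
  [/\ CH2 (c t), is_derive t 1 c (v t) & is_derive t 1 v (- christoffel (c t) (v t) (v t))].

Lemma geodesic_systemP (c : R -> V) : is_geodesic c -> geodesic_system c (derive1 c).
Proof.
move=> [sc cin cov] t; have [D sd] := smooth_derive1 sc.
have [D2 _] := smooth_derive1 sd.
split=> //; move/eqP: (cov t); rewrite addr_eq0 => /eqP <-; exact: D2.
Qed.

Lemma dot_CauchySchwarz n (u v : 'rV[R]_n) : dot u v ^+ 2 <= dot u u * dot v v.
Proof.
have [->|v0] := eqVneq v 0; first by rewrite !dot0r expr0n mulr0.
have := dot_ge0 (dot v v *: u - dot u v *: v).
rewrite !(dotDl, dotDr, dotNl, dotNr, dotZl, dotZr) (dotC v u).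
have := dot_gt0 v0; move: (dot v v) (dot u v) (dot u u) => a b c a0 H.
have : 0 <= a * (a * c - b ^+ 2) by move: H; congr (_ <= _); ring.
by rewrite pmulr_rge0 // subr_ge0 mulrC.
Qed.

Definition enorm n (u : 'rV[R]_n) : R := Num.sqrt (dot u u).
Lemma enorm_ge0 n (u : 'rV[R]_n) : 0 <= enorm u. Proof. exact: sqrtr_ge0. Qed.
Lemma enorm2 n (u : 'rV[R]_n) : enorm u ^+ 2 = dot u u.
Proof. by rewrite sqr_sqrtr // dot_ge0. Qed.
Lemma dot_enorm n (u v : 'rV[R]_n) : `|dot u v| <= enorm u * enorm v.
Proof.
by rewrite -sqrtrM ?dot_ge0 // -sqrtr_sqr ler_wsqrtr // dot_CauchySchwarz.
Qed.
Lemma enormJ u : enorm (J u) = enorm u. Proof. by rewrite /enorm dotJ. Qed.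

(** Multiplied by [expR (- K * t)], the function [D] acquires a nonpositive derivative on the
    interval. *)
Lemma gronwall0 (D D' : R -> R) K T : 0 <= T ->
  (forall t : R, is_derive t 1 D (D' t)) ->
  (forall t, 0 <= t <= T -> D' t <= K * D t) -> D 0 = 0 -> D T <= 0.
Proof.
move=> T0 HD Hle D0.
pose g t := D t * expR (- K * t).
have Hg (t : R) : is_derive t 1 g ((D' t - K * D t) * expR (- K * t)).
  have He := @is_derive1_comp R expR (fun t => - K * t) t _ _ (is_derive_expR _)
    (is_derive_mul (is_derive_const (- K) t) (is_derive_id t 1)).
  by apply: (is_derive_eq (is_derive_mul (HD t) He)) => /=; ring.
have [|x xT] := @MVT_segment R g _ 0 T T0 (fun (x : R) _ => Hg x).
  apply: continuous_subspaceT => x; apply/differentiable_continuous/derivable1_diffP.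
  by have [] := Hg x.
rewrite /g D0 mul0r !subr0 => E.
have : D T * expR (- K * T) <= 0.
  rewrite E; apply: mulr_le0_ge0 => //; apply: mulr_le0_ge0; last exact: expR_ge0.
  by rewrite subr_le0; apply: Hle; move: xT; rewrite in_itv.
by rewrite pmulr_lle0 // expR_gt0.
Qed.

Lemma normM_le (x y a b : R) : `|x| <= a -> `|y| <= b -> `|x * y| <= a * b.
Proof. by move=> H1 H2; rewrite normrM ler_pM. Qed.
Lemma normD_le (x y a b : R) : `|x| <= a -> `|y| <= b -> `|x + y| <= a + b.
Proof. by move=> H1 H2; apply: le_trans (ler_normD _ _) _; apply: lerD. Qed.
Lemma dot_le n (u v : 'rV[R]_n) a b : enorm u <= a -> enorm v <= b -> `|dot u v| <= a * b.
Proof. by move=> H1 H2; apply: le_trans (dot_enorm _ _) _; rewrite ler_pM ?enorm_ge0. Qed.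

(** The left side is the derivative of the squared distance between two solutions with states (x, a)
    and (y, b); the bound is the hypothesis of [gronwall0]. *)
Lemma christoffel_lip (x y a b : V) (m : R) : CH2 x -> CH2 y ->
  (1 - dot x x)^-1 <= m -> (1 - dot y y)^-1 <= m -> enorm a <= m -> enorm b <= m ->
  2 * dot (x - y) (a - b) + 2 * dot (a - b) (christoffel y b b - christoffel x a a) <=
  (1 + 8 * m ^+ 4 + 4 * m ^+ 3 + 12 * m ^+ 2)
   * (dot (x - y) (x - y) + dot (a - b) (a - b)).
Proof.
move=> hx hy mx my ma mb.
have x0 := CH2_gt0 hx; have y0 := CH2_gt0 hy.
have x1 : enorm x <= 1 by rewrite -sqrtr1 ler_wsqrtr // ltW.
have y1 : enorm y <= 1 by rewrite -sqrtr1 ler_wsqrtr // ltW.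
pose d := x - y; pose e := a - b.
rewrite -/d -/e.
have Ea : a = e + b by rewrite /e subrK.
have Ex : x = d + y by rewrite /d subrK.
set h1 := (1 - dot x x)^-1 in mx *; set h2 := (1 - dot y y)^-1 in my *.
(* Every term on the right carries two factors among [d] and [e], the difference [h1 - h2] being h1
   h2 (|x|^2 - |y|^2); so the estimate is quadratic in the distance. *)
have E : dot e (christoffel y b b - christoffel x a a) = - 2 *
  (h1 * h2 * (dot d x + dot d y) * (dot a x * dot e a + dot a (J x) * dot e (J a)) +
   h2 * (dot a x * dot e e + dot e x * dot e b + dot b d * dot e b
     + dot e (J x) * dot e (J b) + dot b (J d) * dot e (J b))).
  have Eh : h1 * h2 * (dot d x + dot d y) = h1 - h2.
    rewrite /h1 /h2 /d !dotE (dotC y x); field.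
    by rewrite !gt_eqF.
  rewrite Eh /christoffel -/h1 -/h2.
  clear Eh mx my; clearbody h1 h2 d e.
  rewrite Ea Ex !dotE.
  dsym e b; dsym e d; dsym e y; dsym b d; dsym b y; dsym d y.
  by ring.
rewrite E.
have hX := enorm_ge0 d; have hY := enorm_ge0 e.
have hm : 0 <= m by apply: le_trans mx; rewrite invr_ge0 ltW.
have nh1 : `|h1| <= m by rewrite ger0_norm // invr_ge0 ltW.
have nh2 : `|h2| <= m by rewrite ger0_norm // invr_ge0 ltW.
set X := enorm d in hX *; set Y := enorm e in hY *.
have eJ (w : V) r : enorm w <= r -> enorm (J w) <= r by rewrite enormJ.
have dd : enorm d <= X by []. have ee : enorm e <= Y by [].
have BT : `|h1 * h2 * (dot d x + dot d y) * (dot a x * dot e a + dot a (J x) * dot e (J a)) +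
   h2 * (dot a x * dot e e + dot e x * dot e b + dot b d * dot e b
     + dot e (J x) * dot e (J b) + dot b (J d) * dot e (J b))| <=
   m * m * (X * 1 + X * 1) * (m * 1 * (Y * m) + m * 1 * (Y * m)) +
   m * (m * 1 * (Y * Y) + Y * 1 * (Y * m) + m * X * (Y * m) + Y * 1 * (Y * m) + m * X * (Y * m)).
  by repeat first [assumption | simple apply normD_le | simple apply normM_le
    | simple apply dot_le | simple apply eJ].
have B2 : `|dot d e| <= X * Y by apply: dot_le.
move: BT B2; rewrite !ler_norml => /andP[BT _] /andP[_ B2].
set T := (h1 * h2 * _ * _ + _) in BT *.
move: T BT (dot d e) B2 => T BT de B2; rewrite -(enorm2 d) -(enorm2 e) -/X -/Y.
rewrite -subr_ge0.
set B := (X in - X <= T) in BT.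
(* The constant comes from 2 X Y <= X^2 + Y^2 applied to the mixed terms of 2 X Y + 4 [B]; the
   remaining term 12 m^2 Y^2 is already a square. *)
apply: (@le_trans _ _ ((1 + 8 * m ^+ 4 + 4 * m ^+ 3) * (X - Y) ^+ 2 + 12 * m ^+ 2 * X ^+ 2)).
  by rewrite addr_ge0 // mulr_ge0 ?sqr_ge0 // ?mulr_ge0 ?exprn_ge0 // !addr_ge0 // !mulr_ge0 ?exprn_ge0.
have -> : (1 + 8 * m ^+ 4 + 4 * m ^+ 3) * (X - Y) ^+ 2 + 12 * m ^+ 2 * X ^+ 2 =
   (1 + 8 * m ^+ 4 + 4 * m ^+ 3 + 12 * m ^+ 2) * (X ^+ 2 + Y ^+ 2) - (2 * (X * Y) + 4 * B).
  by rewrite /B; ring.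
by lra.
Qed.

Lemma continuous_bound (f : R -> R) T : 0 <= T -> continuous f -> exists M, forall t, 0 <= t <= T -> f t <= M.
Proof.
move=> T0 cf; have [|c _ H] := EVT_max (f := f) T0; first exact: continuous_subspaceT.
by exists (f c) => t tT; apply: H; rewrite in_itv.
Qed.

Lemma is_derive_cont (W : normedModType R) (c : R -> W) (t : R) (v : W) :
  is_derive t 1 c v -> {for t, continuous c}.
Proof. by case=> /derivable1_diffP/differentiable_continuous. Qed.

Lemma geodesic_unique_ge0 (c v d w : R -> V) : geodesic_system c v -> geodesic_system d w ->
  c 0 = d 0 -> v 0 = w 0 -> forall T, 0 <= T -> c T = d T.
Proof.
move=> Hc Hd E0 F0 T T0.
(* One bound for the conformal factors and the speeds of both solutions, by compactness of the time
   interval. *)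
have [M HM] : exists M, forall t, 0 <= t <= T -> (1 - dot (c t) (c t))^-1 + (1 - dot (d t) (d t))^-1
   + enorm (v t) + enorm (w t) <= M.
  apply: continuous_bound => // t.
  have [c1 c2 c3] := Hc t; have [d1 d2 d3] := Hd t.
  have q (g : R -> V) g' : CH2 (g t) -> is_derive t 1 g g' -> {for t, continuous (fun s => (1 - dot (g s) (g s))^-1)}.
    move=> h1 h2; apply: (is_derive_cont (is_derive_inv (a := fun s => 1 - dot (g s) (g s)) _ (is_derive_add (is_derive_const (1 : R) t) (is_derive_opp (is_derive_dot h2 h2))))).
    by rewrite gt_eqF // CH2_gt0.
  have r (g : R -> V) g' : is_derive t 1 g g' -> {for t, continuous (fun s => enorm (g s))}.
    move=> h2; apply: (@continuous_comp _ _ _ (fun s => dot (g s) (g s)) Num.sqrt).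
      exact: is_derive_cont (is_derive_dot h2 h2).
    exact: sqrt_continuous.
  by apply: cvgD; [apply: cvgD; [apply: cvgD|]|]; [apply: q c2|apply: q d2|apply: r c3|apply: r d3].
pose D t := dot (c t - d t) (c t - d t) + dot (v t - w t) (v t - w t).
suff D0 : D T <= 0.
  have /eqP : D T == 0 by rewrite eq_le D0 addr_ge0 ?dot_ge0.
  move=> /eqP; rewrite paddr_eq0 ?dot_ge0 // dot_eq0 => /andP[/eqP + _].
  by move/subr0_eq.
have HD (t : R) : is_derive t 1 D (2 * dot (c t - d t) (v t - w t) +
   2 * dot (v t - w t) (christoffel (d t) (w t) (w t) - christoffel (c t) (v t) (v t))).
  have [c1 c2 c3] := Hc t; have [d1 d2 d3] := Hd t.
  have A1 := is_derive_add c2 (is_derive_opp d2).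
  have A2 := is_derive_add c3 (is_derive_opp d3).
  apply: (is_derive_eq (is_derive_add (is_derive_dot A1 A1) (is_derive_dot A2 A2))).
  rewrite opprK (addrC (- christoffel _ _ _)) (dotC (v t - w t) (c t - d t)) (dotC (_ - christoffel _ _ _)).
  by ring.
apply: (gronwall0 T0 HD (K := 1 + 8 * M ^+ 4 + 4 * M ^+ 3 + 12 * M ^+ 2)) => [t tT|]; last first.
  by rewrite /D E0 F0 !subrr !dotE addr0.
have [c1 c2 c3] := Hc t; have [d1 d2 d3] := Hd t.
have := HM t tT.
have := enorm_ge0 (v t); have := enorm_ge0 (w t).
have : 0 <= (1 - dot (c t) (c t))^-1 by rewrite invr_ge0 ltW // CH2_gt0.
have : 0 <= (1 - dot (d t) (d t))^-1 by rewrite invr_ge0 ltW // CH2_gt0.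
move=> ? ? ? ? ?; apply: christoffel_lip => //; lra.
Qed.

Lemma christoffelNN z u : christoffel z (- u) (- u) = christoffel z u u.
Proof. by rewrite /christoffel !dotE !scalerN !scaleNr !opprK. Qed.

Lemma geodesic_systemN (c v : R -> V) : geodesic_system c v ->
  geodesic_system (fun t => c (- t)) (fun t => - v (- t)).
Proof.
move=> H t; have [c1 c2 c3] := H (- t).
have rev (g : R -> V) g' : is_derive (- t) 1 g g' -> is_derive t 1 (fun s => g (- s)) (- g').
  move=> /is_diff_derive Hg.
  have := is_derive_diff_comp (c := fun s => - s) Hg (is_derive_opp (is_derive_id t 1)).
  by rewrite scaleN1r.
split; [exact: c1|exact: rev|].
by rewrite christoffelNN -[X in is_derive _ _ _ X]opprK; apply: is_derive_opp; apply: rev.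
Qed.

Lemma geodesic_unique (c d : R -> V) : is_geodesic c -> is_geodesic d ->
  c 0 = d 0 -> derive1 c 0 = derive1 d 0 -> c = d.
Proof.
move=> /geodesic_systemP Hc /geodesic_systemP Hd E0 F0; apply/funext => T.
have [T0|/ltW T0] := leP 0 T; first exact: (geodesic_unique_ge0 Hc Hd).
have := @geodesic_unique_ge0 _ _ _ _ (geodesic_systemN Hc) (geodesic_systemN Hd) _ _ (- T).
by rewrite !oppr0 opprK F0; apply => //; rewrite oppr_ge0.
Qed.

(** By uniqueness, any geodesic with the right initial data is the one chosen by [geod], so the
    default value never appears. *)
Lemma geodP (p u : V) (c : R -> V) : is_geodesic c -> c 0 = p -> derive1 c 0 = u -> geod p u = c.
Proof.
move=> Hc c0 c1; rewrite /geod; case: xgetP => [d -> [Hd d0 d1]|/(_ c)].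
  by apply: geodesic_unique => //; rewrite ?c0 ?c1.
by case.
Qed.

Lemma geodE p u : CH2 p -> metric p u u = 1 -> geod p u = geoE p u.
Proof.
move=> hp hu; apply: geodP; [exact: geoE_geodesic|exact: geoE0|].
by rewrite (is_derive1 (is_derive_geoE hp hu 0)) geoV0.
Qed.

Lemma metricZ p u (l : R) : metric p (l *: u) (l *: u) = l ^+ 2 * metric p u u.
Proof. by rewrite /metric !dotE [RHS]mulrA; congr (_ / _); ring. Qed.

Lemma smooth_curve_scale (c : R -> V) (l : R) : smooth_curve c -> smooth_curve (fun t => c (l * t)).
Proof.
move=> Hc k; elim: k c Hc => [|k IH] c Hc.
  move=> x _; apply: (@continuous_comp R R V (fun t : R => l * t) c).
    by apply: cvgM; [exact: cvg_cst|exact: cvg_id].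
  exact: (Hc 0%N).
have [D sd] := smooth_derive1 Hc.
apply: (@CkS R R^o V k setT _ (fun t h => h *: (l *: derive1 c (l * t)))) => [|x _|v]; first exact: openT.
  apply/is_diff_derive; have /is_diff_derive Hg := D (l * x).
  have := is_derive_diff_comp (c := fun s => l * s) Hg (is_derive_mul (is_derive_const l x) (is_derive_id x 1)).
  by rewrite mul0r add0r mulr1.
apply: Ck_scale; [exact: openT|apply: Ck_cst; exact: openT|].
by apply: Ck_scale; [exact: openT|apply: Ck_cst; exact: openT|apply: IH].
Qed.

(** The closed formula holds for unit vectors, whereas [geod] takes any initial vector; the case
    [l = 0] covers the constant geodesic. *)
Lemma geodEZ p u (l t : R) : CH2 p -> metric p u u = 1 -> geod p (l *: u) t = geoE p u (l * t).
Proof.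
move=> hp hu.
have sc (g g' : R -> V) (s : R) : (forall s : R, is_derive s 1 g (g' s)) -> is_derive s 1 (fun s => g (l * s)) (l *: g' (l * s)).
  move=> Hg; have /is_diff_derive Hgs := Hg (l * s).
  have := is_derive_diff_comp (c := fun s => l * s) Hgs (is_derive_mul (is_derive_const l s) (is_derive_id s 1)).
  by rewrite mul0r add0r mulr1.
have D1 s := sc _ _ s (is_derive_geoE hp hu).
have D2 (s : R) := is_derive_scale (is_derive_const l s) (sc _ _ s (is_derive_geoV hp hu)).
have E : derive1 (fun s => geoE p u (l * s)) = fun s => l *: geoV p u (l * s).
  by apply/funext => s; apply: is_derive1.
rewrite (geodP (c := fun s => geoE p u (l * s))) //.
- split=> [|s|s]; first exact: smooth_curve_scale (smooth_geoE hp hu).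
    exact: geoE_in.
  rewrite /cov_accel E (is_derive1 (D2 s)) scale0r addr0 scalerN scalerN.
  rewrite /christoffel !dotE.
  apply/rowP => i; rewrite !mxE; ring.
- by rewrite mulr0 geoE0.
- by rewrite E mulr0 geoV0.
Qed.

End Geodesic.

(** * Kernels in dimension four and complex multiples *)

Section LinAlg.
Variable R : realType.
Notation V := 'rV[R]_(2 + 2).

Lemma lin_kernel_nz (L : {linear V -> 'rV[R]_2}) : exists2 v, v != 0 & L v = 0.
Proof.
set A := lin1_mx L.
have K0 : kermx A != 0.
  rewrite -mxrank_eq0 mxrank_ker -lt0n subn_gt0.
  exact: leq_ltn_trans (rank_leq_col A) _.
exists (nz_row (kermx A)); first by rewrite nz_row_eq0.
rewrite -(mul_rV_lin1 L) -/A; apply/eqP.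
by rewrite -sub_kermx; exact: nz_row_sub.
Qed.

Lemma cs_inj (a b : R) (v : V) : v != 0 -> cs a b v = 0 -> a = 0 /\ b = 0.
Proof.
move=> v0 E; have V0 : dot v v != 0 by rewrite dot_eq0.
have := congr1 (fun w => dot w v) E; have := congr1 (fun w => dot w (J v)) E.
rewrite /cs !dotE !opprK ?mulr0 ?add0r ?addr0 ?oppr0 ?mulr0 ?addr0 => /eqP + /eqP.
by rewrite !mulf_eq0 (negbTE V0) !orbF => /eqP -> /eqP ->.
Qed.

(** The kernel of a surjection from dimension 4 to dimension 2 has rank 2, and the independent
    vectors [v] and [J v] already span rank 2. *)
Lemma lin_kernel_span (L : {linear V -> 'rV[R]_2}) (v w : V) :
  (forall b, exists x, L x = b) -> v != 0 -> L v = 0 -> L (J v) = 0 -> L w = 0 ->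
  exists a b, w = cs a b v.
Proof.
move=> surj v0 Lv LJv Lw.
set A := lin1_mx L.
have rA : \rank A = 2%N.
  apply/eqP; rewrite -[_ == _]/(row_full A) -sub1mx; apply/row_subP => i.
  have [x xE] := surj (row i 1%:M).
  by rewrite -xE -(mul_rV_lin1 L); exact: submxMl.
pose B := col_mx v (J v).
have BK : (B <= kermx A)%MS.
  by rewrite col_mx_sub !sub_kermx !mul_rV_lin1 Lv LJv eqxx.
have rB : \rank B = 2%N.
  apply/eqP; rewrite -[_ == _]/(row_free B) -kermx_eq0; apply/eqP/row_matrixP => i.
  rewrite row0; have : row i (kermx B) *m B = 0.
    by apply/eqP; rewrite -sub_kermx row_sub.
  move: (row i _) => x; rewrite -[x]hsubmxK mul_row_col.
  rewrite [lsubmx x]mx11_scalar [rsubmx x]mx11_scalar !mul_scalar_mx.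
  move/(cs_inj v0) => [-> ->].
  have -> : (0 : R)%:M = 0 :> 'M[R]_1 by apply/matrixP => k l; rewrite !mxE mul0rn.
  by rewrite row_mx0.
have /eqmxP EK : (B == kermx A)%MS.
  by rewrite -(mxrank_leqif_eq BK) rB mxrank_ker rA.
have : (w <= B)%MS by rewrite EK sub_kermx mul_rV_lin1 Lw.
move=> /submxP [D ->]; exists (lsubmx D ord0 ord0), (rsubmx D ord0 ord0).
rewrite -[D in LHS]hsubmxK mul_row_col.
by rewrite {1}[lsubmx D]mx11_scalar {1}[rsubmx D]mx11_scalar !mul_scalar_mx.
Qed.

Lemma csD (a b c d : R) (v : V) : cs a b v + cs c d v = cs (a + c) (b + d) v.
Proof. by rewrite /cs !scalerDl addrACA. Qed.
Lemma csN (a b : R) (v : V) : - cs a b v = cs (- a) (- b) v.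
Proof. by rewrite /cs !scaleNr opprD. Qed.
Lemma csM (a b c d : R) (v : V) : cs a b (cs c d v) = cs (a * c - b * d) (a * d + b * c) v.
Proof.
rewrite /cs JD !JZ JJ !scalerDr !scalerA !scalerDl addrA.
rewrite !scalerN -!scaleNr.
by apply/rowP => i; rewrite !mxE; ring.
Qed.
Lemma csJ (a b : R) (v : V) : J (cs a b v) = cs (- b) a v.
Proof. by rewrite /cs JD !JZ JJ scalerN -scaleNr addrC. Qed.
Lemma cs10 (v : V) : cs 1 0 v = v. Proof. by rewrite /cs scale1r scale0r addr0. Qed.
Lemma cs00 (v : V) : cs 0 0 v = 0. Proof. by rewrite /cs !scale0r addr0. Qed.
Lemma csZ (a b c : R) (v : V) : c *: cs a b v = cs (c * a) (c * b) v.
Proof. by rewrite /cs scalerDr !scalerA. Qed.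
Lemma cs_lin (L : {linear V -> 'rV[R]_2}) (v : V) a b : L v = 0 -> L (J v) = 0 -> L (cs a b v) = 0.
Proof. by move=> h1 h2; rewrite /cs linearD !linearZ /= h1 h2 !scaler0 addr0. Qed.

Definition cspan (v : V) : set V := [set w | exists a b, w = cs a b v].

End LinAlg.

(** * Surjectivity of the exponential map *)

Section Exp.
Variable R : realType.
Notation V := 'rV[R]_(2 + 2).

Lemma tanh_surj (tau : R) : 0 <= tau < 1 -> exists2 t : R, 0 <= t & sh t = tau * ch t.
Proof.
move=> /andP[t0 t1].
have r1 : 1 <= (1 + tau) / (1 - tau) by rewrite ler_pdivlMr; lra.
set r := (1 + tau) / (1 - tau) in r1.
have s1 : 1 <= Num.sqrt r by rewrite -sqrtr1 ler_wsqrtr.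
(* This is artanh tau. *)
exists (ln (Num.sqrt r)); first exact: ln_ge0.
have r0 : 0 < Num.sqrt r by apply: lt_le_trans s1.
rewrite /sh /ch expRN lnK ?posrE //.
have E : (Num.sqrt r) ^+ 2 = r by rewrite sqr_sqrtr //; apply: le_trans r1.
set s := Num.sqrt r in r0 E *.
have s0 : s != 0 by rewrite gt_eqF.
apply: (mulIf s0); transitivity ((s ^+ 2 - 1) / 2); first by field.
transitivity (tau * ((s ^+ 2 + 1) / 2)); last by field.
rewrite E /r; field.
by rewrite subr_eq0 eq_sym lt_eqF.
Qed.

Lemma metric_def (p u : V) : metric p u u = dot u u / (1 - dot p p) + k1 p u ^+ 2 + k2 p u ^+ 2 \/ 1 - dot p p = 0.
Proof.
have [->|P0] := eqVneq (1 - dot p p) 0; [by right|left].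
by rewrite /metric /k1 /k2; field.
Qed.

Lemma metricE (p u : V) : CH2 p -> metric p u u = dot u u / (1 - dot p p) + k1 p u ^+ 2 + k2 p u ^+ 2.
Proof. by move=> /CH2_gt0 h; case: (metric_def p u) => // E; move: h; rewrite E ltxx. Qed.

Lemma metric_gt0 (p u : V) : CH2 p -> u != 0 -> 0 < metric p u u.
Proof.
move=> hp u0; rewrite metricE // -addrA ltr_pwDl ?addr_ge0 ?sqr_ge0 //.
by rewrite divr_gt0 ?dot_gt0 ?CH2_gt0.
Qed.

Lemma k1_cs (p u : V) a b : k1 p (cs a b u) = a * k1 p u - b * k2 p u.
Proof. by rewrite /k1 /k2 /cs !dotE; ring. Qed.
Lemma k2_cs (p u : V) a b : k2 p (cs a b u) = a * k2 p u + b * k1 p u.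
Proof. by rewrite /k1 /k2 /cs !dotE; ring. Qed.
Lemma dot_cs (u : V) a b : dot (cs a b u) (cs a b u) = (a ^+ 2 + b ^+ 2) * dot u u.
Proof. by rewrite /cs !dotE; ring. Qed.
Lemma metric_cs (p u : V) a b : CH2 p ->
  metric p (cs a b u) (cs a b u) = (a ^+ 2 + b ^+ 2) * metric p u u.
Proof. by move=> hp; rewrite !metricE // k1_cs k2_cs dot_cs; ring. Qed.

(** Solving (sinh t / om) u = w for u = lambda w gives lambda = 1 / (tanh t (1 - k)), with k taken
    for w, and unit length forces tanh^2 t = [M / N]. This is below 1 because [N - M] = (1 - |z|^2)
    / (1 - |p|^2) > 0. *)
Lemma exp_surj (p z : V) : CH2 p -> CH2 z -> z != p ->
  exists a b t, [/\ metric p (cs a b (z - p)) (cs a b (z - p)) = 1, 0 < t,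
    z = geoE p (cs a b (z - p)) t & (a != 0) || (b != 0)].
Proof.
move=> hp hz zp.
set w := z - p.
have w0 : w != 0 by rewrite subr_eq0.
have zE : z = w + p by rewrite subrK.
clearbody w.
have P0 := CH2_gt0 hp; have Z0 := CH2_gt0 hz.
set P := 1 - dot p p in P0.
pose N := (1 - k1 p w) ^+ 2 + k2 p w ^+ 2.
have M0 := metric_gt0 hp w0.
set M := metric p w w in M0.
have NM : N - M = (1 - dot z z) / P.
  rewrite /M metricE // /N /k1 /k2 -/P zE.
  rewrite !dotE (dotC p w) (_ : dot p p = 1 - P); last by rewrite /P; ring.
  by field; rewrite gt_eqF.
have NM0 : M < N by rewrite -subr_gt0 NM divr_gt0.
have N0 : 0 < N by apply: lt_trans NM0.
have MN1 : 0 <= M / N < 1 by rewrite divr_ge0 ?ltW //= ltr_pdivrMr // mul1r.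
pose tau := Num.sqrt (M / N).
have tau0 : 0 < tau by rewrite sqrtr_gt0 divr_gt0.
have tau2 : tau ^+ 2 = M / N by rewrite sqr_sqrtr //; case/andP: MN1.
have tau1 : 0 <= tau < 1.
  by rewrite ltW //= -sqrtr1 ltr_sqrt //; case/andP: MN1.
have [t t0 ht] := tanh_surj tau1.
have t1 : 0 < t.
  rewrite lt_neqAle t0 andbT eq_sym; apply/eqP => E.
  by move: ht; rewrite E sh0 ch0 mulr1 => E2; move: tau0; rewrite -E2 ltxx.
have taun : tau != 0 by rewrite gt_eqF.
have Nn : N != 0 by rewrite gt_eqF.
have Nn' : (1 - k1 p w) ^+ 2 + k2 p w ^+ 2 != 0 by exact: Nn.
have Mn : M != 0 by rewrite gt_eqF.
exists ((1 - k1 p w) / (tau * N)), (k2 p w / (tau * N)), t; split=> //.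
- rewrite metric_cs // -/M.
  rewrite [LHS](_ : _ = N * M / (tau ^+ 2 * N ^+ 2)); last by rewrite /N; field; rewrite Nn' taun.
  by rewrite tau2; field; rewrite Mn ?Nn ?Nn'.
- set u := cs _ _ w.
  have C0 : ch t != 0 by rewrite gt_eqF // ch_gt0.
  have O1 : om1 p u t = ch t * (1 - k1 p w) / N.
    by rewrite /om1 /u k1_cs ht /N; field; rewrite Nn' taun.
  have O2 : om2 p u t = ch t * k2 p w / N.
    by rewrite /om2 /u k2_cs ht /N; field; rewrite Nn' taun.
  have OD : omd p u t = ch t ^+ 2 / N.
    by rewrite /omd O1 O2 /N; field; rewrite Nn'.
  rewrite /geoE /sg1 /sg2 OD O1 O2 ht {1}zE addrC; congr (_ + _).
  rewrite /u csM -[LHS]cs10; congr (cs _ _ _); rewrite /N; field; rewrite ?Nn' taun ?C0 //.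
- rewrite -negb_and; apply/negP => /andP[/eqP h1 /eqP h2].
  have TN : tau * N != 0 by rewrite mulf_neq0.
  have g1 : 1 - k1 p w = 0 by apply: (mulIf (invr_neq0 TN)); rewrite mul0r.
  have g2 : k2 p w = 0 by apply: (mulIf (invr_neq0 TN)); rewrite mul0r.
  by move: Nn; rewrite /N g1 g2 expr0n addr0 eqxx.
Qed.
End Exp.

(** * Complex lines *)

Section CkMore.
Variable R : realType.
Notation V := 'rV[R]_(2 + 2).

Lemma Ck_J (U : normedModType R) k (A : set U) (f : U -> V) : open A ->
  Ck k A f -> Ck k A (fun x => J (f x)).
Proof. exact: Ck_lin. Qed.

Lemma Ck_cs (U : normedModType R) k (A : set U) (a b : U -> R) (f : U -> V) : open A ->
  Ck k A a -> Ck k A b -> Ck k A f -> Ck k A (fun x => cs (a x) (b x) (f x)).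
Proof. by move=> oA Ha Hb Hf; apply: Ck_add => //; apply: Ck_scale => //; apply: Ck_J. Qed.

End CkMore.

Ltac ck := repeat first [assumption | exact: openT | apply: Ck_cst | apply: Ck_id
  | apply: Ck_add | apply: Ck_opp | apply: Ck_scale | apply: Ck_mul | apply: Ck_dot
  | apply: Ck_J | apply: Ck_cs].

(** * Strict differentiability *)

Section Strict.
Variable R : realType.

Lemma coord_le n (v : 'rV[R]_n) i : `|v ord0 i| <= `|v|.
Proof.
rewrite [leRHS]/Num.Def.normr /= mx_normrE.
exact: (le_bigmax _ (fun ij : 'I_1 * 'I_n => `|v ij.1 ij.2|) (ord0, i)).
Qed.

Lemma norm_coord n (v : 'rV[R]_n) (e : R) : 0 <= e -> (forall i, `|v ord0 i| <= e) -> `|v| <= e.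
Proof.
move=> e0 H; rewrite [leLHS]/Num.Def.normr /= mx_normrE.
by apply: bigmax_le => // -[i j] _ /=; rewrite (ord1 i).
Qed.

Lemma norm_le_enorm n (v : 'rV[R]_n) : `|v| <= enorm v.
Proof.
apply: norm_coord => [|i]; first exact: enorm_ge0.
rewrite -sqrtr_sqr ler_wsqrtr // /dot (bigD1 i) //= expr2 lerDl.
by apply: sumr_ge0 => j _; rewrite -expr2 sqr_ge0.
Qed.

Lemma cvg_dot n (T : Type) (F : set_system T) (f g : T -> 'rV[R]_n) a b : Filter F ->
  f x @[x --> F] --> a -> g x @[x --> F] --> b ->
  dot (f x) (g x) @[x --> F] --> dot a b.
Proof.
move=> FF fa gb; apply: cvg_big => [|i _]; first exact: add_continuous.
apply: cvgM; apply: (@cvg_comp _ _ _ _ (fun w : 'rV[R]_n => w ord0 i)); try exact: coord_continuous.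
  exact: fa.
exact: gb.
Qed.

Lemma cvg_lin n (W : normedModType R) (L : {linear 'rV[R]_n -> W}) (T : Type)
  (F : set_system T) (f : T -> 'rV[R]_n) a : Filter F ->
  f x @[x --> F] --> a -> L (f x) @[x --> F] --> L a.
Proof. by move=> FF fa; apply: (cvg_comp f L fa); apply: lin_rV_continuous. Qed.

Lemma MVT_line n (g : 'rV[R]_n -> R) (x y : 'rV[R]_n) :
  (forall s : R, 0 <= s <= 1 -> differentiable g (y + s *: (x - y))) ->
  exists2 s : R, 0 <= s <= 1 & g x - g y = 'd g (y + s *: (x - y)) (x - y).
Proof.
move=> Hg; pose h (s : R) := g (y + s *: (x - y)).
have Dl (s : R) : is_derive s 1 (fun s : R => y + s *: (x - y)) (x - y).
  have H := is_derive_add (is_derive_const y s)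
    (is_derive_scale (is_derive_id s 1) (is_derive_const (x - y) s)).
  by apply: (is_derive_eq H); rewrite scaler0 scale1r !add0r.
have Dh (s : R) : 0 <= s <= 1 -> is_derive s 1 h ('d g (y + s *: (x - y)) (x - y)).
  by move=> s01; apply: is_derive_diff_comp (Dl s); apply: differentiableP; apply: Hg.
have [||s s01 E] := @MVT_segment R h (fun s => 'd g (y + s *: (x - y)) (x - y)) 0 1 ler01.
- by move=> s; rewrite in_itv /= => /andP[s0 s1]; apply: Dh; rewrite !ltW.
- apply: derivable_within_continuous => s; rewrite in_itv /= => s01.
  by have [] := Dh s s01.
exists s; first by move: s01; rewrite in_itv.
by move: E; rewrite /h scale0r addr0 scale1r subrKC subr0 mulr1.
Qed.

(** Both points vary, unlike in plain differentiability: the mean value theorem on the segment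
    reduces the claim to continuity of the partial derivatives. *)
Lemma strict_diff n (g : 'rV[R]_n -> R) (W : set 'rV[R]_n) q (e : R) :
  open W -> W q -> Ck 1 W g -> 0 < e ->
  exists2 d : R, 0 < d & forall x y, `|x - q| < d -> `|y - q| < d ->
    `|g x - g y - 'd g q (x - y)| <= e * `|x - y|.
Proof.
move=> oW Wq [Hd Hc] e0.
(* One share of [e] per coordinate; the successor avoids a division by 0. *)
pose e' := e / n.+1%:R.
have e'0 : 0 < e' by rewrite divr_gt0.
have : \forall z \near q, W z /\ forall i, `|'d g z (delta_mx 0 i) - 'd g q (delta_mx 0 i)| <= e'.
  apply: filterI; first exact: open_nbhs_nbhs.
  apply: (@filter_forall _ _ (fun i z => `|'d g z (delta_mx 0 i) - 'd g q (delta_mx 0 i)| <= e') (nbhs q)) => i.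
  have /cvgrPdist_le /(_ e' e'0) := Hc (delta_mx 0 i) q Wq.
  move=> Hn; apply: filterS Hn => z Hz.
  by rewrite distrC.
move=> /nbhs_ballP [d d0 Hb]; exists d => // x y xd yd.
have B (s : R) : 0 <= s <= 1 -> ball q d (y + s *: (x - y)).
  move=> /andP[s0 s1]; rewrite -ball_normE /= distrC.
  rewrite (_ : _ - q = (1 - s) *: (y - q) + s *: (x - q)); last first.
    by apply/rowP => i; rewrite !mxE; ring.
  apply: le_lt_trans (ler_normD _ _) _; rewrite !normrZ !ger0_norm ?subr_ge0 //.
  have [->|sn0] := eqVneq s 0; first by rewrite subr0 mul1r mul0r addr0.
  have sp : 0 < s by rewrite lt_neqAle eq_sym sn0.
  have : (1 - s) * `|y - q| <= (1 - s) * d by rewrite ler_wpM2l ?subr_ge0 // ltW.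
  have : s * `|x - q| < s * d by rewrite ltr_pM2l.
  by lra.
have [s s01 ->] := MVT_line (fun s s01 => Hd _ (Hb _ (B s s01)).1).
have [_ Hs] := Hb _ (B s s01).
rewrite [X in `|X - _|]diff_row_sum [X in `|_ - X|]diff_row_sum -sumrB.
apply: le_trans (ler_norm_sum _ _ _) _.
apply: (@le_trans _ _ (\sum_(i < n) e' * `|x - y|)).
  apply: ler_sum => i _; rewrite -scalerBr normrM mulrC.
  by apply: ler_pM => //; exact: coord_le.
rewrite sumr_const card_ord -mulr_natr mulrAC ler_wpM2r //.
rewrite /e' -mulrA; apply: ler_piMr; first exact: ltW.
by rewrite mulrC ler_pdivrMr // mul1r ler_nat.
Qed.

End Strict.

(** * Complex lines as affine complex lines in the ball *)

Section Lines.
Variable R : realType.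
Notation V := 'rV[R]_(2 + 2).

Lemma dot_add_orth n (a w : 'rV[R]_n) : dot a w = 0 -> dot (a + w) (a + w) = dot a a + dot w w.
Proof. by move=> aw; rewrite dotDl !dotDr aw (dotC w a) aw addr0 add0r. Qed.

Lemma Ck0_cvg (U W : normedModType R) (f : U -> W) x : Ck 0 setT f -> f y @[y --> x] --> f x.
Proof. by move=> /(_ x I). Qed.

(** Euclidean orthogonal projection onto the complex span of [v]. *)
Definition cproj (v z : V) := cs (dot z v / dot v v) (dot z (J v) / dot v v) v.

Lemma Ck_cproj (U : normedModType R) k (A : set U) v (f : U -> V) : open A ->
  Ck k A f -> Ck k A (fun x => cproj v (f x)).
Proof. by move=> oA Hf; rewrite /cproj; ck. Qed.

Lemma cproj_orth v z : v != 0 -> dot (z - cproj v z) v = 0.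
Proof. by rewrite -dot_eq0 => V0; rewrite /cproj /cs !dotE; field. Qed.

Lemma cproj_orthJ v z : v != 0 -> dot (z - cproj v z) (J v) = 0.
Proof. by rewrite -dot_eq0 => V0; rewrite /cproj /cs !dotE; field. Qed.

Lemma cproj_span v z : cspan v (cproj v z).
Proof. by eexists; eexists. Qed.

Lemma cproj_id v z : v != 0 -> cspan v z -> cproj v z = z.
Proof.
rewrite -dot_eq0 => V0 [a [b ->]]; congr (cs _ _ v); rewrite /cs !dotE; field => //.
Qed.

Implicit Types (H : set V) (p q v w z : V).

Lemma CH2_continuous : continuous (fun z : V => dot z z).
Proof.
move=> z; apply: (differentiable_continuous (ex_diff (is_diff_def := is_diff_dot (is_diff_id z) (is_diff_id z)))).
Qed.

Lemma CH2_open : open (@CH2 R).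
Proof.
have -> : @CH2 R = (fun z : V => dot z z) @^-1` [set x | x < 1] by [].
by apply: open_comp => [z _|]; [exact: CH2_continuous|exact: open_lt].
Qed.

Lemma unit_scale p v : CH2 p -> v != 0 -> exists2 l : R, 0 < l & metric p (l *: v) (l *: v) = 1.
Proof.
move=> hp v0; have m0 := metric_gt0 hp v0.
exists (Num.sqrt (metric p v v))^-1; first by rewrite invr_gt0 sqrtr_gt0.
by rewrite metricZ exprVn sqr_sqrtr ?ltW // mulVf // gt_eqF.
Qed.

Lemma unit_neq0 p u : metric p u u = 1 -> u != 0.
Proof.
apply: contra_eq_neq => ->; rewrite /metric !dotE !(mulr0, mul0r, addr0) eq_sym.
exact: oner_neq0.
Qed.

Lemma curve_kills k (g : V -> 'rV[R]_k) (c : R -> V) (q v : V) :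
  c 0 = q -> is_derive (0 : R) 1 c v -> differentiable g q ->
  (\forall t \near (0 : R), g (c t) = 0) -> 'd g q v = 0.
Proof.
move=> c0 D dg H.
have D2 : is_derive (0 : R) 1 (fun t => g (c t)) ('d g q v).
  by apply: is_derive_diff_comp D; rewrite c0; apply: differentiableP.
have D3 : is_derive (0 : R) 1 (fun t => g (c t)) 0.
  apply: near_eq_is_derive (is_derive_const (0 : 'rV[R]_k) 0).
  by apply: filterS H.
by case: D2 => _ <-; case: D3.
Qed.

Lemma geod_kills k (g : V -> 'rV[R]_k) (W : set V) q v : CH2 q -> open W -> W q ->
  differentiable g q -> (forall t, W (geod q v t) -> g (geod q v t) = 0) -> 'd g q v = 0.
Proof.
move=> hq oW Wq dg H.
have [->|v0] := eqVneq v 0; first by rewrite linear0.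
have [l l0 lu] := unit_scale hq v0.
have E t : geod q v t = geoE q (l *: v) (l^-1 * t).
  by rewrite -(geodEZ _ _ hq lu) scalerA mulVf ?gt_eqF // scale1r.
have D : is_derive (0 : R) 1 (geod q v) v.
  have /is_diff_derive Hg := is_derive_geoE hq lu (l^-1 * 0).
  have := is_derive_diff_comp (c := fun s => l^-1 * s) Hg
    (is_derive_mul (is_derive_const l^-1 (0 : R)) (is_derive_id (0 : R) 1)).
  rewrite mul0r add0r mulr1 mulr0 geoV0 scalerA mulVf ?gt_eqF // scale1r.
  by move=> D; apply: is_derive_fext D _ => t; rewrite E.
have g0 : geod q v 0 = q by rewrite E mulr0 geoE0.
apply: (curve_kills g0 D dg).
have : geod q v t @[t --> (0 : R)] --> q.
  by rewrite -[X in _ --> X]g0; exact: is_derive_cont D.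
move=> /(_ W (open_nbhs_nbhs (conj oW Wq))) H2.
exact: (@filterS _ (nbhs (0 : R)) _ (fun t => W (geod q v t))).
Qed.

Definition cline p v : set V := [set z | CH2 z /\ cspan v (z - p)].

Lemma cspanD v w z : cspan v w -> cspan v z -> cspan v (w + z).
Proof. by move=> [a [b ->]] [c [d ->]]; rewrite csD; exists (a + c), (b + d). Qed.
Lemma cspanN v w : cspan v w -> cspan v (- w).
Proof. by move=> [a [b ->]]; rewrite csN; exists (- a), (- b). Qed.
Lemma cspanZ v w (c : R) : cspan v w -> cspan v (c *: w).
Proof. by move=> [a [b ->]]; rewrite csZ; exists (c * a), (c * b). Qed.
Lemma cspan_cs v w a b : cspan v w -> cspan v (cs a b w).
Proof. by move=> [c [d ->]]; rewrite csM; do 2 eexists. Qed.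
Lemma cspanv v : cspan v v. Proof. by exists 1, 0; rewrite cs10. Qed.
Lemma cspanJ v w : cspan v w -> cspan v (J w).
Proof. by move=> [a [b ->]]; rewrite csJ; do 2 eexists. Qed.
Lemma cspan_sym v w : w != 0 -> cspan v w -> cspan w `<=>` cspan v.
Proof.
move=> w0 [a [b wE]]; split=> z [c [d ->]]; first by rewrite wE csM; do 2 eexists.
have N0 : a ^+ 2 + b ^+ 2 != 0.
  apply: contra w0; rewrite paddr_eq0 ?sqr_ge0 // !sqrf_eq0 => /andP[/eqP a0 /eqP b0].
  by rewrite wE a0 b0 cs00.
have -> : v = cs (a / (a ^+ 2 + b ^+ 2)) (- b / (a ^+ 2 + b ^+ 2)) w.
  by rewrite wE csM -[LHS]cs10; congr (cs _ _ _); field; rewrite N0.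
by rewrite csM; do 2 eexists.
Qed.

Section Given.
Variables (H : set V).
Hypothesis HH : complex_line H.

Lemma line_CH2 q : H q -> CH2 q. Proof. by case: HH => -[+ _] _ _ _ _; apply. Qed.

(** [tangent] only provides some equation that kills [v]. Since [H] is totally geodesic and
    complete, the geodesic with velocity [v] stays in [H], so every equation kills [v]. *)
Lemma line_kernel p W (f : V -> 'rV[R]_2) v : local_equation H p W f -> H p ->
  tangent 2 H p v -> 'd f p v = 0.
Proof.
move=> [oW Wp WC sf [surj fE]] Hp Tv; case: (HH) => _ _ _ _ Hg.
apply: (geod_kills (line_CH2 Hp) oW Wp) => [|t Wt].
  by have [/(_ p Wp)] := sf 1%N.
by apply/fE => //; apply: Hg.
Qed.

Lemma line_exists_tangent p : H p -> exists2 v, v != 0 & tangent 2 H p v.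
Proof.
move=> Hp; case: (HH) => -[_ /(_ p Hp) [W [f Hf]]] _ _ _ _.
have [v v0 dv] := lin_kernel_nz ('d f p).
by exists v => //; exists W, f.
Qed.

Lemma line_tangent_cs p v a b : H p -> tangent 2 H p v -> tangent 2 H p (cs a b v).
Proof.
move=> Hp Tv; case: (HH) => -[_ /(_ p Hp) [W [f Hf]]] _ _ HJ _.
exists W, f; split=> //.
by apply: cs_lin; apply: line_kernel Hf _ _ => //; apply: HJ.
Qed.

(** By [exp_surj] each point of the affine line is reached from [p] by a geodesic with velocity in
    the span of [v], and [H] contains such geodesics. *)
Lemma cline_sub p v : H p -> tangent 2 H p v -> v != 0 -> cline p v `<=` H.
Proof.
move=> Hp Tv v0 z [hz zv].
have [->|zp] := eqVneq z p; first exact: Hp.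
have hp := line_CH2 Hp.
have [a [b [t [u1 t0 -> _]]]] := exp_surj hp hz zp.
rewrite -geodE //; case: (HH) => _ _ _ _; apply => //.
by case: zv => c [d ->]; rewrite csM; apply: line_tangent_cs.
Qed.

Lemma line_tangentP p v w : H p -> tangent 2 H p v -> v != 0 ->
  tangent 2 H p w <-> cspan v w.
Proof.
move=> Hp Tv v0; split; last by move=> [a [b ->]]; apply: line_tangent_cs.
move=> Tw; case: (HH) => -[_ /(_ p Hp) [W [f Hf]]] _ _ HJ _.
have surj : forall b, exists x, 'd f p x = b by case: Hf => _ Wp _ _ [+ _]; apply.
by apply: (lin_kernel_span surj v0); apply: line_kernel Hf _ _ => //; apply: HJ.
Qed.

(* The inverse function theorem is replaced by strict differentiability at q:
   the derivative is injective on the Euclidean complement of the span of v, so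
   f cannot vanish at two points near q which differ by an element of it. *)
Lemma line_local q v : H q -> tangent 2 H q v -> v != 0 ->
  \forall z \near q, H z -> cspan v (z - q).
Proof.
move=> Hq Tv v0; case: (HH) => -[_ /(_ q Hq) [W [f Hf]]] _ _ HJ _.
have [oW Wq WC sf [surj fE]] := Hf.
have V0 : dot v v != 0 by rewrite dot_eq0.
pose proj := cproj v.
have cprj z : cspan v (proj z) by apply: cproj_span.
have orth1 z : dot (z - proj z) v = 0 by apply: cproj_orth.
have orth2 z : dot (z - proj z) (J v) = 0 by apply: cproj_orthJ.
(* Preimages of the basis vectors: modulo the span of [v], any vector is the combination of them
   prescribed by its image under ['d f q]. *)
have e_ex i : exists x, 'd f q x = delta_mx 0 i by apply: surj.
pose E i := projT1 (cid (e_ex i)).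
have EE i : 'd f q (E i) = delta_mx 0 i by exact: (projT2 (cid (e_ex i))).
have dec n : cspan v (n - \sum_i ('d f q n) ord0 i *: E i).
  apply: (lin_kernel_span (L := 'd f q)) => //; [exact: surj|exact: line_kernel Hf _ _| |].
    by apply: line_kernel Hf _ _ => //; apply: HJ.
  rewrite linearB linear_sum /=.
  under eq_bigr do rewrite linearZ /= EE.
  by rewrite -row_sum_delta subrr.
pose S := \sum_i enorm (E i).
have S0 : 0 <= S by apply: sumr_ge0 => i _; apply: enorm_ge0.
(* What matters is [eps * S < 1]: the final estimate |n|^2 <= eps S |n|^2 then forces n = 0. *)
pose eps := (8 * (S + 1))^-1.
have eps0 : 0 < eps by rewrite invr_gt0 mulr_gt0 // ltr_wpDl.
have C1 i : Ck 1 W (fun z => f z ord0 i) by apply: Ck_coord => //; apply: (sf 1%N).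
have SD i := strict_diff oW Wq (C1 i) eps0.
have ND i : \forall p \near (q, q), `|f p.1 ord0 i - f p.2 ord0 i - ('d f q (p.1 - p.2)) ord0 i|
   <= eps * `|p.1 - p.2|.
  have [d d0 Hd] := SD i.
  have dE w : 'd (fun z => f z ord0 i) q w = ('d f q w) ord0 i.
    have dfq : is_diff q f ('d f q) by apply: differentiableP; have [/(_ q Wq)] := sf 1%N.
    by rewrite (diff_val (is_diff_def := is_diff_coord i dfq)).
  exists (ball q d, ball q d); first by split; apply: nbhsx_ballx.
  move=> [x y] /= []; rewrite -!ball_normE /= !(distrC q) => xd yd.
  by rewrite -dE; apply: Hd.
have pc : q + proj (z - q) @[z --> q] --> q.
  rewrite -[X in _ --> X](_ : q + proj (q - q) = q); last first.
    by rewrite subrr /proj /cproj !dot0l !mul0r cs00 addr0.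
  apply: (Ck0_cvg (f := fun z => q + proj (z - q))).
  by apply: Ck_add; [exact: openT|ck|apply: Ck_cproj; ck].
have Ny : \forall z \near q, W (q + proj (z - q)).
  exact: (pc W (open_nbhs_nbhs (conj oW Wq))).
have NW : \forall z \near q, W z by exact: open_nbhs_nbhs.
pose P (i : 'I_2) z := `|f z ord0 i - f (q + proj (z - q)) ord0 i -
  ('d f q (z - (q + proj (z - q)))) ord0 i| <= eps * `|z - (q + proj (z - q))|.
have ND2 : \forall z \near q, forall i, P i z.
  apply: (@filter_forall _ _ P (nbhs q)) => i.
  exact: (cvg_pair cvg_id pc (ND i)).
near=> z => Hz.
have yW : W (q + proj (z - q)) by near: z.
have zW : W z by near: z.
have zP : forall i, P i z by near: z.
set y := q + proj (z - q) in yW *.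
have Hy : H y.
  apply: (cline_sub Hq Tv v0); split; first exact: WC.
  by rewrite /y addrC addKr; apply: cprj.
have fz : f z = 0 by apply/fE.
have fy : f y = 0 by apply/fE.
pose n := z - y.
have nE : n = (z - q) - proj (z - q) by rewrite /n /y opprD addrA.
have Hi i : `|('d f q n) ord0 i| <= eps * enorm n.
  have : `|f z ord0 i - f y ord0 i - ('d f q n) ord0 i| <= eps * `|n|.
    exact: zP.
  rewrite fz fy !mxE subrr add0r normrN => Hn; apply: le_trans Hn _.
  by rewrite ler_pM2l // norm_le_enorm.
have orth w : cspan v w -> dot n w = 0.
  by move=> [a [b ->]]; rewrite nE /cs dotDr !dotZr orth1 orth2 !mulr0 addr0.
have nn : dot n n = \sum_i ('d f q n) ord0 i * dot n (E i).
  have := orth _ (dec n); rewrite dotDr dotNr => /eqP; rewrite subr_eq0 => /eqP ->.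
  elim: (index_enum _) => [|i s IH]; first by rewrite !big_nil dot0r.
  by rewrite !big_cons dotDr dotZr IH.
have : dot n n <= eps * S * dot n n.
  have -> : eps * S * dot n n = \sum_i eps * enorm (E i) * dot n n.
    by move: (dot n n) => X; rewrite /S mulr_sumr mulr_suml.
  rewrite {1}nn; apply: ler_sum => i _.
  apply: le_trans (ler_norm _) _; rewrite normrM.
  apply: (@le_trans _ _ (eps * enorm n * (enorm n * enorm (E i)))).
    by apply: ler_pM => //; apply: dot_enorm.
  by rewrite -enorm2 expr2 le_eqVlt; apply/orP; left; apply/eqP; ring.
have epsS : eps * S < 1.
  by rewrite /eps mulrC ltr_pdivrMr ?mul1r; lra.
have n0 := dot_ge0 n => Hle.
have /eqP : dot n n = 0 by nra.
rewrite dot_eq0 nE subr_eq0 => /eqP ->; exact: cprj.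
Unshelve. all: by end_near. Qed.

Lemma cline_tangent p v z : H p -> tangent 2 H p v -> v != 0 -> cline p v z ->
  tangent 2 H z v.
Proof.
move=> Hp Tv v0 zl; have Hz := cline_sub Hp Tv v0 zl.
case: (HH) => -[_ /(_ z Hz) [W [f Hf]]] _ _ _ _.
exists W, f; split=> //.
have [oW Wz WC sf [surj fE]] := Hf.
have D : is_derive (0 : R) 1 (fun t : R => z + t *: v) v.
  have H' := is_derive_add (is_derive_const z (0 : R))
    (is_derive_scale (is_derive_id (0 : R) 1) (is_derive_const v (0 : R))).
  by apply: (is_derive_eq H'); rewrite scaler0 scale1r !add0r.
apply: (curve_kills _ D); first by rewrite scale0r addr0.
  by have [/(_ z Wz)] := sf 1%N.
have : z + t *: v @[t --> (0 : R)] --> z.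
  by have := is_derive_cont D; rewrite /prop_for /continuous_at scale0r addr0.
move=> /(_ W (open_nbhs_nbhs (conj oW Wz))) Hn.
apply: (@filterS _ (nbhs (0 : R)) _ (fun t : R => W (z + t *: v))) => // t Wt.
apply/fE => //; apply: (cline_sub Hp Tv v0); split; first exact: WC.
rewrite addrAC; apply: cspanD; first by case: zl.
exact/cspanZ/cspanv.
Qed.

(** Connectedness of [H]: its intersection with the affine line is nonempty, relatively open by
    [line_local], and relatively closed. *)
Lemma line_eq p v : H p -> tangent 2 H p v -> v != 0 -> H = cline p v.
Proof.
move=> Hp Tv v0; apply/seteqP; split; last exact: cline_sub.
have V0 : dot v v != 0 by rewrite dot_eq0.
suff -> : H = H `&` cline p v by move=> z [].
case: (HH) => _ _ Hc _ _; symmetry; apply: Hc.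
- exists p; split=> //; split; first exact: line_CH2.
  by rewrite subrr -(cs00 v); exists 0, 0.
- exists (interior [set z | H z -> cline p v z]); first exact: open_interior.
  apply/seteqP; split=> z [Hz]; last by move=> /interior_subset /(_ Hz).
  move=> zl; split=> //.
  have := line_local Hz (cline_tangent Hp Tv v0 zl) v0; apply: filterS => x Hx Hx2.
  split; first exact: line_CH2.
  rewrite (_ : x - p = (x - z) + (z - p)); last by rewrite subrKA.
  by apply: cspanD; [apply: Hx|case: zl].
- pose res z := (z - p) - cproj v (z - p).
  exists ((fun z => dot (res z) (res z)) @^-1` [set x | x <= 0]).
    apply: closed_comp => [z _|]; last exact: closed_le.
    apply: (Ck0_cvg (f := fun z => dot (res z) (res z))).
    by rewrite /res; ck; apply: Ck_cproj; ck.
  apply/seteqP; split=> z [Hz]; last first.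
    rewrite /= le_eqVlt ltNge dot_ge0 orbF dot_eq0 subr_eq0 => /eqP E.
    by split=> //; split; [exact: line_CH2|rewrite E; apply: cproj_span].
  by move=> [_ zv]; split=> //; rewrite /= /res cproj_id // subrr dot0l.
Qed.

Lemma line_cspan p q v w : H p -> H q -> tangent 2 H p v -> v != 0 ->
  tangent 2 H q w <-> cspan v w.
Proof.
move=> Hp Hq Tv v0.
have ql : cline p v q by rewrite -(line_eq Hp Tv v0).
exact: (line_tangentP w Hq (cline_tangent Hp Tv v0 ql) v0).
Qed.

(* a is the point of H closest to the origin. *)
Lemma line_normal_form : exists a b : V,
  [/\ dot a b = 0, dot a (J b) = 0, dot b b = 1 - dot a a, CH2 a &
    (forall z, H z <-> exists x y, z = a + cs x y b /\ x ^+ 2 + y ^+ 2 < 1) /\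
    (forall q, H q -> forall w, tangent 2 H q w <-> cspan b w)].
Proof.
case: (HH) => _ [p Hp] _ _ _.
have [v v0 Tv] := line_exists_tangent Hp.
have V0 : dot v v != 0 by rewrite dot_eq0.
have V1 : 0 < dot v v by rewrite dot_gt0.
pose a := p - cproj v p.
have av : dot a v = 0 by apply: cproj_orth.
have aJv : dot a (J v) = 0 by apply: cproj_orthJ.
have pE : a + cproj v p = p by rewrite subrK.
have acs x y : dot a (cs x y v) = 0 by rewrite /cs dotDr !dotZr av aJv !mulr0 addr0.
have ap : cspan v (a - p) by rewrite /a addrAC subrr add0r; apply/cspanN/cproj_span.
clearbody a.
have ha : CH2 a.
  apply: le_lt_trans (line_CH2 Hp).
  have acp : dot a (cproj v p) = 0 by exact: acs.
  have := dot_add_orth acp.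
  by rewrite pE => ->; rewrite lerDl dot_ge0.
have A0 := CH2_gt0 ha.
pose m := Num.sqrt ((1 - dot a a) / dot v v).
have m0 : 0 < m by rewrite sqrtr_gt0 divr_gt0.
have m2 : m ^+ 2 = (1 - dot a a) / dot v v by rewrite sqr_sqrtr // divr_ge0 ?ltW.
pose b := m *: v.
have b0 : b != 0 by rewrite scaler_eq0 negb_or v0 gt_eqF.
have bb : dot b b = 1 - dot a a by rewrite /b !dotE mulrA -expr2 m2 mulfVK.
have bv : cspan b `<=>` cspan v by apply: cspan_sym => //; exact/cspanZ/cspanv.
have ab : dot a b = 0 by rewrite dotZr av mulr0.
have aJb : dot a (J b) = 0 by rewrite JZ dotZr aJv mulr0.
clearbody b.
have nz x y : 1 - dot (a + cs x y b) (a + cs x y b) = (1 - dot a a) * (1 - (x ^+ 2 + y ^+ 2)).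
  have o : dot a (cs x y b) = 0 by rewrite /cs dotDr !dotZr ab aJb !mulr0 addr0.
  by rewrite (dot_add_orth o) dot_cs bb; ring.
exists a, b; split=> //; split=> [z|q Hq w]; last first.
  apply: iff_trans (line_cspan w Hp Hq Tv v0) _; split; first by move/(proj2 bv).
  by move/(proj1 bv).
have zin x y : z = a + cs x y b -> CH2 z <-> x ^+ 2 + y ^+ 2 < 1.
  move=> ->; rewrite /CH2 /= -subr_gt0 nz pmulr_rgt0 // subr_gt0.
  by split.
rewrite (line_eq Hp Tv v0); split.
  move=> [hz zv].
  have : cspan b (z - a).
    apply/(proj2 bv); rewrite (_ : z - a = (z - p) - (a - p)); last by rewrite opprB subrKA.
    by apply: cspanD => //; apply: cspanN.
  move=> [x [y E]]; have zE : z = a + cs x y b by rewrite -E addrC subrK.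
  by exists x, y; split=> //; apply/(zin x y zE).
move=> [x [y [zE xy]]]; split; first exact/(zin x y zE).
rewrite (_ : z - p = (z - a) + (a - p)); last by rewrite subrKA.
apply: cspanD => //; apply/(proj1 bv); rewrite zE addrC addKr; eexists; eexists; reflexivity.
Qed.

End Given.
End Lines.

(** * Symmetry of second derivatives *)

Section Schwarz.
Variable R : realType.

Lemma is_diff_sum (U W : normedModType R) (I : finType) (f df : I -> U -> W) x :
  (forall i, is_diff x (f i) (df i)) ->
  is_diff x (fun y => \sum_i f i y) (fun v => \sum_i df i v).
Proof.
move=> H; apply: (@is_diff_ext _ _ _ (\sum_i f i) _ (\sum_i df i)).
- elim: (index_enum _) => [|i s IH]; first by rewrite !big_nil; apply: is_diff_cst.
  by rewrite !big_cons; apply: is_diffD.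
- by move=> y; rewrite fct_sumE.
- by move=> v; rewrite fct_sumE.
Qed.

Lemma is_derive_sum_fun (W : normedModType R) (I : finType) (c : I -> R -> W) (d : I -> W) (t : R) :
  (forall i, is_derive t 1 (c i) (d i)) ->
  is_derive t 1 (fun s => \sum_i c i s) (\sum_i d i).
Proof.
move=> H; apply/is_diff_derive.
have := is_diff_sum (fun i => (is_diff_derive _ _ _).2 (H i)).
by move=> D; apply: is_diff_ext D _ _ => // h; rewrite scaler_sumr.
Qed.

Lemma is_derive_coord n (c : R -> 'rV[R]_n) (t : R) (c' : 'rV[R]_n) i :
  is_derive t 1 c c' -> is_derive t 1 (fun s => c s ord0 i) (c' ord0 i).
Proof. by move=> H; have := is_derive_lin (@rowcoord R n i) H. Qed.

Lemma is_derive_diff n (W : normedModType R) (f : 'rV[R]_n -> W) (A : set 'rV[R]_n)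
   (c v : R -> 'rV[R]_n) (t : R) (c' v' : 'rV[R]_n) : open A -> Ck 2 A f -> A (c t) ->
  is_derive t 1 c c' -> is_derive t 1 v v' ->
  is_derive t 1 (fun s => 'd f (c s) (v s))
    ('d (fun z => 'd f z (v t)) (c t) c' + 'd f (c t) v').
Proof.
move=> oA Hf At Hc Hv.
have H i : is_diff (c t) (fun z => 'd f z (delta_mx 0 i)) ('d (fun z => 'd f z (delta_mx 0 i)) (c t)).
  exact: (CkS_diff (Ckd (delta_mx 0 i) Hf) At).
have Hs := is_derive_sum_fun (fun i => is_derive_scale (is_derive_coord i Hv) (is_derive_diff_comp (H i) Hc)).
apply: is_derive_fext (is_derive_eq Hs _) _ => [|s]; last by rewrite [RHS]diff_row_sum.
rewrite big_split /=; congr (_ + _); last by rewrite [RHS]diff_row_sum.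
have Hd := is_diff_sum (fun i => is_diff_scale (is_diff_cst (v t ord0 i) (c t)) (H i)).
have Hd2 := is_diff_ext Hd (fun z => esym (diff_row_sum f z (v t))) (fun=> erefl).
have /(congr1 (fun g => g c')) E := diff_val (is_diff_def := Hd2).
apply: etrans (esym E); apply: eq_bigr => i _.
by rewrite scale0r addr0.
Qed.

Lemma is_diffE (U W : normedModType R) (f df : U -> W) x v : is_diff x f df -> 'd f x v = df v.
Proof. by move=> /(@diff_val _ _ _ _ _ _ _) ->. Qed.

Lemma is_diffZ_val (U W : normedModType R) (f df : U -> W) x h v :
  is_diff x f df -> df (h *: v) = h *: df v.
Proof. by move=> [_ <-]; rewrite linearZ. Qed.

Lemma diffZv (U W : normedModType R) (f : U -> W) x h v : 'd f x (h *: v) = h *: 'd f x v.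
Proof. exact: linearZ. Qed.

Lemma strict_is_diff n (g dg : 'rV[R]_n -> R) (W : set 'rV[R]_n) q (e : R) :
  open W -> W q -> Ck 1 W g -> is_diff q g dg -> 0 < e ->
  exists2 d : R, 0 < d & forall x y, `|x - q| < d -> `|y - q| < d ->
    `|g x - g y - dg (x - y)| <= e * `|x - y|.
Proof.
move=> oW Wq Cg Dg e0; have [d d0 H] := strict_diff oW Wq Cg e0.
by exists d => // x y xd yd; rewrite -(is_diffE _ Dg); apply: H.
Qed.

Lemma second_difference_aux (D a b h l e u : R) : D = h * a - h * b ->
  `|a - b - h * l| <= e * (`|h| * u) -> `|D - h ^+ 2 * l| <= e * (h ^+ 2 * u).
Proof.
move=> -> Hle; have -> : h * a - h * b - h ^+ 2 * l = h * (a - b - h * l) by ring.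
rewrite normrM; apply: le_trans (ler_wpM2l (normr_ge0 h) Hle) _.
rewrite -(@real_normK _ h) ?num_real // le_eqVlt; apply/orP; left; apply/eqP; ring.
Qed.

(** The mean value theorem for z |-> f (z + h u) - f z in direction h v gives h times an increment
    of ['d f _ v] over h u, based at an unknown point. Strict differentiability compares it with h L
    u although that point is not [q]. *)
Lemma second_difference n (f : 'rV[R]_n -> R) (A : set 'rV[R]_n) q u v (L : 'rV[R]_n -> R) (e : R) :
  open A -> Ck 2 A f -> A q -> is_diff q (fun z => 'd f z v) L -> (forall h : R, L (h *: u) = h * L u) ->
  0 < e -> \forall h \near (0 : R), `|f (q + h *: v + h *: u) - f (q + h *: v) - (f (q + h *: u) - f q)
     - h ^+ 2 * L u| <= e * (h ^+ 2 * `|u|).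
Proof.
move=> oA Hf Aq HL LZ e0.
have C1 := Ckd v Hf.
have [d d0 Hd] := strict_is_diff oA Aq C1 HL e0.
have /nbhs_ballP [r r0 Hr] := open_nbhs_nbhs (conj oA Aq).
pose m := Num.min d r.
have m0 : 0 < m by rewrite lt_min d0.
have : \forall h \near (0 : R), `|h| * (`|u| + `|v| + 1) < m.
  have D0 : 0 < m / (`|u| + `|v| + 1) by rewrite divr_gt0 // ltr_wpDl // addr_ge0.
  exists (m / (`|u| + `|v| + 1)) => //= h /=; rewrite sub0r normrN ltr_pdivlMr // ltr_wpDl // addr_ge0.
apply: filterS => h hm.
have nh : forall s : R, 0 <= s <= 1 -> `|q + s *: (h *: v) - q| < m /\ `|q + s *: (h *: v) + h *: u - q| < m.
  move=> s /andP[s0 s1].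
  have E1 : q + s *: (h *: v) - q = s *: (h *: v) by rewrite addrC addKr.
  have E2 : q + s *: (h *: v) + h *: u - q = s *: (h *: v) + h *: u.
    by apply/rowP => k; rewrite !mxE; ring.
  have B : `|s *: (h *: v)| <= `|h| * `|v|.
    by rewrite !normrZ (ger0_norm s0) ler_piMl // mulr_ge0.
  have := normr_ge0 u; have := normr_ge0 v; have := normr_ge0 h => n1 n2 n3.
  split; first by rewrite E1; apply: le_lt_trans B _; nra.
  rewrite E2; apply: le_lt_trans (ler_normD _ _) _; rewrite (normrZ h u); nra.
have inA x : `|x - q| < m -> A x.
  by rewrite lt_min => /andP[_ xr]; apply: Hr; rewrite -ball_normE /= distrC.
pose g z := f (z + h *: u) - f z.
have dg z : `|z - q| < m -> `|z + h *: u - q| < m ->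
    is_diff z g (fun w => 'd f (z + h *: u) w - 'd f z w).
  move=> z1 z2.
  have D1 := CkS_diff Hf (inA _ z1).
  have D2 := CkS_diff Hf (inA _ z2).
  have D3 : is_diff z (fun z => z + h *: u) id.
    by apply: is_diff_ext (is_diffD (is_diff_id z) (is_diff_cst (h *: u) z)) _ _ => // w; rewrite /= addr0.
  exact: is_diffB (is_diff_comp D3 D2) D1.
have hv : q + h *: v - q = h *: v by rewrite addrC addKr.
have [s s01|s s01] := @MVT_line _ _ g (q + h *: v) q.
  have [n1 n2] := nh s s01; rewrite hv.
  by case: (dg _ n1 n2).
rewrite hv; have [n1 n2] := nh s s01.
set y := q + s *: (h *: v) in n1 n2 *.
move=> E0; have E := etrans E0 (is_diffE (h *: v) (dg _ n1 n2)).
have {E0} := etrans E (congr2 (fun a b => a - b) (diffZv f (y + h *: u) h v) (diffZv f y h v)).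
move=> {}E.
have : `|'d f (y + h *: u) v - 'd f y v - L (y + h *: u - y)| <= e * `|y + h *: u - y|.
  by move: n1 n2; rewrite !lt_min => /andP[n1 _] /andP[n2 _]; apply: Hd.
have -> : y + h *: u - y = h *: u by rewrite addrC addKr.
rewrite LZ normrZ.
exact: (second_difference_aux E).
Qed.

(** The second difference is symmetric in [u] and [v], and divided by h^2 it approaches both
    values. *)
Lemma diff_sym n (f : 'rV[R]_n -> R) (A : set 'rV[R]_n) q u v (L M : 'rV[R]_n -> R) :
  open A -> Ck 2 A f -> A q ->
  is_diff q (fun z => 'd f z v) L -> is_diff q (fun z => 'd f z u) M -> L u = M v.
Proof.
move=> oA Hf Aq HL HM; apply/eqP; rewrite -subr_eq0 -normr_le0; apply/ler_addgt0Pl => e e0.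
rewrite addr0.
pose e' := e / (`|u| + `|v| + 1).
have e'0 : 0 < e' by rewrite divr_gt0 // ltr_wpDl // addr_ge0.
have LZ h : L (h *: u) = h * L u by exact: (is_diffZ_val _ _ HL).
have MZ h : M (h *: v) = h * M v by exact: (is_diffZ_val _ _ HM).
have N1 := second_difference oA Hf Aq HL LZ e'0.
have N2 := second_difference oA Hf Aq HM MZ e'0.
have N3 : \forall h \near (0 : R)^', h != 0 by exact: nbhs_dnbhs_neq.
move: (L u) (M v) N1 N2 => a b N1 N2.
near (0 : R)^' => h.
have h0 : h != 0 by near: h.
have H1 : `|f (q + h *: v + h *: u) - f (q + h *: v) - (f (q + h *: u) - f q)
     - h ^+ 2 * a| <= e' * (h ^+ 2 * `|u|).
  by near: h; exact: nbhs_dnbhs.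
have H2 : `|f (q + h *: u + h *: v) - f (q + h *: u) - (f (q + h *: v) - f q)
     - h ^+ 2 * b| <= e' * (h ^+ 2 * `|v|).
  by near: h; exact: nbhs_dnbhs.
have h2 : 0 < h ^+ 2 by rewrite exprn_even_gt0.
move: H1 H2; rewrite (_ : q + h *: u + h *: v = q + h *: v + h *: u); last by rewrite addrAC.
move: (f _) (f _) (f _) (f _) => f1 f2 f3 f4 H1 H2.
have : h ^+ 2 * `|a - b| <= e' * (h ^+ 2 * `|u|) + e' * (h ^+ 2 * `|v|).
  rewrite -{1}(gtr0_norm h2) -normrM.
  rewrite [X in `|X|](_ : _ = - (f4 - f3 - (f2 - f1) - h ^+ 2 * a) + (f4 - f2 - (f3 - f1) - h ^+ 2 * b)); last by ring.
  by apply: le_trans (ler_normD _ _) _; rewrite normrN; apply: lerD.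
rewrite (_ : e' * _ + _ = h ^+ 2 * (e' * (`|u| + `|v|))); last by ring.
rewrite ler_pM2l // => Hle; apply: le_trans Hle _.
have D0 : 0 < `|u| + `|v| + 1 by rewrite ltr_wpDl // addr_ge0.
by rewrite /e' mulrAC ler_pdivrMr // ler_pM2l // lerDl.
Unshelve. all: by end_near. Qed.

Lemma diff_sym_row n m (f : 'rV[R]_n -> 'rV[R]_m) (A : set 'rV[R]_n) q u v : open A -> Ck 2 A f -> A q ->
  'd (fun z => 'd f z v) q u = 'd (fun z => 'd f z u) q v.
Proof.
move=> oA Hf Aq; apply/rowP => i.
have D w : is_diff q (fun z => 'd (fun z => f z ord0 i) z w)
    (fun w' => ('d (fun z => 'd f z w) q w') ord0 i).
  have D1 := is_diff_coord i (CkS_diff (Ckd w Hf) Aq).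
  have E : \forall z \near q, ('d f z w) ord0 i = 'd (fun z => f z ord0 i) z w.
    apply: filterS (open_nbhs_nbhs (conj oA Aq)) => z Az.
    by rewrite (is_diffE _ (is_diff_coord i (CkS_diff Hf Az))).
  exact: is_diff_near E D1.
have Cf : Ck 2 A (fun z => f z ord0 i) by apply: Ck_coord.
exact: (diff_sym oA Cf Aq (D v) (D u)).
Qed.

End Schwarz.

(** * Isometries and reflections *)

Section Isometry.
Variable R : realType.
Notation V := 'rV[R]_(2 + 2).
Implicit Types (p q u v w x y z : V).

Lemma metricC z u v : metric z u v = metric z v u.
Proof. by rewrite /metric (dotC v u); congr (_ / _); ring. Qed.
Lemma metricDl z u v w : metric z (u + v) w = metric z u w + metric z v w.
Proof. by rewrite /metric !dotDl -mulrDl; congr (_ / _); ring. Qed.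
Lemma metricDr z u v w : metric z w (u + v) = metric z w u + metric z w v.
Proof. by rewrite metricC metricDl !(metricC _ w). Qed.
Lemma metricZl z a u v : metric z (a *: u) v = a * metric z u v.
Proof. by rewrite /metric !dotZl [RHS]mulrA; congr (_ / _); ring. Qed.
Lemma metricZr z a u v : metric z v (a *: u) = a * metric z v u.
Proof. by rewrite metricC metricZl metricC. Qed.
Lemma metricNl z u v : metric z (- u) v = - metric z u v.
Proof. by rewrite -scaleN1r metricZl mulN1r. Qed.
Lemma metricNr z u v : metric z v (- u) = - metric z v u.
Proof. by rewrite metricC metricNl metricC. Qed.
Lemma metric0l z u : metric z 0 u = 0.
Proof. by rewrite -(scale0r 0) metricZl mul0r. Qed.
Lemma metricJ z u v : metric z (J u) (J v) = metric z u v.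
Proof.
by rewrite /metric !dotE; congr (_ / _); ring.
Qed.
Lemma metricuJ z u : metric z u (J u) = 0.
Proof. by rewrite /metric !dotE; ring. Qed.
Lemma metricJl z u v : metric z (J u) v = - metric z u (J v).
Proof. by rewrite -(metricJ z u) JJ metricNr opprK. Qed.
Lemma metric_eq0 p u : CH2 p -> metric p u u = 0 -> u = 0.
Proof.
move=> hp m0; apply/eqP; apply/negPn/negP => u0.
by have := metric_gt0 hp u0; rewrite m0 ltxx.
Qed.

Lemma christoffelJ z x u : christoffel z x (J u) = J (christoffel z x u).
Proof.
rewrite /christoffel JZ !JD !JZ !JJ !dotE; congr (_ *: _).
by apply/rowP => i; rewrite !mxE; ring.
Qed.
Lemma christoffelZr z x a u : christoffel z x (a *: u) = a *: christoffel z x u.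
Proof.
rewrite /christoffel !JZ !dotE.
by apply/rowP => i; rewrite !mxE; ring.
Qed.
Lemma christoffelZl z x a u : christoffel z (a *: x) u = a *: christoffel z x u.
Proof. by rewrite christoffelC christoffelZr christoffelC. Qed.

Lemma lin_inj_surj n (L : {linear 'rV[R]_n -> 'rV[R]_n}) :
  (forall v : 'rV[R]_n, L v = 0 -> v = 0) -> forall b : 'rV[R]_n, exists v : 'rV[R]_n, L v = b.
Proof.
move=> Linj b; set A := lin1_mx L.
have fr : row_free A.
  rewrite -kermx_eq0; apply/eqP/row_matrixP => i; rewrite row0.
  apply: Linj; rewrite -(mul_rV_lin1 L); apply/eqP.
  by rewrite -sub_kermx row_sub.
exists (b *m invmx A).
by rewrite -(mul_rV_lin1 L) mulmxKV // -row_free_unit.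
Qed.

Section Iso.
Variable (s : V -> V).
Hypothesis Hs : Defs.isometry s.

Let sm : smooth_on (@CH2 R) s. Proof. by case: Hs. Qed.
Let sD z : CH2 z -> is_diff z s ('d s z).
Proof. by move=> hz; exact: (CkS_diff (sm 1%N) hz). Qed.
Lemma iso_CH2 z : CH2 z -> CH2 (s z).
Proof. by case: Hs => _ [+ _ _] _ hz; apply. Qed.
Lemma iso_metric z u v : CH2 z -> metric (s z) ('d s z u) ('d s z v) = metric z u v.
Proof. by case: Hs => _ _; apply. Qed.

Lemma iso_surj z : CH2 z -> forall b, exists v, 'd s z v = b.
Proof.
move=> hz; apply: lin_inj_surj => v v0.
by apply: (metric_eq0 hz); rewrite -iso_metric // v0 metric0l.
Qed.

Let S2 z u x := 'd (fun y => 'd s y u) z x.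

(** The isometry condition for fixed [u] and [v], differentiated along z + t x once in the target
    and once in the source. *)
Lemma iso_line_derive z x u v : CH2 z ->
  metric (s z) (S2 z u x + christoffel (s z) ('d s z x) ('d s z u)) ('d s z v) +
  metric (s z) ('d s z u) (S2 z v x + christoffel (s z) ('d s z x) ('d s z v)) =
  metric z (christoffel z x u) v + metric z u (christoffel z x v).
Proof.
move=> hz.
have D : is_derive (0 : R) 1 (fun t : R => z + t *: x) x.
  have H' := is_derive_add (is_derive_const z (0 : R))
    (is_derive_scale (is_derive_id (0 : R) 1) (is_derive_const x (0 : R))).
  by apply: (is_derive_eq H'); rewrite scaler0 scale1r !add0r.
have z0 : z + (0 : R) *: x = z by rewrite scale0r addr0.
have D1 : is_derive (0 : R) 1 (fun t : R => s (z + t *: x)) ('d s z x).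
  by apply: is_derive_diff_comp D; rewrite z0; apply: sD.
have D2 w : is_derive (0 : R) 1 (fun t : R => 'd s (z + t *: x) w) (S2 z w x).
  apply: (@is_derive_diff_comp R _ _ (fun y => 'd s y w)) D; rewrite z0.
  exact: (CkS_diff (Ckd w (sm 2)) hz).
have := @metric_curve _ _ _ _ 0 _ _ _ _ D1 (D2 u) (D2 v).
rewrite z0 => /(_ (iso_CH2 hz)) D3.
have D4 := metric_christoffel x u v hz.
have near_in : \forall t \near (0 : R), CH2 (z + t *: x).
  have := is_derive_cont D; rewrite /prop_for /continuous_at z0.
  by move=> /(_ _ (open_nbhs_nbhs (conj (@CH2_open R) hz))).
have E : \forall t \near (0 : R), metric (z + t *: x) u v =
    metric (s (z + t *: x)) ('d s (z + t *: x) u) ('d s (z + t *: x) v).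
  move: near_in; apply: filterS => t ht; by rewrite iso_metric.
have D5 := near_eq_is_derive E D4.
have [_ <-] := D3; have [_ <-] := D5; reflexivity.
Qed.

(* Koszul: the defect of the Christoffel symbols under s, read as a trilinear
   form, is symmetric in two arguments and skew in two others, hence zero. *)
Lemma iso_christoffel z x u : CH2 z ->
  S2 z u x + christoffel (s z) ('d s z x) ('d s z u) = 'd s z (christoffel z x u).
Proof.
move=> hz.
pose A x u := S2 z u x + christoffel (s z) ('d s z x) ('d s z u) - 'd s z (christoffel z x u).
pose T x u v := metric (s z) (A x u) ('d s z v).
have Asym x' u' : A x' u' = A u' x'.
  rewrite /A christoffelC (christoffelC z); congr (_ + _ - _).
  exact: (diff_sym_row _ _ (@CH2_open R) (sm 2)).
have Tsk x' u' v' : T x' u' v' = - T x' v' u'.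
  apply/eqP; rewrite -addr_eq0 /T /A metricDl (metricDl _ _ (- _)) !metricNl !iso_metric //.
  rewrite addrACA -opprD (metricC _ (_ + _) ('d s z u')) iso_line_derive //.
  by rewrite (metricC z (christoffel z x' v')) subrr.
have T0 x' u' v' : T x' u' v' = 0.
  have Ts a b c : T a b c = T b a c by rewrite /T Asym.
  have : T x' u' v' = - T x' u' v'.
    by rewrite {1}(Tsk x' u' v') (Ts x' v' u') (Tsk v' x' u') opprK (Ts v' u' x') (Tsk u' v' x') (Ts u' x' v').
  by move=> H; lra.
have [w wE] := iso_surj hz (A x u).
have : A x u = 0.
  by apply: (metric_eq0 (iso_CH2 hz)); rewrite -{2}wE; apply: T0.
by move/eqP; rewrite subr_eq0 => /eqP.
Qed.

Lemma iso_geodesic (c : R -> V) : is_geodesic c -> is_geodesic (fun t => s (c t)).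
Proof.
move=> Hc; have [sc cin cov] := Hc.
have G := geodesic_systemP Hc.
have D1 (t : R) : is_derive t 1 (fun t => s (c t)) ('d s (c t) (derive1 c t)).
  by have [_ c1 _] := G t; apply: is_derive_diff_comp c1; apply: sD.
have E1 : derive1 (fun t => s (c t)) = fun t => 'd s (c t) (derive1 c t).
  by apply/funext => t; apply: is_derive1.
split=> [k|t|t]; [|exact: iso_CH2|].
  by apply: (@Ck_comp _ _ _ _ _ (@CH2 R)); [exact: openT|move=> t _; exact: cin|exact: sm|exact: sc].
have [_ c1 c2] := G t.
have D2 := is_derive_diff (@CH2_open R) (sm 2) (cin t) c1 c2.
rewrite /cov_accel E1 (is_derive1 D2).
have aux (a b g d : V) : d = - b -> a + g = b -> a + d + g = 0.
  by move=> -> <-; rewrite addrAC subrr.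
exact: (aux _ _ _ _ (linearN _ _) (iso_christoffel _ _ (cin t))).
Qed.

Lemma iso_geod p u t : CH2 p -> metric p u u = 1 ->
  s (geoE p u t) = geoE (s p) ('d s p u) t.
Proof.
move=> hp hu.
have hsu : metric (s p) ('d s p u) ('d s p u) = 1 by rewrite iso_metric.
rewrite -(geodE (iso_CH2 hp) hsu) (geodP (c := fun t => s (geoE p u t))) //.
- exact/iso_geodesic/geoE_geodesic.
- by rewrite geoE0.
- have := is_derive_diff_comp (c := geoE p u) _ (is_derive_geoE hp hu 0).
  rewrite geoE0 geoV0 => /(_ _ _ _ (sD hp)) D.
  by rewrite (is_derive1 D).
Qed.

End Iso.
End Isometry.

(** * Explicit form of the reflection in a complex line *)

Section Reflection.
Variable R : realType.
Notation V := 'rV[R]_(2 + 2).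
Implicit Types (p q u v w x y z : V).

Lemma mulr_lt1_contra (X Y : R) : 0 <= X -> 0 <= Y -> 0 < 1 - X -> 0 < 1 - Y -> 1 <= X * Y -> False.
Proof. by move=> *; nra. Qed.

(** The analogue of [cproj] for the metric at [z]. *)
Definition mproj (z b w : V) := cs (metric z w b / metric z b b) (metric z w (J b) / metric z b b) b.

Lemma mproj_orth z b w v : CH2 z -> b != 0 -> cspan b v -> metric z (w - mproj z b w) v = 0.
Proof.
move=> hz b0 [x [y ->]].
have m0 : metric z b b != 0 by rewrite gt_eqF // metric_gt0.
rewrite /mproj /cs !(metricDl, metricDr, metricZl, metricZr, metricNl, metricNr).
rewrite (metricC z (J b) b) !metricuJ metricJ.
by field.
Qed.

Lemma cproj_cs b w (x y : R) : cproj b (cs x y w) = cs x y (cproj b w).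
Proof.
rewrite /cproj csM; congr (cs _ _ b); rewrite /cs !dotE; ring.
Qed.

Lemma k1J p u : k1 p (J u) = - k2 p u.
Proof. by rewrite /k1 /k2 dotJl mulNr. Qed.
Lemma k2J p u : k2 p (J u) = k1 p u.
Proof. by rewrite /k1 /k2 dotJ. Qed.
Section Given.
Variables (H : set V) (s : V -> V) (a b : V).
Hypotheses (HH : complex_line H) (Hr : Defs.reflection H s).
Hypotheses (ab : dot a b = 0) (aJb : dot a (J b) = 0) (bb : dot b b = 1 - dot a a) (ha : CH2 a).
Hypothesis Heq : forall z, H z <-> exists x y : R, z = a + cs x y b /\ x ^+ 2 + y ^+ 2 < 1.
Hypothesis HT : forall q, H q -> forall w, tangent 2 H q w <-> cspan b w.

Let Hs : Defs.isometry s. Proof. by case: Hr. Qed.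
Let P0 : 0 < 1 - dot a a. Proof. exact: CH2_gt0. Qed.
Let b0 : b != 0. Proof. by rewrite -dot_eq0 bb gt_eqF. Qed.
Let Ha : H a.
Proof. by apply/Heq; exists 0, 0; rewrite cs00 addr0 expr0n addr0; split. Qed.

Lemma line_in z : CH2 z -> cspan b (z - a) -> H z.
Proof.
move=> hz zb; rewrite (line_eq HH Ha ((HT Ha b).2 (cspanv b)) b0).
by split.
Qed.

(** [s] minus the identity vanishes on [H], which near [q] contains the straight line through [q] in
    direction [v]. *)
Lemma refl_diff_tangent q v : H q -> cspan b v -> 'd s q v = v.
Proof.
move=> Hq bv; have hq := line_CH2 HH Hq.
have sD : is_diff q s ('d s q) by case: Hs => sm _ _; exact: (CkS_diff (sm 1%N) hq).
have D : is_derive (0 : R) 1 (fun t : R => q + t *: v) v.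
  have H' := is_derive_add (is_derive_const q (0 : R))
    (is_derive_scale (is_derive_id (0 : R) 1) (is_derive_const v (0 : R))).
  by apply: (is_derive_eq H'); rewrite scaler0 scale1r !add0r.
have gD : is_diff q (fun z => s z - z) (fun w => 'd s q w - w).
  exact: is_diffB sD (is_diff_id q).
have q0 : q + (0 : R) *: v = q by rewrite scale0r addr0.
have : 'd (fun z => s z - z) q v = 0.
  apply: (curve_kills (c := fun t : R => q + t *: v) q0 D); first by case: gD.
  have := is_derive_cont D; rewrite /prop_for /continuous_at q0.
  move=> /(_ _ (open_nbhs_nbhs (conj (@CH2_open R) hq))).
  move=> Hn; apply: (@filterS _ (nbhs (0 : R)) _ (fun t : R => CH2 (q + t *: v))) => // t ht.
  apply/eqP; rewrite subr_eq0; apply/eqP.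
  case: Hr => _ + _; apply; apply: line_in => //.
  rewrite addrAC; apply: cspanD; last exact: cspanZ.
  by have /Heq [x [y [-> _]]] := Hq; rewrite addrC addKr; eexists; eexists.
move=> Hx; have := etrans (esym (is_diffE v gD)) Hx.
by move/subr0_eq.
Qed.

Lemma refl_diff q w : H q -> 'd s q w = 2 *: mproj q b w - w.
Proof.
move=> Hq; have hq := line_CH2 HH Hq.
have E1 : 'd s q (mproj q b w) = mproj q b w.
  by apply: refl_diff_tangent => //; eexists; eexists.
have E2 : 'd s q (w - mproj q b w) = - (w - mproj q b w).
  case: Hr => _ _; apply => // v /(HT Hq) bv.
  exact: mproj_orth.
have E3 : 'd s q w = 'd s q (mproj q b w) + 'd s q (w - mproj q b w).
  by rewrite -linearD; congr ('d s q _); rewrite subrKC.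
apply: (etrans E3); apply: (etrans (congr2 +%R E1 E2)).
by rewrite opprB addrA scaler_nat mulr2n.
Qed.

(** At [a], which is Hermitian orthogonal to [b], the metric and the Euclidean projections agree;
    this is why the formula for [s] is based at [a]. *)
Lemma mproj_a w : mproj a b w = cproj b w.
Proof.
have Pn : 1 - dot a a != 0 by rewrite gt_eqF.
have ba : dot b a = 0 by rewrite dotC.
have bJa : dot b (J a) = 0 by rewrite dotC dotJl aJb oppr0.
rewrite /mproj /cproj; congr (cs _ _ b); rewrite /metric; try rewrite !dotE; rewrite bb ?ba ?bJa; field => //.
Qed.

Let L w := 2 *: cproj b w - w.

Lemma L_cs (x y : R) w : L (cs x y w) = cs x y (L w).
Proof.
rewrite /L cproj_cs; move: (cproj b w) => c; rewrite /cs !(JD, JN, JZ).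
by apply/rowP => i; rewrite !mxE; ring.
Qed.

Lemma dot_cproj_a w : dot (cproj b w) a = 0.
Proof. by rewrite /cproj /cs !dotE (dotC b) ab (dotC b (J a)) !dotE aJb; ring. Qed.
Lemma dot_cproj_Ja w : dot (cproj b w) (J a) = 0.
Proof. by rewrite /cproj /cs !dotE (dotC b a) ab (dotC b (J a)) !dotE aJb; ring. Qed.

Lemma k1_L w : k1 a (L w) = - k1 a w.
Proof. by rewrite /k1 /L dotDl dotZl dotNl dot_cproj_a mulr0 add0r mulNr. Qed.
Lemma k2_L w : k2 a (L w) = - k2 a w.
Proof. by rewrite /k2 /L dotDl dotZl dotNl dot_cproj_Ja mulr0 add0r mulNr. Qed.

Let m1 z := 1 - 2 * k1 a (z - a).
Let m2 z := - 2 * k2 a (z - a).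

(* s (a + w) = a + L w / (1 - 2 <w, a> / (1 - |a|^2)), in complex notation, since s maps
   the geodesic from a with velocity u to the one with velocity L u. *)
Lemma refl_eq z : CH2 z -> cs (m1 z) (m2 z) (s z - a) = L (z - a).
Proof.
move=> hz; have [->|za] := eqVneq z a.
  have -> : s a = a by case: Hr => _ + _; apply.
  rewrite subrr -(cs00 a) csM /L !mulr0 subrr addr0 cs00 subr0.
  by rewrite /cproj !dot0l !mul0r cs00 scaler0.
have [x [y [t [u1 t0 zE _]]]] := exp_surj ha hz za.
set u := cs x y _ in u1 zE.
have sE : s z = geoE a (L u) t.
  rewrite zE iso_geod //; congr (geoE _ _ t); last by rewrite refl_diff // mproj_a.
  by case: Hr => _ + _; apply.
have zw : z - a = cs (sg1 a u t) (sg2 a u t) u by rewrite zE /geoE addrC addKr.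
have sw : s z - a = cs (sg1 a (L u) t) (sg2 a (L u) t) (L u) by rewrite sE /geoE addrC addKr.
rewrite sw /m1 /m2 zw L_cs csM.
have D0 := omd_gt0 ha u1 t.
have D1 : 0 < omd a (L u) t.
  have hL : metric a (L u) (L u) = 1.
    have sa : s a = a by case: Hr => _ + _; apply.
    have dE : 'd s a u = L u by rewrite refl_diff // mproj_a.
    have := iso_metric Hs u u ha; rewrite sa u1 => /(etrans _); apply.
    by rewrite -[L u]dE.
  exact: omd_gt0.
move: D0 D1; rewrite k1_cs k2_cs /sg1 /sg2 /omd /om1 /om2 k1_L k2_L !mulNr.
move: (k1 a u) (k2 a u) (ch t) (sh t) => c d C S D0 D1.
by congr (cs _ _ _); field; rewrite !gt_eqF.
Qed.

(** At a zero of the denominator [L (z - a)] vanishes; then so does z - a, but there the denominator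
    is 1. *)
Lemma refl_m_neq0 z : CH2 z -> (m1 z != 0) || (m2 z != 0).
Proof.
move=> hz; rewrite -negb_and; apply/negP => /andP[/eqP z1 /eqP z2].
have := refl_eq hz; rewrite z1 z2 cs00 => /esym/eqP; rewrite subr_eq0 => /eqP E.
have E2 : cproj b (z - a) = 2 *: cproj b (z - a).
  rewrite -[in LHS]E (_ : 2 *: _ = cs 2 0 (cproj b (z - a))); last by rewrite /cs scale0r addr0.
  rewrite cproj_cs [X in cs _ _ X]cproj_id //; last exact: cproj_span.
have c0 : cproj b (z - a) = 0.
  move: E2; move: (cproj b (z - a)) => c; rewrite scaler_nat mulr2n => /eqP.
  by rewrite -subr_eq0 opprD addrA subrr sub0r oppr_eq0 => /eqP.
move: z1; rewrite /m1 -E c0 scaler0 /k1 dot0l mul0r mulr0 subr0 => /eqP.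
by rewrite oner_eq0.
Qed.

Lemma is_diff_refl_m1 z : is_diff z m1 (fun v => - 2 * k1 a v).
Proof.
have H1 : is_diff z (fun z => z - a) id.
  by apply: is_diff_ext (is_diffB (is_diff_id z) (is_diff_cst a z)) _ _ => // w; rewrite /= subr0.
have H2 := is_diff_dot H1 (is_diff_cst a z).
have H3 := is_diff_scale (is_diff_cst (-2 / (1 - dot a a)) z) H2.
apply: is_diff_ext (is_diffD (is_diff_cst (1 : R) z) H3) _ _ => w.
  transitivity (1 + -2 / (1 - dot a a) * dot (w - a) a); first by [].
  by rewrite /m1 /k1; ring.
transitivity (0 + (-2 / (1 - dot a a) * (dot w a + dot (z - a) 0) + 0 * dot (z - a) a)); first by [].
by rewrite /k1 !dot0r; ring.
Qed.

Lemma is_diff_refl_m2 z : is_diff z m2 (fun v => - 2 * k2 a v).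
Proof.
have H1 : is_diff z (fun z => z - a) id.
  by apply: is_diff_ext (is_diffB (is_diff_id z) (is_diff_cst a z)) _ _ => // w; rewrite /= subr0.
have H2 := is_diff_dot H1 (is_diff_cst (J a) z).
have H3 := is_diff_scale (is_diff_cst (-2 / (1 - dot a a)) z) H2.
apply: is_diff_ext H3 _ _ => w.
  transitivity (-2 / (1 - dot a a) * dot (w - a) (J a)); first by [].
  by rewrite /m2 /k2; ring.
transitivity (-2 / (1 - dot a a) * (dot w (J a) + dot (z - a) 0) + 0 * dot (z - a) (J a)); first by [].
by rewrite /k2 !dot0r; ring.
Qed.

Lemma is_diff_L z : is_diff z (fun z => L (z - a)) L.
Proof.
have Llin : linear L.
  move=> c u v; rewrite /L /cproj /cs !(dotDl, dotZl) scalerDr.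
  by apply/rowP => i; rewrite !mxE; ring.
pose LM := GRing.isLinear.Build R V V _ L Llin.
pose LL : {linear V -> V} := HB.pack L LM.
have H1 : is_diff z (fun z => z - a) id.
  by apply: is_diff_ext (is_diffB (is_diff_id z) (is_diff_cst a z)) _ _ => // w; rewrite /= subr0.
exact: (is_diff_lin LL H1).
Qed.

Lemma refl_eq_diff z v : CH2 z ->
  cs (m1 z) (m2 z) ('d s z v) + cs (- 2 * k1 a v) (- 2 * k2 a v) (s z - a) = L v.
Proof.
move=> hz.
have sD : is_diff z s ('d s z) by case: Hs => sm _ _; exact: (CkS_diff (sm 1%N) hz).
have H1 : is_diff z (fun z => s z - a) ('d s z).
  by apply: is_diff_ext (is_diffB sD (is_diff_cst a z)) _ _ => // w; rewrite /= subr0.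
have H2 := is_diffD (is_diff_scale (is_diff_refl_m1 z) H1)
   (is_diff_scale (is_diff_refl_m2 z) (is_diff_lin (@J R) H1)).
have NE : \forall y \near z, L (y - a) = m1 y *: (s y - a) + m2 y *: J (s y - a).
  by apply: filterS (open_nbhs_nbhs (conj (@CH2_open R) hz)) => y /refl_eq <-.
have H3 := is_diff_near NE (is_diff_L z).
have E := etrans (esym (is_diffE v H3)) (is_diffE v H2).
apply: etrans _ (esym E).
by rewrite /= /cs; apply: addrACA.
Qed.

Lemma cs_injl (x y : R) u v : (x != 0) || (y != 0) -> cs x y u = cs x y v -> u = v.
Proof.
move=> xy E; have N0 : x ^+ 2 + y ^+ 2 != 0.
  by rewrite paddr_eq0 ?sqr_ge0 // !sqrf_eq0; move: xy; rewrite -negb_and.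
have : cs (x / (x ^+ 2 + y ^+ 2)) (- y / (x ^+ 2 + y ^+ 2)) (cs x y u) = cs (x / (x ^+ 2 + y ^+ 2)) (- y / (x ^+ 2 + y ^+ 2)) (cs x y v) by rewrite E.
rewrite !csM.
have -> : x / (x ^+ 2 + y ^+ 2) * x - - y / (x ^+ 2 + y ^+ 2) * y = 1 by field.
have -> : x / (x ^+ 2 + y ^+ 2) * y + - y / (x ^+ 2 + y ^+ 2) * x = 0 by field.
by rewrite !cs10.
Qed.

Lemma cproj_J w : cproj b (J w) = J (cproj b w).
Proof.
have JE c : J c = cs 0 1 c by rewrite /cs scale0r scale1r add0r.
by rewrite !JE cproj_cs.
Qed.

(** A reflection is only assumed to be an isometry. That it is holomorphic is read off the explicit
    formula, whose denominator and numerator are complex affine. *)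
Lemma refl_J z v : CH2 z -> 'd s z (J v) = J ('d s z v).
Proof.
move=> hz; apply: (cs_injl (refl_m_neq0 hz)).
have E1 := refl_eq_diff (J v) hz; have E2 := congr1 (@J R) (refl_eq_diff v hz).
move: E1 E2; rewrite k1J k2J; move: ('d s z (J v)) ('d s z v) => d e E1 E2.
have LJ : L (J v) = J (L v) by rewrite /L cproj_J; move: (cproj b v) => c; rewrite JD JZ JN.
have : cs (m1 z) (m2 z) d + cs (- 2 * - k2 a v) (- 2 * k1 a v) (s z - a) =
   J (cs (m1 z) (m2 z) e + cs (- 2 * k1 a v) (- 2 * k2 a v) (s z - a)).
  by rewrite E1 E2.
rewrite JD (csJ (- 2 * k1 a v)) mulrN => /addIr ->.
by rewrite /cs !JD !JZ.
Qed.

(** Pairing the formula for s z = z with the component [n] of z - a orthogonal to [b] gives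
    [m1 z = -1] unless n = 0. This means [dot z a = 1], which the Cauchy-Schwarz inequality excludes
    in the ball. *)
Lemma refl_fix z : CH2 z -> s z = z -> H z.
Proof.
move=> hz sz; apply: line_in => //.
have E := refl_eq hz; rewrite sz in E.
set w := z - a in E *.
set n := w - cproj b w.
have n1 : dot n b = 0 by exact: cproj_orth.
have n2 : dot n (J b) = 0 by exact: cproj_orthJ.
have np : dot (cproj b w) n = 0 by rewrite dotC /cproj /cs dotDr !dotZr n1 n2 !mulr0 addr0.
have npJ : dot (J (cproj b w)) n = 0.
  by rewrite dotC /cproj /cs JD !JZ JJ dotDr !dotZr dotNr n1 n2 oppr0 !mulr0 addr0.
have wE : w = cproj b w + n by rewrite subrKC.
have [n0|n0] := eqVneq n 0; first by rewrite wE n0 addr0; apply: cproj_span.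
have N0 := dot_gt0 n0.
have LE : L w = cproj b w - n.
  by rewrite /L {2}wE opprD addrA scaler_nat mulr2n addrK.
have wn : dot w n = dot n n by rewrite {1}wE dotDl np add0r.
have Jwn : dot (J w) n = 0 by rewrite {1}wE JD dotDl npJ add0r dotC dotuJ.
have := congr1 (fun x => dot x n) E; rewrite LE [RHS]dotDl dotNl np add0r.
rewrite /cs dotDl !dotZl wn Jwn mulr0 addr0 => E3.
have mz : m1 z = -1 by apply: (mulIf (x := dot n n)); rewrite ?gt_eqF // mulN1r.
have k1z : k1 a w = 1 by move: mz; rewrite /m1 -/w => h; lra.
have az : dot z a = 1.
  have Pn : 1 - dot a a != 0 by rewrite gt_eqF.
  have : dot w a = 1 - dot a a by rewrite -[LHS](mulfVK Pn) -/(k1 a w) k1z mul1r.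
  by rewrite /w dotDl dotNl => h; lra.
have := dot_CauchySchwarz z a; rewrite az expr1n.
have z0 := CH2_gt0 hz; have H1 := dot_ge0 z; have H2 := dot_ge0 a; have H3 := P0; move=> H0.
by exfalso; apply: (mulr_lt1_contra H1 H2 z0 H3 H0).
Qed.

End Given.
End Reflection.

(** * Convex hypersurfaces *)

Section Hyper.
Variable R : realType.
Notation V := 'rV[R]_(2 + 2).
Implicit Types (p q u v w x y z : V) (N : set V).

Lemma norm_le_all (a K : R) : 0 <= K -> (forall e : R, 0 < e <= 1 -> `|a| <= e * K) -> a = 0.
Proof.
move=> K0 H; apply/eqP; rewrite -normr_le0; apply/ler_addgt0Pl => e e0; rewrite addr0.
pose e' := Num.min 1 (e / (K + 1)).
have K1 : 0 < K + 1 by rewrite ltr_wpDl.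
have e'0 : 0 < e' by rewrite lt_min ltr01 divr_gt0.
apply: le_trans (H e' _) _; first by rewrite e'0 /e' ge_min lexx.
apply: (@le_trans _ _ (e / (K + 1) * K)).
  by apply: ler_wpM2r => //; rewrite /e' ge_min lexx orbT.
by rewrite mulrAC ler_pdivrMr // ler_pM2l // lerDl.
Qed.

Lemma diff_line (g : V -> R) q u n (t x : R) :
  'd g q (t *: (u + x *: n)) = t * ('d g q u + x * 'd g q n).
Proof.
apply: (etrans (diffZv _ _ _ _)); congr (_ * _).
by apply: (etrans (linearD _ _ _)); congr (_ + _); exact: diffZv.
Qed.

(* By the intermediate value theorem f has zeros close to q in the direction u,
   where 'd f q u = 0, although no curve of zeros is available. *)
Lemma zeros_kill (f g : V -> R) (D : set V) q u n :
  f q = 0 -> (\forall z \near q, differentiable f z) -> 'd f q u = 0 -> 0 < 'd f q n ->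
  differentiable g q -> D q -> (forall t r : R, D (q + t *: (u + r *: n))) ->
  (\forall z \near q, D z -> f z = 0 -> g z = 0) -> 'd g q u = 0.
Proof.
move=> fq0 df fu fn dg Dq HD Hfg.
have gq0 : g q = 0 by exact: (nbhs_singleton Hfg).
have dfq : differentiable f q by exact: nbhs_singleton df.
set c := 'd f q n in fn.
have K0 : 0 <= `|'d g q n| + (`|u| + `|n|) by rewrite !addr_ge0.
apply: (norm_le_all K0) => e /andP[e0 e1].
pose M := `|u| + `|n| + 1.
have M0 : 0 < M by rewrite ltr_wpDl // addr_ge0.
(* With this precision the error of [f] at q + t (u + x n), for |x| <= 1, is at most half of the
   main term t e c attained at x = e, so [k] below changes sign on [-e, e]. *)
pose d1 := e * c / 2 / M.
have d10 : 0 < d1 by rewrite !divr_gt0 // mulr_gt0.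
have N1 := diff_eps dfq d10.
have N2 := diff_eps dg e0.
have N3 : \forall h \near (0 : V), differentiable f (q + h) /\ (D (q + h) -> f (q + h) = 0 -> g (q + h) = 0).
  have cq : q + h @[h --> (0 : V)] --> q.
    by rewrite -[X in _ --> X]addr0; exact: (cvgD (cvg_cst _) cvg_id).
  exact: (cq _ (filterI df Hfg)).
have /nbhs_ballP [r r0 Hr] : nbhs (0 : V) (fun h => `|f (q + h) - f q - 'd f q h| <= d1 * `|h| /\
    `|g (q + h) - g q - 'd g q h| <= e * `|h| /\
    (differentiable f (q + h) /\ (D (q + h) -> f (q + h) = 0 -> g (q + h) = 0))).
  by apply: filterI => //; apply: filterI.
pose t := r / (2 * M).
have t0 : 0 < t by rewrite divr_gt0 // mulr_gt0.
have hb (x : R) : `|x| <= 1 -> `|u + x *: n| <= `|u| + `|n|.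
  move=> x1; apply: le_trans (ler_normD _ _) _; rewrite lerD2l normrZ.
  by apply: ler_piMl.
have hin (x : R) : `|x| <= 1 -> ball 0 r (t *: (u + x *: n)).
  move=> x1; rewrite -ball_normE /= sub0r normrN normrZ gtr0_norm //.
  apply: (@le_lt_trans _ _ (t * M)); first by rewrite ler_pM2l //; apply: le_trans (hb x x1) _; rewrite lerDl.
  by rewrite /t invfM mulrA mulfVK ?gt_eqF // ltr_pdivrMr // ltr_pMr // ltr1n.
clearbody t.
pose k (x : R) := f (q + t *: (u + x *: n)).
have kest (x : R) : `|x| <= 1 -> `|k x - t * (x * c)| <= t * (e * c / 2).
  move=> x1; have [H1 _] := Hr _ (hin x x1).
  move: H1; rewrite fq0 subr0 diff_line fu add0r -/c => H1; apply: le_trans H1 _; rewrite normrZ gtr0_norm // mulrCA ler_pM2l //.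
  apply: (@le_trans _ _ (d1 * M)).
    by rewrite ler_pM2l //; apply: le_trans (hb x x1) _; rewrite lerDl.
  by rewrite /d1 mulfVK // gt_eqF.
have e1' : `|e| <= 1 by rewrite gtr0_norm.
have ec : 0 < e * c by rewrite mulr_gt0.
have tec : 0 < t * (e * c) by rewrite mulr_gt0.
have kp : 0 < k e.
  have := kest e e1'; rewrite ler_norml => /andP[H1 _]; move: H1 tec.
  rewrite (_ : t * (e * c / 2) = t * (e * c) / 2); last by rewrite mulrA.
  by move: (t * (e * c)) (k e) => A B; lra.
have kn : k (- e) < 0.
  have := kest (- e); rewrite normrN => /(_ e1'); rewrite ler_norml => /andP[_ H1]; move: H1 tec.
  rewrite (_ : t * (e * c / 2) = t * (e * c) / 2); last by rewrite mulrA.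
  rewrite (_ : t * (- e * c) = - (t * (e * c))); last by rewrite mulNr mulrN.
  by move: (t * (e * c)) (k (- e)) => A B; lra.
have ck : {within `[- e, e], continuous k}.
  apply: derivable_within_continuous => x; rewrite in_itv /= => xe.
  have x1 : `|x| <= 1 by rewrite ler_norml; lra.
  have [_ [_ [dfx _]]] := Hr _ (hin x x1).
  have Dx : is_derive x 1 (fun x : R => q + t *: (u + x *: n)) (t *: n).
    have H' := is_derive_add (is_derive_const q x) (is_derive_scale (is_derive_const t x)
      (is_derive_add (is_derive_const u x) (is_derive_scale (is_derive_id x 1) (is_derive_const n x)))).
    by apply: (is_derive_eq H'); rewrite !add0r !scale0r scaler0 addr0 scale1r add0r.
  by have [] := is_derive_diff_comp (differentiableP dfx) Dx.
have ee : - e <= e by lra.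
have [|x xe kx] := IVT (v := 0) ee ck.
  by rewrite ge_min le_max (ltW kn) (ltW kp) orbT.
have x1 : `|x| <= e by move: xe; rewrite in_itv /= ler_norml.
have x1' : `|x| <= 1 by apply: le_trans e1.
have [_ [H2 [_ H3]]] := Hr _ (hin x x1').
move: H2; rewrite (H3 (HD t x) kx) gq0 subrr sub0r normrN diff_line (normrM t) normrZ (gtr0_norm t0) //.
rewrite mulrCA ler_pM2l // => H2.
have : `|'d g q u| <= `|'d g q u + x * 'd g q n| + `|x * 'd g q n|.
  by apply: le_trans (ler_normB _ _); rewrite addrK.
move=> H4; apply: le_trans H4 _.
rewrite normrM mulrDr [leRHS]addrC; apply: lerD.
  by apply: le_trans H2 _; rewrite ler_pM2l // hb.
by rewrite ler_wpM2r.
Qed.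

(** The covariant Hessian of [g] on [v]: the second derivative of [g] along the geodesic with
    velocity [v]. *)
Definition Phi (g : V -> R) z v : R := 'd (fun y => 'd g y v) z v - 'd g z (christoffel z v v).

Lemma geoE_second (g : V -> R) (A : set V) p u (t : R) : open A -> Ck 2 A g -> CH2 p -> metric p u u = 1 ->
  A (geoE p u t) ->
  is_derive t 1 (fun t => g (geoE p u t)) ('d g (geoE p u t) (geoV p u t)) /\
  is_derive t 1 (fun t => 'd g (geoE p u t) (geoV p u t)) (Phi g (geoE p u t) (geoV p u t)).
Proof.
move=> oA Hg hp hu At; split.
  by apply: is_derive_diff_comp (is_derive_geoE hp hu t); apply: CkS_diff Hg At.
have D := is_derive_diff oA Hg At (is_derive_geoE hp hu t) (is_derive_geoV hp hu t).
apply: (is_derive_eq D); rewrite /Phi; congr (_ + _); exact: linearN.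
Qed.

(** A scalar equation [f] of [N] near [q], oriented to increase along [nu], together with a smooth
    extension [xi] of [nu]. Positivity of the shape operator is recorded at the centre [q] only. *)
Definition normal_chart N (nu : V -> V) q (W : set V) (f : V -> R) (xi : V -> V) :=
  [/\ [/\ open W, W q, W `<=` @CH2 R, forall k, Ck k W f & forall z, W z -> (N z <-> f z = 0)],
      [/\ smooth_on W xi, forall z, N z -> W z -> xi z = nu z,
        forall z, W z -> 0 < 'd f z (xi z),
        forall z, N z -> W z -> metric z (nu z) (nu z) = 1 &
        forall z y, N z -> W z -> 'd f z y = 'd f z (nu z) * metric z (nu z) y] &
      forall x, metric q (nu q) x = 0 -> x != 0 -> 0 < metric q (- nabla xi q x) x].

Lemma normal_chart_exists N nu q : submanifold 1 N -> inward_normal N nu -> N q ->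
  exists W f xi, normal_chart N nu q W f xi.
Proof.
move=> [NC NL] Hnu Nq.
have [W1 [f1 [oW1 W1q W1C sf1 [surj1 f1E]]]] := NL q Nq.
have [W2 [xi [[oW2 W2q sxi Hxi] xiE Hsh]]] := Hnu q Nq.
pose f2 z := f1 z ord0 ord0.
have sf2 k : Ck k W1 f2 by apply: Ck_coord.
have d2 z v : W1 z -> 'd f2 z v = ('d f1 z v) ord0 ord0.
  move=> W1z; have D := is_diff_coord ord0 (CkS_diff (sf1 1%N) W1z).
  exact: (is_diffE v D).
have ker z v : N z -> W1 z -> 'd f2 z v = 0 -> tangent 1 N z v.
  move=> Nz W1z; rewrite d2 // => E; exists W1, f1; split=> //.
  by apply/rowP => i; rewrite (ord1 i) E mxE.
have f2E z : W1 z -> (N z <-> f2 z = 0).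
  move=> W1z; apply: iff_trans (f1E z W1z) _; split; first by move=> E; rewrite /f2 E mxE.
  by move=> E; apply/rowP => i; rewrite (ord1 i) mxE.
have nz z : N z -> W1 z -> W2 z -> 'd f2 z (xi z) != 0.
  move=> Nz W1z W2z; apply/eqP => /(ker _ _ Nz W1z) T.
  have [h1 h2] := Hxi z Nz W2z; have := h2 _ T; rewrite h1 => /eqP.
  by rewrite oner_eq0.
pose sg : R := if 0 < 'd f2 q (xi q) then 1 else -1.
pose f z := sg * f2 z.
have sgn : sg != 0 by rewrite /sg; case: ifP; rewrite ?oppr_eq0 oner_eq0.
have sf k : Ck k W1 f by apply: Ck_mul => //; apply: Ck_cst.
have d3 z v : W1 z -> 'd f z v = sg * 'd f2 z v.
  move=> W1z; have D := is_diff_scale (is_diff_cst sg z) (CkS_diff (sf2 1%N) W1z).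
  by apply: (etrans (is_diffE v D)); rewrite /= scale0r addr0.
have dq : 0 < 'd f q (xi q).
  rewrite d3 // /sg; case: ifPn => [h|]; first by rewrite mul1r.
  by rewrite -leNgt mulN1r oppr_gt0 lt_neqAle nz.
have oW12 : open (W1 `&` W2) by apply: openI.
have Cd : Ck 0 (W1 `&` W2) (fun z => \sum_i (xi z) ord0 i *: 'd f z (delta_mx 0 i)).
  apply: Ck_sum => // i; apply: Ck_scale => //.
    by apply: Ck_coord => //; apply: Ck_sub (sxi 0%N) => z [].
  by apply: Ck_sub (Ckd (delta_mx 0 i) (sf 1%N)) => z [].
have Np : \forall z \near q, (W1 `&` W2) z /\ 0 < 'd f z (xi z).
  apply: filterI; first exact: open_nbhs_nbhs.
  have Hc : 'd f z (xi z) @[z --> q] --> 'd f q (xi q).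
    have -> : (fun z => 'd f z (xi z)) = fun z => \sum_i (xi z) ord0 i *: 'd f z (delta_mx 0 i).
      by apply/funext => z; apply: diff_row_sum.
    rewrite [X in _ --> X]diff_row_sum.
    exact: (Cd q (conj W1q W2q)).
  exact: (cvgr_gt _ Hc).
pose W := interior [set z | (W1 `&` W2) z /\ 0 < 'd f z (xi z)].
have WS z : W z -> (W1 `&` W2) z /\ 0 < 'd f z (xi z) by move/interior_subset.
have W1s z : W z -> W1 z by move/WS => [[]].
have W2s z : W z -> W2 z by move/WS => [[]].
have oW : open W by exact: open_interior.
exists W, f, xi; split; [split|split|] => //.
- by move=> z /W1s /W1C.
- by move=> k; apply: Ck_sub (sf k).
- move=> z Wz; apply: iff_trans (f2E z (W1s z Wz)) _; rewrite /f; split; first by move=> ->; rewrite mulr0.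
  by move=> /eqP; rewrite mulf_eq0 (negbTE sgn) /= => /eqP.
- by move=> k; apply: Ck_sub (sxi k).
- by move=> z Nz Wz; apply: xiE => //; apply: W2s.
- by move=> z /WS [].
- by move=> z Nz Wz; rewrite -xiE //; [have [] := Hxi z Nz (W2s z Wz)|apply: W2s].
- move=> z y Nz Wz; rewrite -xiE //; last exact: W2s.
  have [h1 h2] := Hxi z Nz (W2s z Wz).
  have := nz z Nz (W1s z Wz) (W2s z Wz); rewrite !d3; [|exact: W1s|exact: W1s] => n0.
  set D := 'd f2 z (xi z) in n0 *.
  (* Removing a multiple of the normal makes [y] tangent, hence orthogonal to the normal; this
     identifies the differential with a metric product. *)
  have T : tangent 1 N z (y - ('d f2 z y / D) *: xi z).
    apply: (ker _ _ Nz (W1s z Wz)).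
    rewrite linearB /= diffZv -/D /GRing.scale /= mulfVK // subrr //.
  have := h2 _ T; rewrite metricDr metricNr metricZr h1 mulr1 => /eqP.
  rewrite subr_eq0 => /eqP ->; by rewrite -mulrA [D * _]mulrC mulfVK.
- move=> x hx x0; apply: Hsh => //; apply: (ker q x) => //.
  have := nz q Nq W1q W2q => n0.
  have [h1 h2] := Hxi q Nq W2q.
  set D := 'd f2 q (xi q) in n0.
  have T : tangent 1 N q (x - ('d f2 q x / D) *: xi q).
    apply: (ker _ _ Nq W1q).
    rewrite linearB /= diffZv -/D /GRing.scale /= mulfVK // subrr //.
  have := h2 _ T; rewrite metricDr metricNr metricZr h1 mulr1 xiE // hx sub0r => /eqP.
  by rewrite oppr_eq0 mulf_eq0 invr_eq0 (negbTE n0) orbF => /eqP.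
Qed.

End Hyper.

(** * Derivatives of functions vanishing on a hypersurface *)

Section Hess.
Variable R : realType.
Notation V := 'rV[R]_(2 + 2).

Lemma Ck_metric (U : normedModType R) k (A : set U) (c X Y : U -> V) : open A ->
  (forall x, A x -> CH2 (c x)) -> Ck k A c -> Ck k A X -> Ck k A Y ->
  Ck k A (fun x => metric (c x) (X x) (Y x)).
Proof.
move=> oA cin Hc HX HY; apply: Ck_mul => //; first by ck.
apply: Ck_inv => //; last by rewrite /GRing.exp /=; ck.
by move=> x /cin h; rewrite expf_neq0 // gt_eqF // CH2_gt0.
Qed.

Lemma Ck_diffv n (W : normedModType R) k (A : set 'rV[R]_n) (g : 'rV[R]_n -> W)
   (X : 'rV[R]_n -> 'rV[R]_n) : open A -> Ck k.+1 A g -> Ck k A X -> Ck k A (fun z => 'd g z (X z)).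
Proof.
move=> oA Hg HX.
have -> : (fun z => 'd g z (X z)) = fun z => \sum_i (X z) ord0 i *: 'd g z (delta_mx 0 i).
  by apply/funext => z; apply: diff_row_sum.
by apply: Ck_sum => // i; apply: Ck_scale => //; [apply: Ck_coord|apply: Ckd].
Qed.

Lemma is_derive_uniq (W : normedModType R) (c : R -> W) (t : R) (a b : W) :
  is_derive t 1 c a -> is_derive t 1 c b -> a = b.
Proof. by move=> [_ <-] [_ <-]. Qed.

Lemma Ck_near_diff n (W : normedModType R) k (A : set 'rV[R]_n) (g : 'rV[R]_n -> W) z :
  open A -> A z -> Ck k.+1 A g -> \forall y \near z, differentiable g y.
Proof.
move=> oA Az Hg.
apply: (@filterS _ (nbhs z) _ A); last exact: open_nbhs_nbhs.
by move=> y Ay; have := CkS_diff Hg Ay => /(@ex_diff _ _ _ _ _ _).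
Qed.

Implicit Types (p q u v w x y z : V) (N : set V).

(** The part of [y] tangent to [N] contributes nothing, by [zeros_kill]. *)
Lemma zeros_first N nu q W (f : V -> R) xi (g : V -> R) (W' : set V) z y :
  normal_chart N nu q W f xi -> open W' -> Ck 1 W' g -> (forall z, W' z -> N z -> g z = 0) ->
  N z -> W z -> W' z -> 'd g z y = 'd g z (nu z) * metric z (nu z) y.
Proof.
move=> [[oW Wq WC sf fE] [sxi xiE dpos nu1 dE] Hsh] oW' Hg g0 Nz Wz W'z.
have E (c : R) : 'd g z (y + c *: nu z) = 'd g z y + c * 'd g z (nu z).
  by have := diff_line g z y (nu z) 1 c; rewrite scale1r mul1r.
suff : 'd g z (y + (- metric z (nu z) y) *: nu z) = 0.
  by rewrite E mulNr => /eqP; rewrite subr_eq0 mulrC => /eqP.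
apply: (@zeros_kill _ f g setT z _ (xi z)) => //.
- by apply/(fE z Wz).
- exact: (Ck_near_diff oW Wz (sf 1%N)).
- have := diff_line f z y (nu z) 1 (- metric z (nu z) y); rewrite scale1r mul1r => ->.
  by rewrite (dE z y Nz Wz) mulNr mulrC subrr.
- exact: dpos.
- by have := CkS_diff Hg W'z => /(@ex_diff _ _ _ _ _ _).
- apply: (@filterS _ (nbhs z) _ (W `&` W')).
    by move=> w [Ww W'w] _ /(fE w Ww); apply: g0.
  by apply: open_nbhs_nbhs; split; [exact: openI|split].
Qed.

(* The Hessian of a function vanishing on N, on tangent vectors of N. *)
Lemma zeros_second N nu q W (f : V -> R) xi (g : V -> R) (W' : set V) u :
  normal_chart N nu q W f xi -> open W' -> W' q -> (forall k, Ck k W' g) ->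
  (forall z, W' z -> N z -> g z = 0) -> N q -> metric q (nu q) u = 0 ->
  Phi g q u = - ('d g q (nu q) * metric q (- nabla xi q u) u).
Proof.
move=> Hch oW' W'q Hg g0 Nq hu.
have [[oW Wq WC sf fE] [sxi xiE dpos nu1 dE] Hsh] := Hch.
have oA : open (W `&` W') by exact: openI.
have Aq : (W `&` W') q by [].
have hq : CH2 q by apply: WC.
have sxi' k : Ck k (W `&` W') xi by apply: Ck_sub (sxi k) => z [].
have Hg' k : Ck k (W `&` W') g by apply: Ck_sub (Hg k) => z [].
(* By [zeros_first] this vanishes on [N], hence so does its derivative in the tangent direction [u];
   expanding that derivative yields the Hessian and the shape operator. *)
pose psi z := 'd g z u - 'd g z (xi z) * metric z (xi z) u.
have sdxi k : Ck k (W `&` W') (fun z => 'd g z (xi z)) by apply: Ck_diffv.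
have smu k : Ck k (W `&` W') (fun z => metric z (xi z) u).
  by apply: Ck_metric => //; [move=> z [/WC]|ck|ck].
have spsi k : Ck k (W `&` W') psi.
  apply: Ck_add => //; first exact: Ckd (Hg' k.+1).
  by apply: Ck_opp => //; apply: Ck_mul.
have E1 : 'd psi q u = 0.
  apply: (@zeros_kill _ f psi setT q _ (xi q)) => //.
  - by apply/(fE q Wq).
  - exact: (Ck_near_diff oW Wq (sf 1%N)).
  - by rewrite (dE q u Nq Wq) hu mulr0.
  - exact: dpos.
  - by have := CkS_diff (spsi 1%N) Aq => /(@ex_diff _ _ _ _ _ _).
  - apply: (@filterS _ (nbhs q) _ (W `&` W')); last exact: open_nbhs_nbhs.
    move=> w [Ww W'w] _ /(fE w Ww) Nw; rewrite /psi xiE //.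
    by rewrite (zeros_first u Hch oW' (Hg 1%N)) // subrr.
have q0 : q + (0 : R) *: u = q by rewrite scale0r addr0.
have D : is_derive (0 : R) 1 (fun t : R => q + t *: u) u.
  have H' := is_derive_add (is_derive_const q (0 : R))
    (is_derive_scale (is_derive_id (0 : R) 1) (is_derive_const u (0 : R))).
  by apply: (is_derive_eq H'); rewrite scaler0 scale1r !add0r.
have Dc (W0 : normedModType R) (h : V -> W0) : Ck 1 (W `&` W') h ->
    is_derive (0 : R) 1 (fun t : R => h (q + t *: u)) ('d h q u).
  by move=> Hh; apply: is_derive_diff_comp D; rewrite q0; apply: CkS_diff Hh _.
have Dpsi := Dc _ _ (spsi 1%N).
have Dg := Dc _ _ (Ckd u (Hg' 2)).
have Dx := Dc _ _ (sdxi 1%N).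
have := @metric_curve _ _ _ _ 0 _ _ _ _ D (Dc _ _ (sxi' 1%N)) (is_derive_const u (0 : R)).
rewrite q0 => /(_ hq) Dm.
have Dall := is_derive_add Dg (is_derive_opp (is_derive_mul Dx Dm)).
have Em : metric (q + (0 : R) *: u) (xi (q + (0 : R) *: u)) u = 0 by rewrite q0 xiE.
have Ex : 'd g (q + (0 : R) *: u) (xi (q + (0 : R) *: u)) = 'd g q (nu q) by rewrite q0 xiE.
have EA : metric q ('d xi q u + christoffel q u (xi q)) u = - metric q (- nabla xi q u) u.
  by rewrite metricNl opprK.
have EB := zeros_first (christoffel q u u) Hch oW' (Hg 1%N) g0 Nq Wq W'q.
have EB' : metric q (xi q) (0 + christoffel q u u) = metric q (nu q) (christoffel q u u).
  by rewrite add0r xiE.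
have aux (P G X m x A B y A' B' C : R) : P = G - (X * m + x * (A + B)) -> P = 0 -> m = 0 ->
    x = y -> A = - A' -> B = B' -> C = y * B' -> G - C = - (y * A').
  move=> -> E0 Em0 Exy EA0 EB0 ->; move: E0 => /eqP; rewrite subr_eq0 => /eqP ->.
  by rewrite Em0 Exy EA0 EB0 mulr0 add0r mulrDr addrK mulrN.
exact: (aux _ _ _ _ _ _ _ _ _ _ _ (is_derive_uniq Dpsi Dall) E1 Em Ex EA EB' EB).
Qed.

End Hess.

(** * Invariance of the inward normal under isometries *)

Section NormalInvariance.
Variable R : realType.
Notation V := 'rV[R]_(2 + 2).
Implicit Types (p q u v w x y z : V) (N : set V).

Lemma nu_sub_CH2 N : submanifold 1 N -> forall q, N q -> CH2 q.
Proof. by move=> [H _] q /H. Qed.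

Lemma nu_unit N (nu : V -> V) q : submanifold 1 N -> inward_normal N nu -> N q ->
  metric q (nu q) (nu q) = 1.
Proof.
move=> hN hnu Nq; have [W [f [xi [[_ Wq _ _ _] [_ _ _ H _] _]]]] := normal_chart_exists hN hnu Nq.
exact: H.
Qed.

(** Both sides are the second derivative of one function of t, since [s] maps the geodesic of [u] to
    that of ['d s q u]. *)
Lemma Phi_isometry (s : V -> V) (f : V -> R) (W : set V) q u : Defs.isometry s ->
  open W -> W (s q) -> Ck 2 W f -> CH2 q -> metric q u u = 1 ->
  Phi (fun z => f (s z)) q u = Phi f (s q) ('d s q u).
Proof.
move=> Hs oW Wsq sf hq hu.
have [sm _ _] := Hs.
pose B := interior [set z | CH2 z /\ W (s z)].
have BS z : B z -> CH2 z /\ W (s z) by move/interior_subset.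
have oB : open B by exact: open_interior.
have Bq : B q.
  apply: filterI; first exact: (open_nbhs_nbhs (conj (@CH2_open R) hq)).
  exact: (Ck_cont (sm 0%N) hq (open_nbhs_nbhs (conj oW Wsq))).
have sg : Ck 2 B (fun z => f (s z)).
  apply: (@Ck_comp _ _ _ _ _ W) => //; first by move=> z /BS [].
  by apply: Ck_sub (sm 2) => z /BS [].
have hu' : metric (s q) ('d s q u) ('d s q u) = 1 by rewrite iso_metric.
have hsq := iso_CH2 Hs hq.
have E t : s (geoE q u t) = geoE (s q) ('d s q u) t by exact: iso_geod.
have A0 : B (geoE q u 0) by rewrite geoE0.
have W0 : W (geoE (s q) ('d s q u) 0) by rewrite geoE0.
have nearB : \forall t \near (0 : R), B (geoE q u t).
  have := is_derive_cont (is_derive_geoE hq hu (0 : R)).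
  by move=> /(_ _ (open_nbhs_nbhs (conj oB A0))).
have [_ D1] := geoE_second oB sg hq hu A0.
have [_ D2] := geoE_second oW sf hsq hu' W0.
have Eq : \forall t \near (0 : R), 'd (fun z => f (s z)) (geoE q u t) (geoV q u t) =
    'd f (geoE (s q) ('d s q u) t) (geoV (s q) ('d s q u) t).
  apply: (@filterS _ (nbhs (0 : R)) _ (fun t => B (geoE q u t))) => // t Bt.
  have [D3 _] := geoE_second oB sg hq hu Bt.
  have Wt : W (geoE (s q) ('d s q u) t) by rewrite -E; have [] := BS _ Bt.
  have [D4 _] := geoE_second oW sf hsq hu' Wt.
  apply: (is_derive_uniq D3); apply: is_derive_fext D4 _ => x; by rewrite E.
have := is_derive_uniq (near_eq_is_derive Eq D1) D2.
by rewrite !geoE0 !geoV0.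
Qed.

(* Equations of N at q and s q have second derivatives along corresponding tangent
   geodesics whose signs, by convexity, tell the side to which nu points. *)
Lemma nu_isometry (s nu : V -> V) N q : Defs.isometry s -> submanifold 1 N -> inward_normal N nu ->
  (forall z, N z -> N (s z)) -> N q -> 'd s q (nu q) = nu (s q).
Proof.
move=> Hs hN hnu sN Nq.
have hq := nu_sub_CH2 hN Nq; have hsq := iso_CH2 Hs hq.
have [sm _ _] := Hs.
have Np := sN q Nq.
have [W [f [xi Hch]]] := normal_chart_exists hN hnu Nq.
have [W' [f' [xi' Hch']]] := normal_chart_exists hN hnu Np.
have [[oW Wq WC sf fE] [sxi xiE dpos nu1 dE] Hsh] := Hch.
have [[oW' Wq' WC' sf' fE'] [sxi' xiE' dpos' nu1' dE'] Hsh'] := Hch'.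
pose B := interior [set z | CH2 z /\ W' (s z)].
have BS z : B z -> CH2 z /\ W' (s z) by move/interior_subset.
have oB : open B by exact: open_interior.
have Bq : B q.
  apply: filterI; first exact: (open_nbhs_nbhs (conj (@CH2_open R) hq)).
  exact: (Ck_cont (sm 0%N) hq (open_nbhs_nbhs (conj oW' Wq'))).
pose g z := f' (s z).
have sg k : Ck k B g.
  apply: (@Ck_comp _ _ _ _ _ W') => //; first by move=> z /BS [].
  by apply: Ck_sub (sm k) => z /BS [].
have g0 z : B z -> N z -> g z = 0.
  by move=> /BS [hz Wz] Nz; apply/(fE' _ Wz)/sN.
have dg y : 'd g q y = 'd f' (s q) ('d s q y).
  have D1 : is_diff q s ('d s q) := CkS_diff (sm 1%N) hq.
  have D2 : is_diff (s q) f' ('d f' (s q)) := CkS_diff (sf' 1%N) Wq'.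
  exact: (is_diffE y (is_diff_comp D1 D2)).
set n := 'd s q (nu q).
have n1 : metric (s q) n n = 1 by rewrite iso_metric // (nu_unit hN hnu).
have dpos1 : 0 < 'd f' (s q) (nu (s q)) by rewrite -xiE' //; apply: dpos'.
have orth y : metric q (nu q) y = 0 -> metric (s q) (nu (s q)) ('d s q y) = 0.
  move=> hy; have E := zeros_first y Hch oB (sg 1%N) g0 Nq Wq Bq.
  move: E; rewrite hy mulr0 dg (dE' _ _ Np Wq') => /eqP.
  by rewrite mulf_eq0 gt_eqF //= => /eqP.
(* The normal component [c] of a preimage of [nu (s q)] is the sign to be shown equal to 1. *)
have [w wE] := iso_surj Hs hq (nu (s q)).
pose c := metric q (nu q) w.
have nuE : nu (s q) = c *: n.
  have hx : metric q (nu q) (w - c *: nu q) = 0.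
    by rewrite metricDr metricNr metricZr (nu_unit hN hnu) // mulr1 subrr.
  have E : 'd s q (w - c *: nu q) = nu (s q) - c *: n.
    apply: (etrans (linearB _ _ _)); congr (_ - _) => //; exact: diffZv.
  have := orth _ hx; rewrite E => h1.
  have h2 : metric (s q) n (nu (s q) - c *: n) = 0 by rewrite -E iso_metric.
  apply/eqP; rewrite -subr_eq0; apply/eqP; apply: (metric_eq0 hsq).
  by rewrite metricDl h1 metricNl metricZl h2 mulr0 oppr0 addr0.
pose u := J (nu q).
have hu : metric q (nu q) u = 0 by rewrite metricuJ.
have u1 : metric q u u = 1 by rewrite metricJ (nu_unit hN hnu).
have u0 : u != 0 by apply: unit_neq0 u1.
have us1 : metric (s q) ('d s q u) ('d s q u) = 1 by rewrite iso_metric.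
have P1 := zeros_second Hch oB Bq sg g0 Nq hu.
have g0' z : W' z -> N z -> f' z = 0 by move=> Wz /(fE' z Wz).
have P2 := zeros_second Hch' oW' Wq' sf' g0' Np (orth _ hu).
have P3 := Phi_isometry Hs oW' Wq' (sf' 2) hq u1.
have A1 := Hsh u hu u0.
have A2 := Hsh' _ (orth _ hu) (unit_neq0 us1).
have dgn : 'd g q (nu q) = c * 'd f' (s q) (nu (s q)).
  have mc : metric (s q) (nu (s q)) n = c by rewrite nuE metricZl n1 mulr1.
  apply: (etrans (dg _)); apply: (etrans (dE' _ _ Np Wq')).
  by apply: (etrans (congr1 _ mc)); exact: mulrC.
have c2 : c * c = 1.
  have := nu_unit hN hnu Np; rewrite {1 2}nuE metricZl metricZr n1 mulr1; exact.
have cpos : 0 < c.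
  have E : c * 'd f' (s q) (nu (s q)) * metric q (- nabla xi q u) u =
      'd f' (s q) (nu (s q)) * metric (s q) (- nabla xi' (s q) ('d s q u)) ('d s q u).
    by apply: oppr_inj; rewrite -dgn -P1 -P2 -P3.
  move: E A1 A2 dpos1.
  move: (metric q _ _) (metric (s q) _ _) ('d f' _ _) => X Y Z E X0 Y0 Z0.
  have : 0 < c * Z * X by rewrite E mulr_gt0.
  by rewrite pmulr_lgt0 // pmulr_lgt0.
have -> : nu (s q) = n; last by [].
rewrite nuE.
have -> : c = 1; last by rewrite scale1r.
by clear -c2 cpos; nra.
Qed.

End NormalInvariance.

(** * Tangent geodesics and the exterior *)

Section Gdir.
Variable R : realType.
Notation V := 'rV[R]_(2 + 2).
Implicit Types (p q u v w x y z : V).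

(* If x = q + sigma u with u a unit vector, sigma complex and k = <u, q> / (1 - |q|^2),
   then gdir x q u - i gdir x q (J u) is a positive multiple of 1 / sigma - k, which
   is coth t at the point x = geoE q u t. *)
Definition gdir x q v : R := (1 - dot q q) * dot (x - q) v - dot (x - q) (x - q) * dot q v.

Lemma gdir_cs q u (s1 s2 : R) : CH2 q -> let N := s1 ^+ 2 + s2 ^+ 2 in
  gdir (q + cs s1 s2 u) q u = (1 - dot q q) * dot u u * (s1 - N * k1 q u) /\
  gdir (q + cs s1 s2 u) q (J u) = (1 - dot q q) * dot u u * (s2 + N * k2 q u).
Proof.
move=> hq N; have A0 : 1 - dot q q != 0 by rewrite gt_eqF ?CH2_gt0.
have X : q + cs s1 s2 u - q = cs s1 s2 u by rewrite addrC addKr.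
rewrite /gdir X dot_cs -/N /cs /k1 /k2 !dotE (dotC q u).
rewrite -[dot q (J u)]opprK -dotJl (dotC (J q)).
by split; field.
Qed.

Lemma gdir_geoE q u (t : R) : CH2 q -> metric q u u = 1 ->
  gdir (geoE q u t) q u = (1 - dot q q) * dot u u * (sh t * ch t / omd q u t) /\
  gdir (geoE q u t) q (J u) = 0.
Proof.
move=> hq hu; have D0 := omd_gt0 hq hu t; have D1 : omd q u t != 0 by rewrite gt_eqF.
have [-> ->] := gdir_cs u (sg1 q u t) (sg2 q u t) hq.
have EN : sg1 q u t ^+ 2 + sg2 q u t ^+ 2 = sh t ^+ 2 / omd q u t.
  move: D1; rewrite /sg1 /sg2 /omd => D1; by field.
rewrite EN /sg1 /sg2 /om1 /om2; split; first by congr (_ * _); field.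
by field.
Qed.

Lemma expR_inj2 (t t' : R) : sh t = sh t' -> ch t = ch t' -> t = t'.
Proof.
move=> hs hc; apply: expR_inj.
have E s : expR s = ch s + sh s :> R by rewrite /ch /sh; field.
by rewrite !E hs hc.
Qed.

Lemma sh_gt0 (t : R) : (0 < sh t) = (0 < t).
Proof.
have S : (0 < sh t) = (expR (- t) < expR t).
  by rewrite /sh pmulr_lgt0 ?invr_gt0 // subr_gt0.
by rewrite S ltr_expR; apply/idP/idP; lra.
Qed.

Lemma le_2sh (t : R) : 0 <= t -> t <= 2 * sh t.
Proof.
move=> t0; have S0 : 0 <= sh t.
  by rewrite /sh mulr_ge0 ?invr_ge0 // subr_ge0 ler_expR; lra.
have C0 := ch_gt0 t; have CS := ch_sh t.
have : expR t = ch t + sh t :> R by rewrite /ch /sh; field.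
have := expR_ge1Dx t; have : ch t <= 1 + sh t by nra.
lra.
Qed.

Lemma ch_ge (t : R) : (1 + t) / 2 <= ch t.
Proof.
have := expR_ge1Dx t; have := expR_gt0 (- t); rewrite /ch => h1 h2.
by rewrite ler_pM2r ?invr_gt0 //; lra.
Qed.

Lemma sh_le_ch (t : R) : sh t <= ch t.
Proof. have := expR_gt0 (- t); rewrite /sh /ch; lra. Qed.

(** [F1] and [F2] say that S / C and S' / C' are positive roots of m T^2 + 2 k1 T = A - 1. As m > 0
    and A > 1 the roots have opposite signs, so these two agree. Hence [omd] takes a value above 1
    at most once for positive times. *)
Lemma tanh_root (A k1 k2 S C S' C' : R) : 1 < A -> 0 < S -> 0 < C -> 0 < S' -> 0 < C' ->
  C ^+ 2 - S ^+ 2 = 1 -> C' ^+ 2 - S' ^+ 2 = 1 ->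
  (C + k1 * S) ^+ 2 + (k2 * S) ^+ 2 = A -> (C' + k1 * S') ^+ 2 + (k2 * S') ^+ 2 = A ->
  S = S' /\ C = C'.
Proof.
move=> A1 S0 C0 S0' C0' h1 h2 e1 e2.
have E1 : A * (C ^+ 2 - S ^+ 2) = (C + k1 * S) ^+ 2 + (k2 * S) ^+ 2 by rewrite h1 mulr1.
have E2 : A * (C' ^+ 2 - S' ^+ 2) = (C' + k1 * S') ^+ 2 + (k2 * S') ^+ 2 by rewrite h2 mulr1.
pose m := A + k1 ^+ 2 + k2 ^+ 2.
have F1 : m * S ^+ 2 + 2 * k1 * C * S = (A - 1) * C ^+ 2.
  by rewrite /m; transitivity ((C + k1 * S) ^+ 2 + (k2 * S) ^+ 2 + A * S ^+ 2 - C ^+ 2); [ring|rewrite -E1; ring].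
have F2 : m * S' ^+ 2 + 2 * k1 * C' * S' = (A - 1) * C' ^+ 2.
  by rewrite /m; transitivity ((C' + k1 * S') ^+ 2 + (k2 * S') ^+ 2 + A * S' ^+ 2 - C' ^+ 2); [ring|rewrite -E2; ring].
have F3 : (S * C' - S' * C) * (m * S * S' + (A - 1) * C * C') = 0.
  transitivity (S' * C' * (m * S ^+ 2 + 2 * k1 * C * S) - S * C * (m * S' ^+ 2 + 2 * k1 * C' * S')
    + (A - 1) * (S * C * C' ^+ 2 - S' * C' * C ^+ 2)); first by ring.
  by rewrite F1 F2; ring.
have m0 : 0 < m by rewrite /m -addrA ltr_wpDr ?addr_ge0 ?sqr_ge0 //; lra.
have G : S * C' = S' * C.
  apply/eqP; rewrite -subr_eq0; move/eqP: F3; rewrite mulf_eq0 => /orP[//|/eqP F].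
  have p1 : 0 < m * S * S' by rewrite !mulr_gt0.
  have p2 : 0 < (A - 1) * C * C' by rewrite !mulr_gt0 // subr_gt0.
  by lra.
have CC : C = C'.
  apply/eqP; rewrite -(eqrXn2 (n := 2)) ?(ltW C0) ?(ltW C0') //; apply/eqP.
  transitivity (C ^+ 2 * (C' ^+ 2 - S' ^+ 2)); first by rewrite h2 mulr1.
  transitivity (C' ^+ 2 * (C ^+ 2 - S ^+ 2)); last by rewrite h1 mulr1.
  have : (S * C') ^+ 2 = (S' * C) ^+ 2 by rewrite G.
  by rewrite !exprMn !mulrBr => H; rewrite (mulrC (C' ^+ 2) (S ^+ 2)) H; ring.
split=> //; apply: (mulIf (x := C')); first by rewrite gt_eqF.
by rewrite G CC.
Qed.

Lemma omd_inj q u (t t' : R) : 0 < t -> 0 < t' -> 1 < omd q u t -> omd q u t = omd q u t' -> t = t'.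
Proof.
move=> t0 t0' h1 e.
have [|||||||| a b] := @tanh_root _ (k1 q u) (k2 q u) (sh t) (ch t) (sh t') (ch t') h1.
all: rewrite ?sh_gt0 ?ch_gt0 ?ch_sh //.
exact: expR_inj2.
Qed.

(** For t >= 0, [om1] is at least (1 - |k1|) cosh t, hence at least (1 - |k1|) (1 + t) / 2. *)
Lemma omd_large q u (M : R) : CH2 q -> metric q u u = 1 ->
  exists2 T : R, 0 < T & forall t, T <= t -> M < omd q u t.
Proof.
move=> hq hu; have kk := k_lt1 hq hu.
pose c := 1 - `|k1 q u|.
have c0 : 0 < c.
  rewrite subr_gt0 -(ltr_pXn2r (n := 2)) ?nnegrE // expr1n real_normK ?num_real //.
  by have := sqr_ge0 (k2 q u); lra.
pose M' := `|M| + 1; have M1 : 1 <= M' by rewrite lerDr.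
exists (2 * M' / c); first by rewrite divr_gt0 // mulr_gt0 //; lra.
move=> t; rewrite ler_pdivrMr // => ht.
have t0 : 0 <= t by rewrite -(pmulr_lge0 _ c0); lra.
have Mo : M' < om1 q u t.
  have C0 := ch_ge t; have CC := sh_le_ch t.
  have S0 : 0 <= sh t by have := le_2sh t0; lra.
  have a4 : - (`|k1 q u| * ch t) <= k1 q u * sh t.
    rewrite lerNl; apply: (@le_trans _ _ (`|k1 q u| * sh t)); last by rewrite ler_wpM2l.
    by rewrite -mulNr ler_wpM2r // -normrN ler_norm.
  have a3 : c * ((1 + t) / 2) <= c * ch t by rewrite ler_pM2l.
  have a2 : c * ((1 + t) / 2) = c / 2 + t * c / 2 by field.
  have a1 : c * ch t = ch t - `|k1 q u| * ch t by rewrite mulrBl mul1r.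
  rewrite /om1; move: a1 a2 a3 a4 ht c0; clearbody c M'.
  move: (c * ch t) (c * ((1 + t) / 2)) (t * c) (`|k1 q u| * _) (k1 q u * _) => X Y Z T W.
  by lra.
have M2 : M <= M' by rewrite /M'; have := ler_norm M; lra.
rewrite /omd; apply: (@lt_le_trans _ _ (om1 q u t ^+ 2)); last by rewrite lerDl sqr_ge0.
by move: Mo M2 M1; move: (om1 q u t) => X; nra.
Qed.

Lemma omd_exists q u (A : R) : CH2 q -> metric q u u = 1 -> 1 < A ->
  exists2 t : R, 0 < t & omd q u t = A.
Proof.
move=> hq hu A1; have [T T0 HT] := omd_large A hq hu.
have o0 : omd q u 0 = 1 by rewrite /omd /om1 /om2 ch0 sh0 !mulr0 addr0 expr1n expr0n addr0.
have cont : {within `[0, T], continuous (omd q u)}.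
  by apply: derivable_within_continuous => x _; have [] := is_derive_omd q u x.
have [|t] := IVT (v := A) (ltW T0) cont.
  by rewrite o0 ge_min le_max (ltW A1) (ltW (HT T (lexx _))) orbT.
rewrite in_itv /= => /andP[t0 _] tA; exists t => //.
rewrite lt_neqAle t0 andbT; apply/eqP => E.
by move: A1; rewrite -tA -E o0 ltxx.
Qed.

(** Expresses sinh^2 t through the end points, so that close end points force a short time and a
    positive time separates them. *)
Lemma geoE_dist q u (t : R) : CH2 q -> metric q u u = 1 ->
  dot (geoE q u t - q) (geoE q u t - q) * (1 - dot q q) =
  sh t ^+ 2 * dot u u * (1 - dot (geoE q u t) (geoE q u t)).
Proof.
move=> hq hu; have D0 := omd_gt0 hq hu t; have D1 : omd q u t != 0 by rewrite gt_eqF.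
rewrite geoE_norm //.
have -> : geoE q u t - q = cs (sg1 q u t) (sg2 q u t) u by rewrite /geoE addrC addKr.
rewrite dot_cs.
have -> : sg1 q u t ^+ 2 + sg2 q u t ^+ 2 = sh t ^+ 2 / omd q u t.
  move: D1; rewrite /sg1 /sg2 /omd => D1; by field.
by field.
Qed.

(** The hypotheses on [gdir] say that 1 / sigma - k is a real number [l >= 0], and x being in the
    ball means l^2 > 1; so l = coth t for some t > 0. *)
Lemma gdir_geoE_inv q u x : CH2 q -> CH2 x -> metric q u u = 1 -> x != q -> cspan u (x - q) ->
  gdir x q (J u) = 0 -> 0 <= gdir x q u -> exists2 t : R, 0 < t & x = geoE q u t.
Proof.
move=> hq hx hu xq [s1 [s2 E]].
have Ex : x = q + cs s1 s2 u by rewrite -E addrC subrK.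
have [G1 G2] := gdir_cs u s1 s2 hq.
have A0 := CH2_gt0 hq; have u0 := unit_neq0 hu; have U0 := dot_gt0 u0.
have AU : 0 < (1 - dot q q) * dot u u by rewrite mulr_gt0.
rewrite Ex G1 G2 => /eqP; rewrite mulf_eq0 gt_eqF //= => /eqP h2.
rewrite pmulr_rge0 // => h1.
have X0 := CH2_gt0 hx; have un := unit_norm hq hu.
pose N := s1 ^+ 2 + s2 ^+ 2.
have N0 : 0 < N.
  rewrite lt_neqAle addr_ge0 ?sqr_ge0 // andbT eq_sym paddr_eq0 ?sqr_ge0 // !sqrf_eq0.
  apply: contra xq => /andP[/eqP a /eqP b]; rewrite Ex a b /cs !scale0r !addr0 //.
have Xn : 1 - dot x x = (1 - dot q q) * (1 - 2 * (s1 * k1 q u - s2 * k2 q u)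
    - N * (1 - k1 q u ^+ 2 - k2 q u ^+ 2)).
  have -> : dot x x = dot q q + 2 * dot q (cs s1 s2 u) + N * dot u u.
    by rewrite Ex -dot_cs; move: (cs s1 s2 u) => c; rewrite !dotDl !dotDr (dotC c q); ring.
  rewrite un /cs !dotE (dotC q u) -[dot q (J u)]opprK -dotJl (dotC (J q)) /k1 /k2.
  by field; rewrite gt_eqF.
move: X0; rewrite Xn pmulr_rgt0 // => {Xn} h3.
pose l := s1 / N - k1 q u.
have Nn : N != 0 by rewrite gt_eqF.
have e1 : s1 = N * (l + k1 q u) by rewrite /l subrK mulrCA mulfV // mulr1.
have e2 : s2 = - (N * k2 q u) by apply/eqP; rewrite -addr_eq0 h2.
have l0 : 0 <= l by rewrite /l subr_ge0 ler_pdivlMr // mulrC -subr_ge0.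
have en : N * ((l + k1 q u) ^+ 2 + k2 q u ^+ 2) = 1.
  apply: (mulfI Nn); rewrite mulr1 {3}/N e1 e2; ring.
have l1 : 1 < l.
  have : 0 < N * (l ^+ 2 - 1).
    move: h3; rewrite e1 e2.
    rewrite (_ : 1 - _ - _ = N * (l ^+ 2 - 1)) //.
    by rewrite -{1}en; ring.
  by rewrite pmulr_rgt0 // => h; nra.
have ln : l != 0 by rewrite gt_eqF //; lra.
have [|t t0 ht] := @tanh_surj R l^-1.
  by rewrite invr_ge0 l0 /= invf_lt1 //; lra.
have C0 := ch_gt0 t.
have Cn : ch t != 0 by rewrite gt_eqF.
have S0 : 0 < sh t by rewrite ht mulr_gt0 // invr_gt0; lra.
have t1 : 0 < t by rewrite -sh_gt0.
exists t => //; rewrite /geoE; congr (_ + _).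
have q0 : (l + k1 q u) ^+ 2 + k2 q u ^+ 2 != 0.
  by apply/eqP => E0; move: en; rewrite E0 mulr0 => /eqP; rewrite eq_sym oner_eq0.
have NE : N = ((l + k1 q u) ^+ 2 + k2 q u ^+ 2)^-1.
  by apply: (mulIf q0); rewrite en mulVf.
rewrite e1 e2 NE /sg1 /sg2 /omd /om1 /om2 ht.
have D0 : (ch t + k1 q u * (l^-1 * ch t)) ^+ 2 + (k2 q u * (l^-1 * ch t)) ^+ 2 != 0.
  rewrite (_ : _ + _ = (ch t / l) ^+ 2 * ((l + k1 q u) ^+ 2 + k2 q u ^+ 2)); last by field.
  by rewrite mulf_neq0 // expf_neq0 // mulf_neq0 // invr_neq0.
move: q0 D0; move: (k1 q u) (k2 q u) (ch t) Cn => a b C Cn q0 D0.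
have D2 : (C * l + a * C) ^+ 2 + (b * C) ^+ 2 != 0.
  rewrite (_ : _ + _ = C ^+ 2 * ((l + a) ^+ 2 + b ^+ 2)); last by ring.
  by rewrite mulf_neq0 // expf_neq0.
by congr (cs _ _ _); field; rewrite ?ln ?q0 ?D2.
Qed.

Definition gdirD x z v dx dz dv : R :=
  - (2 * dot z dz) * dot (x - z) v + (1 - dot z z) * (dot (dx - dz) v + dot (x - z) dv)
  - (2 * dot (x - z) (dx - dz) * dot z v + dot (x - z) (x - z) * (dot dz v + dot z dv)).
Lemma is_diff_gdir (U : normedModType R) (X dX Z dZ Y dY : U -> V) (e : U) :
  is_diff e X dX -> is_diff e Z dZ -> is_diff e Y dY ->
  is_diff e (fun e => gdir (X e) (Z e) (Y e)) (fun h => gdirD (X e) (Z e) (Y e) (dX h) (dZ h) (dY h)).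
Proof.
move=> HX HZ HY.
have HXZ : is_diff e (fun e => X e - Z e) (fun h => dX h - dZ h) by exact: is_diffB.
have H1 : is_diff e (fun e => 1 - dot (Z e) (Z e)) (fun h => 0 - (dot (dZ h) (Z e) + dot (Z e) (dZ h))).
  exact: (is_diffB (is_diff_cst _ _) (is_diff_dot HZ HZ)).
have H2 := is_diff_scale H1 (is_diff_dot HXZ HY).
have H3 := is_diff_scale (is_diff_dot HXZ HXZ) (is_diff_dot HZ HY).
apply: is_diff_ext (is_diffB H2 H3) _ _ => [y|h]; first by [].
rewrite !fctE /= /GRing.scale /= /gdirD (dotC (dZ h) (Z e)) (dotC (dX h - dZ h) (X e - Z e)).
by ring.
Qed.
(** The terms not involving [k] combine to a multiple of [gdir x q n], which is 0; the curvature
    term is left. Its being nonzero permits implicit differentiation of the tangency condition. *)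
Lemma gdirD_shape q n x (k : R) : CH2 q -> cspan n (x - q) -> gdir x q n = 0 ->
  gdirD x q n 0 (J n) (- (k *: J n) - christoffel q (J n) n) = - (k * gdir x q (J n)).
Proof.
move=> hq [s1 [s2 E]].
have A0 : 1 - dot q q != 0 by rewrite gt_eqF ?CH2_gt0.
rewrite /gdir /gdirD E /christoffel => G.
apply/eqP; rewrite -subr_eq0; apply/eqP.
transitivity (- (4 * dot q (J n) / (1 - dot q q)) * ((1 - dot q q) * dot (cs s1 s2 n) n - dot (cs s1 s2 n) (cs s1 s2 n) * dot q n)); last by rewrite G mulr0.
rewrite /cs; rewrite !dotE.
have E1 : dot n q = dot q n by exact: dotC.
have E2 : dot n (J q) = - dot q (J n) by rewrite dotC dotJl.
rewrite ?E1 ?E2 ?dotJl.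
move: A0; move: (dot q q) (dot n n) (dot q n) (dot q (J n)) => B e m1 m2 A0.
by field.
Qed.

(* A geodesic from q crosses the larger circle centered at 0 through x transversally. *)
Lemma planar_transversal (x1 x2 q1 q2 n1 n2 : R) :
  q1 ^+ 2 + q2 ^+ 2 < x1 ^+ 2 + x2 ^+ 2 -> x1 ^+ 2 + x2 ^+ 2 < 1 ->
  let A := 1 - (q1 ^+ 2 + q2 ^+ 2) in
  let B := (x1 - q1) ^+ 2 + (x2 - q2) ^+ 2 in
  A * ((x1 - q1) * n1 + (x2 - q2) * n2) - B * (q1 * n1 + q2 * n2) = 0 ->
  A * (- x2 * n1 + x1 * n2) - 2 * ((x1 - q1) * - x2 + (x2 - q2) * x1) * (q1 * n1 + q2 * n2) = 0 ->
  n1 = 0 /\ n2 = 0.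
Proof.
move=> hqx hx A B e1 e2.
pose X2 := x1 ^+ 2 + x2 ^+ 2; pose Q2 := q1 ^+ 2 + q2 ^+ 2; pose r := x1 * q1 + x2 * q2.
pose M1 := A * (x1 - q1) - B * q1; pose M2 := A * (x2 - q2) - B * q2.
(* (n1, n2) solves a homogeneous linear system with rows (M1, M2) and (M1', M2'), whose determinant
   [E] is positive by Cauchy-Schwarz. *)
pose C := 2 * ((x1 - q1) * - x2 + (x2 - q2) * x1).
pose M1' := - A * x2 - C * q1; pose M2' := A * x1 - C * q2.
have f1 : M1 * n1 + M2 * n2 = 0 by rewrite -e1 /M1 /M2; ring.
have f2 : M1' * n1 + M2' * n2 = 0 by rewrite -e2 /M1' /M2' /C; ring.
pose E := (1 - Q2) * (X2 * (1 + Q2) - r * (1 + X2)).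
have det : M1 * M2' - M2 * M1' = E.
  rewrite /E /M1 /M2 /M1' /M2' /C /A /B /X2 /Q2 /r; ring.
have Q0 : 0 <= Q2 by rewrite addr_ge0 ?sqr_ge0.
have X0 : 0 < X2 by apply: le_lt_trans hqx.
have Q1 : Q2 < 1 by apply: lt_trans hx.
have CS : r ^+ 2 <= X2 * Q2.
  rewrite -subr_ge0 (_ : _ - _ = (x1 * q2 - x2 * q1) ^+ 2) ?sqr_ge0 //.
  by rewrite /X2 /Q2 /r; ring.
have E0 : 0 < E.
  rewrite mulr_gt0 ?subr_gt0 // ltNge; apply/negP => h.
  have s0 : 0 < X2 * (1 + Q2) by rewrite mulr_gt0 // ltr_wpDr.
  have h2 : (X2 * (1 + Q2)) ^+ 2 <= (r * (1 + X2)) ^+ 2.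
    by rewrite ler_pXn2r ?nnegrE // ?(ltW s0) // (le_trans (ltW s0) h).
  have h3 : (r * (1 + X2)) ^+ 2 <= X2 * Q2 * (1 + X2) ^+ 2.
    by rewrite exprMn ler_wpM2r // sqr_ge0.
  have : 0 <= X2 * ((Q2 - X2) * (1 - X2 * Q2)).
    rewrite (_ : _ * _ = X2 * Q2 * (1 + X2) ^+ 2 - (X2 * (1 + Q2)) ^+ 2); last by ring.
    by rewrite subr_ge0 (le_trans h2 h3).
  rewrite pmulr_rge0 // pmulr_lge0; first by rewrite subr_ge0 leNgt hqx.
  rewrite subr_gt0 -(mulr1 1) ltr_pM //; exact: ltW.
have Em : E != 0 by rewrite gt_eqF.
split; apply: (mulfI Em); rewrite mulr0 -det.
  transitivity ((M1 * n1 + M2 * n2) * M2' - (M1' * n1 + M2' * n2) * M2); first by ring.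
  by rewrite f1 f2 !mul0r subrr.
transitivity (M1 * (M1' * n1 + M2' * n2) - M1' * (M1 * n1 + M2 * n2)); first by ring.
by rewrite f1 f2 !mulr0 subrr.
Qed.

End Gdir.

(** * The exterior near the sphere at infinity *)

Section Exterior.
Variable R : realType.
Notation V := 'rV[R]_(2 + 2).
Implicit Types (p q u v w x y z : V) (N : set V).

Lemma convex_gt (a b c s : R) : a < b -> a < c -> 0 <= s -> s <= 1 -> a < (1 - s) * b + s * c.
Proof.
move=> ab ac; rewrite le_eqVlt => /predU1P[<- _|s0 s1]; first by rewrite subr0 mul1r mul0r addr0.
have h1 : 0 <= (1 - s) * (b - a) by rewrite mulr_ge0 ?subr_ge0 // ltW.
have h2 : 0 < s * (c - a) by rewrite mulr_gt0 ?subr_gt0.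
by rewrite -subr_gt0 (_ : _ - a = (1 - s) * (b - a) + s * (c - a)); [exact: ltr_wpDl|ring].
Qed.

Lemma convex_lt (a b c s : R) : b < a -> c < a -> 0 <= s -> s <= 1 -> (1 - s) * b + s * c < a.
Proof.
move=> ab ac s0 s1; have := @convex_gt (- a) (- b) (- c) s; rewrite !ltrN2 => /(_ ab ac s0 s1).
by rewrite !mulrN -opprD ltrN2.
Qed.

Section Comp.
Variables (N : set V) (nu : V -> V).
Let U := exterior N nu.

Lemma exterior_sub x : U x -> CH2 x /\ ~ N x.
Proof.
move=> [p [_ [e e0 He]]].
have /He : 0 < e / 2 < e by rewrite divr_gt0 //= ltr_pdivrMr // mulr_natr mulr2n ltrDl.
by move/connected_component_sub.
Qed.

Lemma exterior_connected (C : set V) x : connected C -> C `<=` CH2 (R := R) `\` N -> C x -> U x -> C `<=` U.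
Proof.
move=> cC CN Cx [p [Np [e e0 He]]] y Cy; exists p; split=> //; exists e => // s /He h.
apply: connected_component_trans h _.
exact: (connected_component_max Cx CN cC).
Qed.

Lemma exterior_path (f : R -> V) (a b : R) : (forall s, s \in `[a, b] -> {for s, continuous f}) ->
  (forall s, s \in `[a, b] -> CH2 (f s) /\ ~ N (f s)) ->
  forall s t, s \in `[a, b] -> t \in `[a, b] -> U (f s) -> U (f t).
Proof.
move=> cf hf s t sa ta Us.
have cI : connected (f @` `[a, b]).
  apply: connected_continuous_connected; first exact: segment_connected.
  by apply: continuous_in_subspaceT => x; rewrite inE => /cf.
apply: (exterior_connected cI _ _ Us); last by exists t.
  by move=> _ [x xa <-]; apply: hf.
by exists s.
Qed.

Lemma enorm_cont (f : R -> V) s : {for s, continuous f} -> {for s, continuous (fun s => enorm (f s))}.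
Proof.
move=> cf; have H := cvg_dot (nbhs_filter s) cf cf.
exact: (cvg_comp _ _ H (@sqrt_continuous R _)).
Qed.

(** The segment from [z] to [w] is rescaled radially so that its norm interpolates linearly between
    those of the end points; this keeps it in the shell, provided that it avoids 0. *)
Lemma shell_path (rho : R) z w : 0 <= rho -> (forall q, N q -> dot q q <= rho) ->
  rho < dot z z < 1 -> rho < dot w w < 1 ->
  (forall s : R, 0 <= s <= 1 -> (1 - s) *: z + s *: w != 0) -> U z -> U w.
Proof.
move=> r0 Nr /andP[z0 z1] /andP[w0 w1] m0 Uz.
pose m (s : R) := (1 - s) *: z + s *: w.
pose e (s : R) := (1 - s) * enorm z + s * enorm w.
pose h (s : R) := (e s / enorm (m s)) *: m s.
have en0 (x : V) : x != 0 -> enorm x != 0.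
  by move=> x0; rewrite -sqrf_eq0 enorm2 dot_eq0.
have nn s : s \in `[0, 1] -> enorm (m s) != 0.
  by rewrite in_itv /= => /m0 /en0.
have h0 : h 0 = z.
  rewrite /h /e /m subr0 !scale1r !mul1r scale0r mul0r !addr0 mulfV ?scale1r //.
  by have := nn 0; rewrite in_itv /= lexx ler01 /m subr0 scale1r scale0r addr0 => /(_ isT).
have h1 : h 1 = w.
  rewrite /h /e /m subrr !scale1r !mul1r scale0r mul0r !add0r mulfV ?scale1r //.
  by have := nn 1; rewrite in_itv /= lexx ler01 /m subrr scale1r scale0r add0r => /(_ isT).
rewrite -h1; have I0 : (0 : R) \in `[0, 1] by rewrite in_itv /= lexx ler01.
have I1 : (1 : R) \in `[0, 1] by rewrite in_itv /= lexx ler01.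
suff [P1 P2] : (forall s, s \in `[0, 1] -> {for s, continuous h}) /\
    (forall s, s \in `[0, 1] -> CH2 (h s) /\ ~ N (h s)).
  by have := exterior_path P1 P2 I0 I1; rewrite h0; apply.
split.
  move=> s sI.
  have D (v : V) (a : R -> R) (a' : R) : is_derive s 1 a a' -> {for s, continuous (fun s => a s *: v)}.
    by move=> Da; apply: (is_derive_cont (is_derive_scale Da (is_derive_const v s))).
  have D1 : is_derive s 1 (fun s : R => 1 - s) (0 - 1).
    exact: is_deriveB (is_derive_const (1 : R) s) (is_derive_id s 1).
  have cm : {for s, continuous m}.
    apply: cvgD; [exact: D D1|exact: (D w _ _ (is_derive_id s 1))].
  have ce : {for s, continuous e}.
    have De := is_derive_add (is_derive_mul D1 (is_derive_const (enorm z) s))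
      (is_derive_mul (is_derive_id s 1) (is_derive_const (enorm w) s)).
    exact: (is_derive_cont De).
  have cn := enorm_cont cm.
  apply: cvgZ => //; apply: cvgM => //; apply: cvgV => //; exact: nn.
move=> s sI; have nz := nn s sI.
have E : dot (h s) (h s) = e s ^+ 2.
  rewrite /h dotZl dotZr mulrA -enorm2 -!expr2.
  by rewrite -exprMn mulfVK.
move: sI; rewrite in_itv /= => /andP[s0 s1].
have rr : Num.sqrt rho ^+ 2 = rho by rewrite sqr_sqrtr.
have sr := sqrtr_ge0 rho.
have lz : Num.sqrt rho < enorm z by rewrite ltr_sqrt // (le_lt_trans r0).
have lw : Num.sqrt rho < enorm w by rewrite ltr_sqrt // (le_lt_trans r0).
have uz : enorm z < 1 by rewrite -(sqrtr1 R) ltr_sqrt.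
have uw : enorm w < 1 by rewrite -(sqrtr1 R) ltr_sqrt.
have [el eu] : Num.sqrt rho < e s /\ e s < 1.
  by split; [apply: convex_gt|apply: convex_lt].
have E1 : rho < dot (h s) (h s) by rewrite E -rr; nra.
split; first by rewrite /CH2 /= E; nra.
by move/Nr; rewrite leNgt E1.
Qed.

(** If the segment meets 0, then [w] is a negative multiple of [z], and a detour through [J z]
    avoids 0. *)
Lemma shell_exterior (rho : R) z w : 0 <= rho -> (forall q, N q -> dot q q <= rho) ->
  rho < dot z z < 1 -> rho < dot w w < 1 -> U z -> U w.
Proof.
move=> r0 Nr hz hw Uz.
have z0 : z != 0.
  by rewrite -dot_eq0 gt_eqF //; case/andP: hz => h _; apply: le_lt_trans h.
have w0 : w != 0.
  by rewrite -dot_eq0 gt_eqF //; case/andP: hw => h _; apply: le_lt_trans h.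
have [H|H] := pselect (forall s : R, 0 <= s <= 1 -> (1 - s) *: z + s *: w != 0).
  exact: (shell_path r0 Nr hz hw).
have [s [sI]] : exists s : R, 0 <= s <= 1 /\ (1 - s) *: z + s *: w = 0.
  apply: contrapT => h; apply: H => s sI; apply/eqP => h'; apply: h; by exists s.
move=> E.
have hJ : rho < dot (J z) (J z) < 1 by rewrite dotJ.
have UJ : U (J z).
  apply: (shell_path r0 Nr hz hJ) => // t _; apply/eqP => /(cs_inj z0) [h1 h2].
  by move: h1; rewrite h2 subr0 => /eqP; rewrite oner_eq0.
have s0 : s != 0.
  apply/eqP => s0; move: E; rewrite s0 subr0 scale1r scale0r addr0 => h; case/negP: z0; exact/eqP.
have wE : w = (- ((1 - s) / s)) *: z.
  apply: (scalerI s0); rewrite scalerA mulrN mulrCA mulfV // mulr1 scaleNr.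
  by move/eqP: E; rewrite addrC addr_eq0 => /eqP.
apply: (shell_path r0 Nr hJ hw _ UJ) => t _; apply/eqP => E'.
have : cs (- (t * ((1 - s) / s))) (1 - t) z = 0.
  by rewrite -E' [in RHS]wE scalerA mulrN [RHS]addrC.
move=> /(cs_inj z0) [h1 h2].
have t1 : t = 1 by apply/esym/eqP; rewrite -subr_eq0 h2.
move: h1; rewrite t1 mul1r => h1; move: w0; rewrite wE h1 scale0r eqxx //.
Qed.

End Comp.

Lemma compact_norm_bound N : N `<=` CH2 (R := R) -> compact N -> N !=set0 ->
  exists2 rho : R, 0 <= rho < 1 & forall q, N q -> dot q q <= rho.
Proof.
move=> NC cN N0.
have [|c cN' Hc] := EVT_max_rV (f := fun z : V => dot z z) N0 cN.
  by apply: continuous_subspaceT; apply: CH2_continuous.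
exists (dot c c); first by rewrite dot_ge0 /=; apply: NC; move: cN'; rewrite inE.
by move=> q Nq; apply: Hc; rewrite inE.
Qed.

Lemma flow_unit N nu q : submanifold 1 N -> inward_normal N nu -> N q ->
  metric q (J (nu q)) (J (nu q)) = 1.
Proof. by move=> hN hnu Nq; rewrite metricJ (nu_unit hN hnu). Qed.

Lemma flowE N nu q (t : R) : submanifold 1 N -> inward_normal N nu -> N q ->
  tangent_flow nu (q, t) = geoE q (J (nu q)) t.
Proof.
by move=> hN hnu Nq; rewrite /tangent_flow /= geodE ?(flow_unit hN hnu) //; apply: nu_sub_CH2 hN _ Nq.
Qed.

Lemma geoE_near_boundary q u (rho : R) : CH2 q -> metric q u u = 1 -> rho < 1 ->
  exists2 T : R, 0 < T & forall t, T <= t -> rho < dot (geoE q u t) (geoE q u t) < 1.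
Proof.
move=> hq hu r1; have [T T0 HT] := omd_large ((1 - dot q q) / (1 - rho)) hq hu.
exists T => // t /HT h; rewrite [X in _ && X](geoE_in hq hu) andbT.
have D0 := omd_gt0 hq hu t.
have r0 : 0 < 1 - rho by rewrite subr_gt0.
move: h; rewrite ltr_pdivrMr // mulrC -ltr_pdivrMr // -geoE_norm //; lra.
Qed.

(** A single tangent ray suffices: it runs in the exterior and ends up in the shell, and the shell
    is path connected and disjoint from [N]. *)
Lemma exists_shell N nu B : submanifold 1 N -> compact N -> N !=set0 ->
  inward_normal N nu -> outer_billiard_map N nu B ->
  exists2 rho : R, 0 <= rho < 1 & (forall q, N q -> dot q q <= rho) /\
    forall z, rho < dot z z < 1 -> exterior N nu z.
Proof.
move=> hN cN N0 hnu [[Fp _ _] _ _].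
have [rho /andP[r0 r1] Nr] := compact_norm_bound (nu_sub_CH2 hN) cN N0.
exists rho; rewrite ?r0 //; split=> // z hz.
have [q Nq] := N0; have hq := nu_sub_CH2 hN Nq; have hu := flow_unit hN hnu Nq.
have [T T0 HT] := geoE_near_boundary hq hu r1.
apply: (shell_exterior r0 Nr (HT T (lexx _)) hz).
by rewrite -(flowE _ hN hnu Nq); apply: Fp.
Qed.

End Exterior.

(** * Billiards in a complex line *)

Section Core.
Variable R : realType.
Notation V := 'rV[R]_(2 + 2).
Implicit Types (p q u v w x y z : V) (N : set V).

(* H is the intersection of the ball with a + C b, and the tangent flow neither
   leaves nor enters H. *)
Definition billiard_line (H : set V) a b N (nu B : V -> V) : Prop :=
  [/\ [/\ dot a b = 0, dot a (J b) = 0, dot b b = 1 - dot a a, CH2 a &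
        (forall z, H z <-> exists x y : R, z = a + cs x y b /\ x ^+ 2 + y ^+ 2 < 1) /\
        (forall q, H q -> forall w, tangent 2 H q w <-> cspan b w)],
      [/\ submanifold 1 N, compact N, N !=set0, inward_normal N nu & outer_billiard_map N nu B],
      (forall q, N q -> H q -> cspan b (nu q)) &
      (forall q (t : R), N q -> t != 0 -> H (tangent_flow nu (q, t)) -> H q)].

Lemma cvg_gdir (T : Type) (F : set_system T) (X Q W : T -> V) x q v : Filter F ->
  X e @[e --> F] --> x -> Q e @[e --> F] --> q -> W e @[e --> F] --> v ->
  gdir (X e) (Q e) (W e) @[e --> F] --> gdir x q v.
Proof.
move=> FF hx hq hv.
have hxq : (X e - Q e) @[e --> F] --> x - q by exact: cvgB.
apply: cvgB; apply: cvgM; try exact: cvg_dot.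
by apply: cvgB; [exact: cvg_cst|exact: cvg_dot].
Qed.

Section Given.
Variables (H : set V) (a b : V) (N : set V) (nu B : V -> V).
Hypothesis hyp : billiard_line H a b N nu B.
Let ab : dot a b = 0. Proof. by case: hyp => -[]. Qed.
Let aJb : dot a (J b) = 0. Proof. by case: hyp => -[]. Qed.
Let bb : dot b b = 1 - dot a a. Proof. by case: hyp => -[]. Qed.
Let ha : CH2 a. Proof. by case: hyp => -[]. Qed.
Let Heq z : H z <-> exists x y : R, z = a + cs x y b /\ x ^+ 2 + y ^+ 2 < 1.
Proof. by case: hyp => -[_ _ _ _ [+ _]] _ _ _; apply. Qed.
Let hN : submanifold 1 N. Proof. by case: hyp => _ []. Qed.
Let cN : compact N. Proof. by case: hyp => _ []. Qed.
Let hnu : inward_normal N nu. Proof. by case: hyp => _ []. Qed.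
Let hB : outer_billiard_map N nu B. Proof. by case: hyp => _ []. Qed.
Let Hnu q : N q -> H q -> cspan b (nu q). Proof. by case: hyp => _ _ + _; apply. Qed.
Let Hback q (t : R) : N q -> t != 0 -> H (tangent_flow nu (q, t)) -> H q.
Proof. by case: hyp => _ _ _; apply. Qed.
Let P0 : 0 < 1 - dot a a. Proof. exact: CH2_gt0. Qed.
Let b0 : b != 0. Proof. by rewrite -dot_eq0 bb gt_eqF. Qed.
Let NC q : N q -> CH2 q. Proof. exact: nu_sub_CH2. Qed.
Notation U := (exterior N nu).

Lemma bl_norm (x y : R) : 1 - dot (a + cs x y b) (a + cs x y b) =
  (1 - dot a a) * (1 - (x ^+ 2 + y ^+ 2)).
Proof.
have E : dot a (cs x y b) = 0 by rewrite /cs !dotE ab aJb !mulr0 addr0.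
by rewrite dot_add_orth // dot_cs bb; ring.
Qed.

Lemma bl_HP z : H z <-> CH2 z /\ cspan b (z - a).
Proof.
split=> [/Heq [x [y [-> h]]]|[hz [x [y E]]]].
  split; last by exists x, y; rewrite addrC addKr.
  by rewrite /CH2 /= -subr_gt0 bl_norm mulr_gt0 // subr_gt0.
have zE : z = a + cs x y b by rewrite -E addrC subrK.
apply/Heq; exists x, y; split=> //; move: (CH2_gt0 hz).
by rewrite zE bl_norm pmulr_rgt0 // subr_gt0.
Qed.

Lemma bl_diff x q : H x -> H q -> cspan b (x - q).
Proof.
move=> /bl_HP [_ hx] /bl_HP [_ hq].
by have := cspanD hx (cspanN hq); rewrite opprB addrA subrK.
Qed.

Lemma bl_move q v : H q -> cspan b v -> CH2 (q + v) -> H (q + v).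
Proof.
move=> /bl_HP [_ hq] bv h; apply/bl_HP; split=> //.
by have := cspanD hq bv; rewrite addrAC.
Qed.

Lemma bl_flow q (t : R) : N q -> H q -> H (tangent_flow nu (q, t)).
Proof.
move=> Nq Hq; rewrite (flowE _ hN hnu Nq); apply: bl_move => //.
  by apply: cspan_cs; apply: cspanJ; apply: Hnu.
exact: (geoE_in (NC Nq) (flow_unit hN hnu Nq)).
Qed.

Lemma bl_nu_span q : N q -> H q -> cspan (nu q) `<=>` cspan b.
Proof.
by move=> Nq Hq; apply: cspan_sym; [apply: unit_neq0 (nu_unit hN hnu Nq)|apply: Hnu].
Qed.

Lemma bl_exterior x : H x -> U x -> exists q (t : R), [/\ N q, H q, 0 < t & x = tangent_flow nu (q, t)].
Proof.
move=> Hx Ux; have [[_ _ surj] _ _] := hB.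
have [[q t] [Nq t0] E] := surj x Ux.
exists q, t; split=> //; apply: (Hback Nq) (_ : t != 0) _; first by rewrite gt_eqF.
by rewrite E.
Qed.

Lemma flow_exterior q (t : R) : N q -> 0 < t -> U (tangent_flow nu (q, t)).
Proof. by move=> Nq t0; have [[Fp _ _] _ _] := hB; apply: Fp. Qed.

Lemma flow_exteriorN q (t : R) : N q -> t < 0 -> U (tangent_flow nu (q, t)).
Proof. by move=> Nq t0; have [_ [Fp _ _] _] := hB; apply: Fp. Qed.

Lemma flow_inj q q' (t t' : R) : N q -> N q' -> 0 < t -> 0 < t' ->
  tangent_flow nu (q, t) = tangent_flow nu (q', t') -> q = q' /\ t = t'.
Proof.
move=> Nq Nq' t0 t0' E; have [[_ inj _] _ _] := hB.
have := inj (q, t) (q', t'); rewrite !inE => /(_ (conj Nq t0) (conj Nq' t0') E) [-> ->].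
by [].
Qed.

(** That [x] is on the tangent ray from [q]. The weak inequality makes the condition closed, so that
    its failure persists for nearby pairs. *)
Definition tangent_from x q := gdir x q (nu q) = 0 /\ 0 <= gdir x q (J (nu q)).

Lemma flow_tangent q (t : R) : N q -> 0 < t ->
  gdir (tangent_flow nu (q, t)) q (nu q) = 0 /\ 0 < gdir (tangent_flow nu (q, t)) q (J (nu q)).
Proof.
move=> Nq t0; rewrite (flowE _ hN hnu Nq).
have hu := flow_unit hN hnu Nq; have hq := NC Nq.
have [-> E] := gdir_geoE t hq hu; split.
  have : gdir (geoE q (J (nu q)) t) q (J (J (nu q))) = - gdir (geoE q (J (nu q)) t) q (nu q).
    by rewrite /gdir JJ !dotNr; ring.
  by rewrite E => /eqP; rewrite eq_sym oppr_eq0 => /eqP.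
have S0 : 0 < sh t by rewrite sh_gt0.
have U0 := dot_gt0 (unit_neq0 hu); have O0 := omd_gt0 hq hu t; have A0 := CH2_gt0 hq.
have C0 := ch_gt0 t.
by apply: mulr_gt0; [apply: mulr_gt0|apply: divr_gt0 => //; apply: mulr_gt0].
Qed.

Lemma tangent_flow_inv x q : CH2 x -> N q -> H q -> H x -> x != q -> tangent_from x q ->
  exists2 t : R, 0 < t & x = tangent_flow nu (q, t).
Proof.
move=> hx Nq Hq Hx xq [G P]; have hu := flow_unit hN hnu Nq; have hq := NC Nq.
have [||t t0 E] := gdir_geoE_inv hq hx hu xq _ _ P.
- exact: (cspan_sym (unit_neq0 hu) (cspanJ (Hnu Nq Hq))).2 _ (bl_diff Hx Hq).
- by rewrite JJ -[RHS]oppr0 -G /gdir !dotNr; ring.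
- by exists t => //; rewrite (flowE _ hN hnu Nq).
Qed.

Lemma closed_line : closed [set z | cproj b (z - a) = z - a].
Proof.
have C : continuous (fun z => cproj b (z - a) - (z - a)).
  have sm : Ck 0 setT (fun z => cproj b (z - a) - (z - a)).
    have oT : open [set: V] by exact: openT.
    have s1 : Ck 0 setT (fun z => z - a) by ck.
    have s2 : Ck 0 setT (fun z => - (z - a)) by exact: Ck_opp.
    exact: (Ck_add oT (Ck_cproj b oT s1) s2).
  by move=> z; apply: sm.
rewrite (_ : [set _ | _] = (fun z => cproj b (z - a) - (z - a)) @^-1` [set 0]); last first.
  apply/seteqP; split=> z /= => [->|/eqP]; first by rewrite subrr.
  by rewrite subr_eq0 => /eqP.
apply: closed_comp => [z _|]; first exact: C.
by apply: accessible_closed_set1; apply: hausdorff_accessible; exact: norm_hausdorff.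
Qed.

Lemma bl_NHE : N `&` H = N `&` [set z | cproj b (z - a) = z - a].
Proof.
apply/seteqP; split=> z [Nz h]; split=> //.
  by apply: cproj_id => //; have [] := (bl_HP z).1 h.
apply/bl_HP; split; first exact: NC.
by rewrite -h; apply: cproj_span.
Qed.

(** The common points of [N] and [H] outside [O] form a compact set on which tangency from [xs]
    fails. It fails near each such pair, so by compactness one neighbourhood of [xs] serves them
    all. *)
Lemma tangency_cont xs qs (O : set V) : CH2 xs -> N qs -> H qs ->
  (forall q, N q -> H q -> q <> qs -> ~ tangent_from xs q) -> nbhs qs O ->
  \forall x \near xs, forall q (t : R), N q -> H q -> 0 < t -> x = tangent_flow nu (q, t) -> O q.
Proof.
move=> hxs Nqs Hqs uniq Oqs.
pose K := (N `&` H) `&` ~` (interior O).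
have cK : compact K.
  rewrite /K bl_NHE; apply: compact_closedI.
    by apply: compact_closedI => //; apply: closed_line.
  by apply: open_closedC; apply: open_interior.
have := (compact_near_coveringP K).1 cK.
move=> /(_ V (nbhs xs) (fun x q => N q -> ~ tangent_from x q) _) cov.
have : \forall x \near xs, K `<=` (fun q => N q -> ~ tangent_from x q).
  apply: cov => q' [[Nq' Hq'] Oq'].
  have nq : q' <> qs by move=> E; apply: Oq'; rewrite E.
  have [W [f [xi Hch]]] := normal_chart_exists hN hnu Nq'.
  have [[oW Wq _ _ _] [sxi xiE _ _ _] _] := Hch.
  have cxi := Ck_cont (sxi 0%N) Wq.
  have c1 : fst e @[e --> (q', xs)] --> q' by exact: cvg_fst.
  have c2 : snd e @[e --> (q', xs)] --> xs by exact: cvg_snd.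
  have c3 : xi (fst e) @[e --> (q', xs)] --> xi q' by apply: (cvg_comp _ _ c1 cxi).
  have cJ : J (xi (fst e)) @[e --> (q', xs)] --> J (xi q') by exact: (@cvg_lin _ _ _ (@J R) _ _ _ _ _ c3).
  have cG : gdir e.2 e.1 (xi e.1) @[e --> (q', xs)] --> gdir xs q' (xi q') by exact: cvg_gdir.
  have cP : gdir e.2 e.1 (J (xi e.1)) @[e --> (q', xs)] --> gdir xs q' (J (xi q')) by exact: cvg_gdir.
  have nW : \forall e \near (q', xs), W e.1 by exact: (c1 _ (open_nbhs_nbhs (conj oW Wq))).
  have := uniq q' Nq' Hq' nq.
  rewrite /tangent_from -(xiE q' Nq' Wq).
  move=> nT.
  suff S : \forall e \near (q', xs), N e.1 ->
      ~ (gdir e.2 e.1 (nu e.1) = 0 /\ 0 <= gdir e.2 e.1 (J (nu e.1))) by exact: S.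
  have [G0|G0] := eqVneq (gdir xs q' (xi q')) 0.
    have P0' : gdir xs q' (J (xi q')) < 0.
      by rewrite ltNge; apply/negP => h; apply: nT.
    have nP : \forall e \near (q', xs), gdir e.2 e.1 (J (xi e.1)) < 0 by exact: cvgr_lt cP _ P0'.
    apply: filterS (filterI nW nP) => -[q x] /= [Wq' Pq] Nq [_]; rewrite -xiE //.
    by rewrite leNgt Pq.
  have nG : \forall e \near (q', xs), gdir e.2 e.1 (xi e.1) != 0 by exact: cvgr_neq0 cG G0.
  apply: filterS (filterI nW nG) => -[q x] /= [Wq' Gq] Nq [+ _]; rewrite -xiE //.
  exact/eqP.
apply: filterS => x Hx q t Nq Hq t0 E.
apply: contrapT => nO.
have Kq : K q by split=> // /interior_subset.
apply: (Hx q Kq Nq); have [G P] := flow_tangent Nq t0.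
by rewrite -E in G P; split=> //; apply: ltW.
Qed.

Lemma tangency_cont_ext qs (t : R) (O : set V) : N qs -> H qs -> 0 < t -> nbhs qs O ->
  \forall x \near tangent_flow nu (qs, t), forall q (t : R), N q -> H q -> 0 < t -> x = tangent_flow nu (q, t) -> O q.
Proof.
move=> Nq Hq t0 Oq; have Ux := flow_exterior Nq t0; have [hx nx] := exterior_sub Ux.
apply: (tangency_cont hx Nq Hq) => // q' Nq' Hq' nq T.
have xq : tangent_flow nu (qs, t) != q' by apply/eqP => E; apply: nx; rewrite E.
have [t' t0' E] := tangent_flow_inv hx Nq' Hq' (bl_flow _ Nq Hq) xq T.
by have [] := flow_inj Nq Nq' t0 t0' E => /esym.
Qed.

(** Uniqueness holds here because a tangent ray from another point through [qs] would put [qs], a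
    point of [N], into the exterior. *)
Lemma tangency_cont_boundary qs (O : set V) : N qs -> H qs -> nbhs qs O ->
  \forall x \near qs, forall q (t : R), N q -> H q -> 0 < t -> x = tangent_flow nu (q, t) -> O q.
Proof.
move=> Nq Hq Oq; apply: (tangency_cont (NC Nq) Nq Hq) => // q' Nq' Hq' nq T.
have xq : qs != q' by apply/eqP => /esym.
have [t' t0' E] := tangent_flow_inv (NC Nq) Nq' Hq' Hq xq T.
have := flow_exterior Nq' t0'; rewrite -E; by move/exterior_sub => [].
Qed.

End Given.
End Core.

(** * The side of the hypersurface on which the exterior lies *)

Section Side.
Variable R : realType.
Notation V := 'rV[R]_(2 + 2).

Lemma neg_second_derivative (k k1 k2 : R -> R) (t : R) : 0 < t ->
  (forall s, 0 <= s <= t -> is_derive s 1 k (k1 s)) ->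
  (forall s, 0 <= s <= t -> is_derive s 1 k1 (k2 s)) ->
  (forall s, 0 <= s <= t -> k2 s < 0) -> k 0 = 0 -> k1 0 = 0 -> k t < 0.
Proof.
move=> t0 D1 D2 h k0 k10.
have MV (g dg : R -> R) (c : R) : 0 < c -> c <= t -> (forall s, 0 <= s <= t -> is_derive s 1 g (dg s)) ->
    exists2 d, 0 < d < c & g c - g 0 = dg d * c.
  move=> c0 ct D.
  have sub (x : R) : 0 <= x <= c -> 0 <= x <= t by move=> /andP[-> /= h']; apply: le_trans ct.
  have [||d dI E] := @MVT R g dg 0 c c0.
  - by move=> x; rewrite in_itv /= => /andP[x0 x1]; apply: D; apply: sub; rewrite !ltW.
  - by apply: derivable_within_continuous => x; rewrite in_itv /= => /sub /D [].
  - by exists d; [move: dI; rewrite in_itv|rewrite E subr0].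
have [d /andP[d0 dt] E] := MV k k1 t t0 (lexx _) D1.
have [d' /andP[d0' dt'] E'] := MV k1 k2 d d0 (ltW dt) D2.
move: E E'; rewrite k0 k10 !subr0 => -> ->.
have h' : k2 d' < 0 by apply: h; rewrite (ltW d0') ltW // (lt_trans dt').
by rewrite pmulr_llt0 // pmulr_llt0.
Qed.

Lemma cvg_diff1 n (g : 'rV[R]_n -> R) (W : set 'rV[R]_n) (T : Type) (F : set_system T)
  (Z Y : T -> 'rV[R]_n) (z v : 'rV[R]_n) : Filter F -> Ck 1 W g -> W z ->
  Z e @[e --> F] --> z -> Y e @[e --> F] --> v -> 'd g (Z e) (Y e) @[e --> F] --> 'd g z v.
Proof.
move=> FF sg Wz hZ hY.
rewrite [X in _ --> X]diff_row_sum.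
have -> : (fun e => 'd g (Z e) (Y e)) = fun e => \sum_i (Y e) ord0 i *: 'd g (Z e) (delta_mx 0 i).
  by apply/funext => e; apply: diff_row_sum.
apply: cvg_big => [|i _]; first exact: add_continuous.
apply: cvgZ.
  exact: (@cvg_comp _ _ _ _ (fun w : 'rV[R]_n => w ord0 i) _ _ _ hY (@coord_continuous _ _ _ _ _ _)).
exact: (cvg_comp _ _ hZ (Ckd (delta_mx 0 i) sg z Wz)).
Qed.

Lemma diff2_sum n (g : 'rV[R]_n -> R) (W : set 'rV[R]_n) (z v x : 'rV[R]_n) : Ck 2 W g -> W z ->
  'd (fun y => 'd g y v) z x = \sum_i v ord0 i * 'd (fun y => 'd g y (delta_mx 0 i)) z x.
Proof.
move=> sg Wz.
have D i : is_diff z (fun y => v ord0 i *: 'd g y (delta_mx 0 i))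
    (fun h => v ord0 i *: 'd (fun y => 'd g y (delta_mx 0 i)) z h).
  have D1 := CkS_diff (Ckd (delta_mx 0 i) sg) Wz.
  have D2 := is_diff_scale (is_diff_cst (v ord0 i) z) D1.
  apply: is_diff_ext D2 _ _ => h //; by rewrite scale0r addr0.
have D3 := is_diff_sum D.
have D4 := is_diff_ext D3 (fun y => esym (diff_row_sum g y v)) (fun=> erefl).
exact: (is_diffE x D4).
Qed.

Lemma cvg_diff2 n (g : 'rV[R]_n -> R) (W : set 'rV[R]_n) (T : Type) (F : set_system T)
  (Z Y X : T -> 'rV[R]_n) (z v x : 'rV[R]_n) : Filter F -> open W -> Ck 2 W g -> W z ->
  Z e @[e --> F] --> z -> Y e @[e --> F] --> v -> X e @[e --> F] --> x ->
  'd (fun y => 'd g y (Y e)) (Z e) (X e) @[e --> F] --> 'd (fun y => 'd g y v) z x.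
Proof.
move=> FF oW sg Wz hZ hY hX.
rewrite [X in _ --> X](diff2_sum v x sg Wz).
have nW : \forall e \near F, W (Z e) by exact: (hZ _ (open_nbhs_nbhs (conj oW Wz))).
have E : \forall e \near F, \sum_i (Y e) ord0 i * 'd (fun y => 'd g y (delta_mx 0 i)) (Z e) (X e) =
    'd (fun y => 'd g y (Y e)) (Z e) (X e).
  by apply: filterS nW => e We; exact: (esym (diff2_sum _ _ sg We)).
apply: cvg_trans (near_eq_cvg E) _.
apply: cvg_big => [|i _]; first exact: add_continuous.
apply: cvgM.
  exact: (@cvg_comp _ _ _ _ (fun w : 'rV[R]_n => w ord0 i) _ _ _ hY (@coord_continuous _ _ _ _ _ _)).
exact: (cvg_diff1 _ (Ckd (delta_mx 0 i) sg) Wz hZ hX).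
Qed.

Implicit Types (p q u v w x y z : V) (N : set V).

Section Cvg.
Variables (T : Type) (F : set_system T).
Context {FF : Filter F}.
Variables (Z Y : T -> V) (S : T -> R) (z v : V) (s : R).
Hypotheses (hZ : Z e @[e --> F] --> z) (hY : Y e @[e --> F] --> v) (hS : S e @[e --> F] --> s).
Hypotheses (hz : CH2 z).

Let hJ (X : T -> V) x : X e @[e --> F] --> x -> J (X e) @[e --> F] --> J x.
Proof. by move=> h; exact: (@cvg_lin _ _ _ (@J R) _ _ _ _ _ h). Qed.
Let hd (X X' : T -> V) x x' : X e @[e --> F] --> x -> X' e @[e --> F] --> x' ->
  dot (X e) (X' e) @[e --> F] --> dot x x'.
Proof. by move=> h h'; exact: cvg_dot. Qed.
Let z1 : 1 - dot z z != 0. Proof. by rewrite gt_eqF ?CH2_gt0. Qed.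
Let hinv : (1 - dot (Z e) (Z e))^-1 @[e --> F] --> (1 - dot z z)^-1.
Proof. by apply: cvgV => //; apply: cvgB; [exact: cvg_cst|exact: hd]. Qed.

Lemma cvg_christoffel : christoffel (Z e) (Y e) (Y e) @[e --> F] --> christoffel z v v.
Proof.
apply: cvgZ => //; have hJZ := hJ hZ; have hJY := hJ hY.
have A : dot (Y e) (Z e) *: Y e @[e --> F] --> dot v z *: v by apply: cvgZ => //; exact: hd.
have B : dot (Y e) (J (Z e)) *: J (Y e) @[e --> F] --> dot v (J z) *: J v by apply: cvgZ => //; exact: hd.
exact: (cvgD (cvgD (cvgD A B) A) B).
Qed.

Lemma cvg_Phi (g : V -> R) (W : set V) : open W -> Ck 2 W g -> W z ->
  Phi g (Z e) (Y e) @[e --> F] --> Phi g z v.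
Proof.
move=> oW sg Wz; apply: cvgB; first exact: (cvg_diff2 _ oW sg Wz hZ hY hY).
by apply: (cvg_diff1 _ (CkW sg) Wz hZ); exact: cvg_christoffel.
Qed.

Hypothesis hv : metric z v v = 1.
Let hk1 : k1 (Z e) (Y e) @[e --> F] --> k1 z v. Proof. by apply: cvgM => //; exact: hd. Qed.
Let hk2 : k2 (Z e) (Y e) @[e --> F] --> k2 z v.
Proof. by apply: cvgM => //; apply: hd => //; exact: hJ. Qed.
Let hch : ch (S e) @[e --> F] --> ch s.
Proof. exact: (cvg_comp _ _ hS (is_derive_cont (is_derive_ch s))). Qed.
Let hsh : sh (S e) @[e --> F] --> sh s.
Proof. exact: (cvg_comp _ _ hS (is_derive_cont (is_derive_sh s))). Qed.
Let h1 : om1 (Z e) (Y e) (S e) @[e --> F] --> om1 z v s.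
Proof. by apply: cvgD => //; apply: cvgM. Qed.
Let h2 : om2 (Z e) (Y e) (S e) @[e --> F] --> om2 z v s.
Proof. by apply: cvgM. Qed.
Let hsq (f : T -> R) (c : R) : f e @[e --> F] --> c -> f e ^+ 2 @[e --> F] --> c ^+ 2.
Proof. by move=> h; apply: cvgM. Qed.
Let ho : omd (Z e) (Y e) (S e) @[e --> F] --> omd z v s.
Proof. by apply: cvgD; exact: hsq. Qed.
Let on : omd z v s != 0. Proof. by rewrite gt_eqF // omd_gt0. Qed.
Let hcs (f g : T -> R) (c d : R) : f e @[e --> F] --> c -> g e @[e --> F] --> d ->
  cs (f e) (g e) (Y e) @[e --> F] --> cs c d v.
Proof. by move=> h h'; apply: cvgD; apply: cvgZ => //; exact: hJ. Qed.

Lemma cvg_geoE : geoE (Z e) (Y e) (S e) @[e --> F] --> geoE z v s.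
Proof.
apply: cvgD => //; apply: hcs.
  by apply: cvgM; [apply: cvgM|exact: cvgV].
by apply: cvgM; [apply: cvgN; apply: cvgM|exact: cvgV].
Qed.

Lemma cvg_geoV : geoV (Z e) (Y e) (S e) @[e --> F] --> geoV z v s.
Proof.
have o2 : omd z v s ^+ 2 != 0 by rewrite expf_neq0.
have hi : (omd (Z e) (Y e) (S e) ^+ 2)^-1 @[e --> F] --> (omd z v s ^+ 2)^-1.
  by apply: cvgV => //; exact: hsq.
apply: hcs; apply: cvgM => //.
  by apply: cvgB; exact: hsq.
by apply: cvgN; apply: cvgM => //; apply: cvgM => //; exact: cvg_cst.
Qed.

End Cvg.

Section Given.
Variables (H : set V) (a b : V) (N : set V) (nu B : V -> V).
Hypothesis hyp : billiard_line H a b N nu B.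
Let hN : submanifold 1 N. Proof. by case: hyp => _ []. Qed.
Let hnu : inward_normal N nu. Proof. by case: hyp => _ []. Qed.
Let NC q : N q -> CH2 q. Proof. exact: nu_sub_CH2. Qed.
Notation U := (exterior N nu).

(* Tangent geodesics start into the side f < 0 as Phi f < 0 near (q, J (nu q)). *)
Lemma flow_side q W (f : V -> R) xi : N q -> normal_chart N nu q W f xi ->
  exists2 e : R, 0 < e & \forall q' \near q, N q' -> forall t : R, 0 < t < e -> f (tangent_flow nu (q', t)) < 0.
Proof.
move=> Nq Hch.
have [[oW Wq WC sf fE] [sxi xiE dpos nu1 dE] Hsh] := Hch.
have hq := NC Nq; have hu := flow_unit hN hnu Nq.
have cxi := Ck_cont (sxi 0%N) Wq.
have c1 : fst e @[e --> (q, (0 : R))] --> q by exact: cvg_fst.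
have c2 : snd e @[e --> (q, (0 : R))] --> (0 : R) by exact: cvg_snd.
have c3 : xi (fst e) @[e --> (q, (0 : R))] --> xi q by apply: (cvg_comp _ _ c1 cxi).
have c4 : J (xi (fst e)) @[e --> (q, (0 : R))] --> J (xi q) by exact: (@cvg_lin _ _ _ (@J R) _ _ _ _ _ c3).
have hu' : metric q (J (xi q)) (J (xi q)) = 1 by rewrite xiE.
have cE : geoE e.1 (J (xi e.1)) e.2 @[e --> (q, (0 : R))] --> q.
  by rewrite -[X in _ --> X](geoE0 q (J (xi q))); exact: cvg_geoE.
have cV : geoV e.1 (J (xi e.1)) e.2 @[e --> (q, (0 : R))] --> J (xi q).
  by rewrite -[X in _ --> X](geoV0 q (J (xi q))); exact: cvg_geoV.
have cP : Phi f (geoE e.1 (J (xi e.1)) e.2) (geoV e.1 (J (xi e.1)) e.2) @[e --> (q, (0 : R))] -->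
    Phi f q (J (xi q)) by exact: (cvg_Phi cE cV hq oW (sf 2) Wq).
have P0 : Phi f q (J (xi q)) < 0.
  rewrite xiE // (zeros_second Hch oW Wq sf _ Nq) ?metricuJ //; last by move=> z Wz /(fE z Wz).
  rewrite oppr_lt0 mulr_gt0 //; first by rewrite -xiE // dpos.
  by apply: Hsh; [rewrite metricuJ|apply: unit_neq0 hu].
have nP : \forall e \near (q, (0 : R)),
    Phi f (geoE e.1 (J (xi e.1)) e.2) (geoV e.1 (J (xi e.1)) e.2) < 0 by exact: cvgr_lt cP _ P0.
have nW : \forall e \near (q, (0 : R)), W (geoE e.1 (J (xi e.1)) e.2).
  exact: (cE _ (open_nbhs_nbhs (conj oW Wq))).
have [[A C] /= [nA nC] HAC] := filterI nP nW.
have /nbhs_ballP [e e0 He] := nC.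
exists e => //.
apply: filterS (filterI nA (open_nbhs_nbhs (conj oW Wq))) => q' [Aq' Wq'] Nq' t /andP[t0 te].
have hq' := NC Nq'; have hu2 := flow_unit hN hnu Nq'.
have Q s : 0 <= s <= t -> Phi f (geoE q' (J (nu q')) s) (geoV q' (J (nu q')) s) < 0 /\
    W (geoE q' (J (nu q')) s).
  move=> /andP[s0 st].
  have Cs : C s by apply: He; rewrite /ball /= sub0r normrN ger0_norm // (le_lt_trans st).
  by have := HAC (q', s) (conj Aq' Cs); rewrite /= xiE.
rewrite (flowE _ hN hnu Nq').
apply: (@neg_second_derivative (fun s => f (geoE q' (J (nu q')) s))
   (fun s => 'd f (geoE q' (J (nu q')) s) (geoV q' (J (nu q')) s))
   (fun s => Phi f (geoE q' (J (nu q')) s) (geoV q' (J (nu q')) s)) t t0).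
- by move=> s /Q [_ Ws]; have [] := geoE_second oW (sf 2) hq' hu2 Ws.
- by move=> s /Q [_ Ws]; have [] := geoE_second oW (sf 2) hq' hu2 Ws.
- by move=> s /Q [].
- by rewrite geoE0; apply/(fE _ Wq').
- by rewrite geoE0 geoV0 (dE _ _ Nq' Wq') metricuJ mulr0.
Qed.

(** An exterior point of [H] near [q] is on a tangent ray whose start is near [q] by
    [tangency_cont_boundary] and whose time is short by [geoE_dist]; so [flow_side] applies. *)
Lemma exterior_side q W (f : V -> R) xi : N q -> H q -> normal_chart N nu q W f xi ->
  \forall x \near q, H x -> U x -> f x < 0.
Proof.
move=> Nq Hq Hch; have [e e0 He] := flow_side Nq Hch.
have [[oW Wq WC sf fE] [sxi xiE dpos nu1 dE] Hsh] := Hch.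
have hq := NC Nq; have hu := flow_unit hN hnu Nq.
have cxi := Ck_cont (sxi 0%N) Wq.
(* By [geoE_dist] this is sinh^2 t at a pair (x, q') in which x is the point at time t on the
   tangent geodesic from q'. *)
pose r (e : V * V) := dot (e.1 - e.2) (e.1 - e.2) * (1 - dot e.2 e.2) /
   ((1 - dot e.1 e.1) * dot (J (xi e.2)) (J (xi e.2))).
have c1 : fst e @[e --> (q, q)] --> q by exact: cvg_fst.
have c2 : snd e @[e --> (q, q)] --> q by exact: cvg_snd.
have c3 : xi (snd e) @[e --> (q, q)] --> xi q by apply: (cvg_comp _ _ c2 cxi).
have c4 : J (xi (snd e)) @[e --> (q, q)] --> J (xi q) by exact: (@cvg_lin _ _ _ (@J R) _ _ _ _ _ c3).
have d0 : (1 - dot q q) * dot (J (xi q)) (J (xi q)) != 0.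
  by rewrite mulf_neq0 // gt_eqF ?CH2_gt0 // dot_gt0 // xiE // (unit_neq0 hu).
have cr : r e @[e --> (q, q)] --> r (q, q).
  have c5 : (e.1 - e.2) @[e --> (q, q)] --> q - q by exact: cvgB.
  apply: cvgM.
    by apply: cvgM; [exact: cvg_dot|apply: cvgB; [exact: cvg_cst|exact: cvg_dot]].
  have c6 : (1 - dot e.1 e.1) * dot (J (xi e.2)) (J (xi e.2)) @[e --> (q, q)] -->
      (1 - dot q q) * dot (J (xi q)) (J (xi q)).
    apply: cvgM; last exact: cvg_dot.
    by apply: cvgB; [exact: cvg_cst|exact: cvg_dot].
  exact: (cvgV d0 c6).
have r0 : r (q, q) = 0 by rewrite /r /= subrr dot0l !mul0r.
(* Since t <= 2 sinh t, a value of [r] below (e / 2)^2 gives t < e. *)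
have e2 : r (q, q) < (e / 2) ^+ 2 by rewrite r0 exprn_gt0 // divr_gt0.
have nr : \forall x \near (q, q), r x < (e / 2) ^+ 2 by exact: cvgr_lt cr _ e2.
have [[A C] /= [nA nC] HAC] := nr.
have nO : nbhs q (fun q' => (C q' /\ (N q' -> forall t : R, 0 < t < e -> f (tangent_flow nu (q', t)) < 0)) /\ W q').
  by apply: filterI; [exact: filterI|exact: (open_nbhs_nbhs (conj oW Wq))].
have := tangency_cont_boundary hyp Nq Hq nO.
move=> T; apply: filterS (filterI nA T) => x [Ax Tx] Hx Ux.
have [q' [t [Nq' Hq' t0 E]]] := bl_exterior hyp Hx Ux.
have [[Cq' He'] Wq'] := Tx q' t Nq' Hq' t0 E.
have hq' := NC Nq'; have hu2 := flow_unit hN hnu Nq'.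
rewrite E; apply: He' => //; rewrite t0 /=.
have := HAC (x, q') (conj Ax Cq'); rewrite /r /= xiE // E (flowE _ hN hnu Nq').
have D := geoE_dist t hq' hu2.
have X0 := CH2_gt0 (geoE_in hq' hu2 t).
have U0 := dot_gt0 (unit_neq0 hu2).
rewrite D ltr_pdivrMr; last by rewrite mulr_gt0.
rewrite -mulrA [dot _ _ * (1 - _)]mulrC ltr_pM2r; last by rewrite mulr_gt0.
have S0 : 0 < sh t by rewrite sh_gt0.
have e20 : 0 < e / 2 by rewrite divr_gt0.
rewrite ltr_pXn2r ?nnegrE ?(ltW S0) ?(ltW e20) //.
by rewrite ltr_pdivlMr // mulrC; apply: le_lt_trans; apply: le_2sh; apply: ltW.
Qed.

(** The equation [f] is positive just after the start in direction [nu], but negative at nearby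
    exterior points of [H]. *)
Lemma inward_not_exterior q : N q -> H q ->
  exists2 e : R, 0 < e & forall s : R, 0 < s < e ->
    [/\ H (geod q (nu q) s), ~ N (geod q (nu q) s) & ~ U (geod q (nu q) s)].
Proof.
move=> Nq Hq; have [W [f [xi Hch]]] := normal_chart_exists hN hnu Nq.
have Hsd := exterior_side Nq Hq Hch.
have [[oW Wq WC sf fE] [sxi xiE dpos nu1 dE] Hsh] := Hch.
have hq := NC Nq; have hu := nu_unit hN hnu Nq.
have D := is_derive_geoE hq hu (0 : R).
rewrite geoV0 in D.
have D1 : is_derive (0 : R) 1 (fun s => f (geoE q (nu q) s)) ('d f q (nu q)).
  apply: is_derive_diff_comp D; rewrite geoE0; exact: (CkS_diff (sf 1%N) Wq).
have fpos : 0 < 'd f q (nu q) by rewrite -xiE // dpos.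
have nf : \forall s \near (0 : R), 0 < s -> 0 < f (geoE q (nu q) s).
  have /is_diff_derive D2 := D1.
  have c0 : 0 < 'd f q (nu q) / 2 by rewrite divr_gt0.
  have df : differentiable (fun s : R^o => f (geoE q (nu q) s) : R^o) (0 : R^o) by exact: ex_diff.
  have := diff_eps df c0.
  apply: (@filterS _ (nbhs (0 : R))) => s.
  rewrite add0r geoE0 (is_diffE s D2) ((fE q Wq).1 Nq) subr0 => Hs s0.
  move: Hs; rewrite ler_norml => /andP[Hs _]; move: Hs.
  rewrite (gtr0_norm s0) /GRing.scale /=.
  have : 0 < s * 'd f q (nu q) by rewrite mulr_gt0.
  rewrite [_ / 2 * s]mulrC mulrA.
  by move: (s * _) (f _) => X Y; lra.
have cE := is_derive_cont D.
have nW : \forall s \near (0 : R), W (geoE q (nu q) s).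
  by apply: (cE _ (open_nbhs_nbhs (conj oW _))); rewrite geoE0.
have nS : \forall s \near (0 : R), H (geoE q (nu q) s) -> U (geoE q (nu q) s) -> f (geoE q (nu q) s) < 0.
  by apply: (cE (fun x => H x -> U x -> f x < 0)); rewrite geoE0.
have /nbhs_ballP [e e0 He] : nbhs (0 : R) (fun s => ((0 < s -> 0 < f (geoE q (nu q) s)) /\ W (geoE q (nu q) s)) /\
    (H (geoE q (nu q) s) -> U (geoE q (nu q) s) -> f (geoE q (nu q) s) < 0)).
  by apply: filterI => //; exact: filterI.
exists e => // s /andP[s0 se].
have /He [[fs Ws] Ss] : ball 0 e s by rewrite /ball /= sub0r normrN gtr0_norm.
rewrite geodE //.
have fs0 := fs s0; split.
- apply: (bl_move hyp Hq); last exact: geoE_in.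
  by apply: cspan_cs; have [_ _ + _] := hyp; apply.
- by move=> Ns; move: fs0; rewrite ((fE _ Ws).1 Ns) ltxx.
move=> Us; move: fs0; rewrite ltNge ltW //; apply: Ss => //.
apply: (bl_move hyp Hq); last exact: geoE_in.
by apply: cspan_cs; have [_ _ + _] := hyp; apply.
Qed.

End Given.
End Side.

(** * The linear estimate behind implicit differentiation *)

Section Implicit.
Variable R : realType.
Notation V := 'rV[R]_(2 + 2).

Lemma is_derive_eps (W : normedModType R) (c : R -> W) (t : R) (v : W) :
  (forall e : R, 0 < e -> \forall h \near (0 : R), `|c (t + h) - c t - h *: v| <= e * `|h|) ->
  is_derive t 1 c v.
Proof.
move=> H; apply/is_diff_derive.
have lin : linear (fun h : R^o => h *: v : W).
  by move=> k x y; rewrite scalerDl scalerA.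
pose L : {linear R^o -> W} := HB.pack (fun h : R^o => h *: v : W) (GRing.isLinear.Build R R^o W *:%R _ lin).
apply: (@eps_is_diff _ _ _ (c : R^o -> W) L (t : R^o)) => [x|e e0]; last exact: H.
apply: (@cvgZr_tmp _ _ _ _ _ id x v); exact: cvg_id.
Qed.

(** The triangular system A h1 = 0, E h1 + D h2 + m d = 0, solved with errors small relative to all
    increments. Here [d] will be the increment of the parameter, [h1] and [h2] those of the curve
    along the normal and the tangent. *)
Lemma implicit_real (A E D m e : R) : A != 0 -> D != 0 -> 0 < e ->
  exists2 s : R, 0 < s & forall h1 h2 d : R,
    `|A * h1| <= s * (`|h1| + `|h2|) ->
    `|E * h1 + D * h2 + m * d| <= s * (`|h1| + `|h2| + `|d|) ->
    `|h1| <= e * `|d| /\ `|h2 + m / D * d| <= e * `|d|.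
Proof.
move=> A0 D0 e0.
have a0 : 0 < `|A| by rewrite normr_gt0.
have d0 : 0 < `|D| by rewrite normr_gt0.
(* The a priori bound |h2| <= L |d|, which results once the error terms are absorbed into half of
   |D| |h2|. *)
pose L := 2 / `|D| * (`|m| + 1).
have L0 : 0 < L by rewrite mulr_gt0 ?divr_gt0 // ltr_wpDl.
have LE : L = 2 / `|D| * (`|m| + 1) by [].
clearbody L.
have E0 : 0 <= `|E| by [].
have EL : 0 <= (`|E| + 2) * (L + 1) by apply: mulr_ge0; lra.
pose K := (`|E| + 2) * (L + 1) + 1 + L.
have K0 : 0 < K by rewrite /K; lra.
have KE : K = (`|E| + 2) * (L + 1) + 1 + L by [].
clearbody K.
pose r := Num.min 1 (Num.min (`|D| / 2 / K) (Num.min (`|D| * e / K) (e / K))).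
have r0 : 0 < r by rewrite !lt_min ltr01 !divr_gt0 ?mulr_gt0.
have r1 : r <= 1 by rewrite ge_min lexx.
have r2 : r * K <= `|D| / 2 by rewrite -ler_pdivlMr // !ge_min lexx !orbT.
have r3 : r * K <= `|D| * e by rewrite -ler_pdivlMr // !ge_min lexx !orbT.
have r4 : r * K <= e by rewrite -ler_pdivlMr // !ge_min lexx !orbT.
exists (Num.min r (r * `|A| / 2)); first by rewrite lt_min r0 divr_gt0 // mulr_gt0.
move=> h1 h2 d H1 H2.
have n1 := normr_ge0 h1; have n2 := normr_ge0 h2; have n3 := normr_ge0 d.
have {}H1 : `|h1| <= r * `|h2|.
  have : `|A * h1| <= r * `|A| / 2 * (`|h1| + `|h2|).
    by apply: le_trans H1 _; rewrite ler_wpM2r ?addr_ge0 // ge_min lexx orbT.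
  rewrite normrM (_ : r * `|A| / 2 * _ = `|A| * (r / 2 * (`|h1| + `|h2|))); last by ring.
  rewrite ler_pM2l // => h.
  by clear -h n1 n2 r0 r1; move: (`|h1|) (`|h2|) h n1 n2 => x y; nra.
have {}H2 : `|E * h1 + D * h2 + m * d| <= r * (`|h1| + `|h2| + `|d|).
  by apply: le_trans H2 _; rewrite ler_wpM2r ?addr_ge0 // ge_min lexx.
have H3 : `|D * h2 + m * d| <= r * (`|E| + 2) * `|h2| + r * `|d|.
  have : `|D * h2 + m * d| <= `|E * h1 + D * h2 + m * d| + `|E * h1|.
    rewrite (_ : D * h2 + m * d = (E * h1 + D * h2 + m * d) - E * h1); last by ring.
    exact: ler_normB.
  rewrite [`|E * h1|]normrM => h.
  have h' : `|E| * `|h1| <= `|E| * (r * `|h2|) by rewrite ler_wpM2l.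
  have h4 : r * `|h1| <= r * `|h2|.
    by rewrite ler_pM2l // (le_trans H1) // ler_piMl.
  clear -H2 h h' h4; move: (`|h1|) (`|h2|) (`|d|) (`|E|) (`|D * h2 + _|) (`|_ + _|) H2 h h' h4 => x y z w X Y.
  by lra.
have rK : r * (`|E| + 2) <= `|D| / 2.
  apply: le_trans r2; rewrite ler_pM2l // KE.
  have : 0 <= (`|E| + 2) * L by apply: mulr_ge0; lra.
  lra.
have H4 : `|h2| <= L * `|d|.
  have t1 : `|D| * `|h2| <= `|D * h2 + m * d| + `|m| * `|d|.
    by rewrite -!normrM; apply: le_trans (ler_normB _ _); rewrite addrK.
  have t2 : r * (`|E| + 2) * `|h2| <= `|D| / 2 * `|h2| by rewrite ler_wpM2r.
  have t3 : r * `|d| <= `|d| by rewrite ler_piMl.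
  have t4 : `|D| / 2 * `|h2| <= (`|m| + 1) * `|d|.
    move: t1 t2 t3 H3; move: (r * (`|E| + 2) * `|h2|) (r * `|d|) (`|D * h2 + _|) => x y z.
    by move: (`|h2|) (`|d|) (`|D|) (`|m|) => w X Y Z; lra.
  have -> : L * `|d| = 2 / `|D| * ((`|m| + 1) * `|d|) by rewrite LE; ring.
  rewrite -ler_pdivrMl ?divr_gt0 // invf_div //.
have R1 : `|h1| <= r * L * `|d|.
  by apply: le_trans H1 _; rewrite -mulrA ler_pM2l.
have rL : r * L <= r * K.
  by rewrite ler_pM2l // KE; lra.
split.
  by apply: le_trans R1 _; rewrite ler_wpM2r // (le_trans rL).
have -> : h2 + m / D * d = (D * h2 + m * d) / D by field.
rewrite normrM normfV ler_pdivrMr // mulrAC [e * _]mulrC.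
apply: le_trans H3 _; apply: (@le_trans _ _ (r * K * `|d|)); last by rewrite ler_wpM2r.
have h5 : r * (`|E| + 2) * `|h2| <= r * (`|E| + 2) * (L * `|d|).
  by rewrite ler_wpM2l // mulr_ge0 //; exact: ltW.
apply: (@le_trans _ _ (r * (`|E| + 2) * (L * `|d|) + r * `|d|)); first by rewrite lerD2r.
rewrite (_ : _ + _ = r * ((`|E| + 2) * L + 1) * `|d|); last by ring.
rewrite ler_wpM2r // ler_pM2l // KE mulrDr mulr1.
have : 0 <= `|E| + 2 by lra.
lra.
Qed.

End Implicit.

(** * Curvature of the intersection, and the curve of tangency points *)

Section Curve.
Variable R : realType.
Notation V := 'rV[R]_(2 + 2).

Lemma is_diff_fst (U W : normedModType R) (e : U * W) : is_diff e (fun e : U * W => e.1) (fun e : U * W => e.1).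
Proof.
have lin : linear (fun e : U * W => e.1) by [].
pose L : {linear (U * W)%type -> U} := HB.pack (fun e : U * W => e.1) (GRing.isLinear.Build R (U * W)%type U *:%R _ lin).
have cL : continuous L by move=> x; exact: cvg_fst.
by apply: DiffDef; [exact: (linear_differentiable (f := L))|exact: (diff_lin (f := L) e cL)].
Qed.

Lemma is_diff_snd (U W : normedModType R) (e : U * W) : is_diff e (fun e : U * W => e.2) (fun e : U * W => e.2).
Proof.
have lin : linear (fun e : U * W => e.2) by [].
pose L : {linear (U * W)%type -> W} := HB.pack (fun e : U * W => e.2) (GRing.isLinear.Build R (U * W)%type W *:%R _ lin).
have cL : continuous L by move=> x; exact: cvg_snd.
by apply: DiffDef; [exact: (linear_differentiable (f := L))|exact: (diff_lin (f := L) e cL)].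
Qed.

Lemma Ck_cos_sin k : Ck k setT (fun x : R^o => cos (x : R) : R^o) /\ Ck k setT (fun x : R^o => sin (x : R) : R^o).
Proof.
have oT := @openT R^o.
elim: k => [|k [IHc IHs]].
  split=> x _; first exact: (is_derive_cont (is_derive_cos x)).
  exact: (is_derive_cont (is_derive_sin x)).
split.
  apply: (CkS (df := fun (x h : R^o) => h *: (- sin (x : R)) : R^o)) => // [x _|v].
    by apply/is_diff_derive; apply: is_derive_cos.
  by apply: Ck_scale => //; [exact: Ck_cst|exact: Ck_opp].
apply: (CkS (df := fun (x h : R^o) => h *: cos (x : R) : R^o)) => // [x _|v].
  by apply/is_diff_derive; apply: is_derive_sin.
by apply: Ck_scale => //; exact: Ck_cst.
Qed.

Lemma Ck_gdirD (U : normedModType R) k (A : set U) (X Z Y dX dZ dY : U -> V) : open A ->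
  Ck k A X -> Ck k A Z -> Ck k A Y -> Ck k A dX -> Ck k A dZ -> Ck k A dY ->
  Ck k A (fun e => gdirD (X e) (Z e) (Y e) (dX e) (dZ e) (dY e)).
Proof. by move=> oA HX HZ HY HX' HZ' HY'; rewrite /gdirD; ck. Qed.

Implicit Types (p q u v w x y z : V) (N : set V).

Section Given.
Variables (H : set V) (a b : V) (N : set V) (nu B : V -> V).
Hypothesis hyp : billiard_line H a b N nu B.
Let ab : dot a b = 0. Proof. by case: hyp => -[]. Qed.
Let aJb : dot a (J b) = 0. Proof. by case: hyp => -[]. Qed.
Let bb : dot b b = 1 - dot a a. Proof. by case: hyp => -[]. Qed.
Let ha : CH2 a. Proof. by case: hyp => -[]. Qed.
Let P0 : 0 < 1 - dot a a. Proof. exact: CH2_gt0. Qed.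
Let b0 : b != 0. Proof. by rewrite -dot_eq0 bb gt_eqF. Qed.
Let hN : submanifold 1 N. Proof. by case: hyp => _ []. Qed.
Let hnu : inward_normal N nu. Proof. by case: hyp => _ []. Qed.
Let Hnu q : N q -> H q -> cspan b (nu q). Proof. by case: hyp => _ _ + _; apply. Qed.
Let NC q : N q -> CH2 q. Proof. exact: nu_sub_CH2. Qed.

(* The covariant derivative of the normal along the tangent of N `&` H: its
   normal component vanishes since nu is a unit field, and the one normal to H
   since nu is tangent to H along H. *)
Lemma line_curvature q W (f : V -> R) xi : N q -> H q -> normal_chart N nu q W f xi ->
  exists2 k : R, 0 < k &
    'd xi q (J (nu q)) = - (k *: J (nu q)) - christoffel q (J (nu q)) (nu q).
Proof.
move=> Nq Hq Hch.
have [[oW Wq WC sf fE] [sxi xiE dpos nu1 dE] Hsh] := Hch.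
have hq := NC Nq; have hu := flow_unit hN hnu Nq; have hn := nu_unit hN hnu Nq.
have dxi : is_diff q xi ('d xi q) := CkS_diff (sxi 1%N) Wq.
set u := J (nu q); set n := nu q in u *.
have bn : cspan b n by apply: Hnu.
have bu : cspan b u by apply: cspanJ.
have in_span : cspan b ('d xi q u).
  move: (CkS_diff (sxi 1%N) Wq) => dxi'.
  set d := 'd xi q u.
  pose w := d - cproj b d.
  have w1 : dot w b = 0 by apply: cproj_orth.
  have w2 : dot w (J b) = 0 by apply: cproj_orthJ.
  (* Restricting [zeros_kill] to the affine line of [H] is essential: only at points of [N] in [H]
     is the normal known to be tangent to [H]. *)
  pose D := [set z | cspan b (z - q)].
  pose g z := dot (xi z) w.
  have dg := is_diff_dot dxi (is_diff_cst w q).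
  have gE : 'd g q u = dot d w.
    by apply: (etrans (is_diffE u dg)); rewrite dot0r addr0.
  have E : 'd g q u = 0.
    apply: (@zeros_kill _ f g D q _ n) => //.
    - by apply/(fE q Wq).
    - exact: (Ck_near_diff oW Wq (sf 1%N)).
    - by rewrite (dE _ _ Nq Wq) metricuJ mulr0.
    - by have := dpos q Wq; rewrite xiE.
    - by rewrite /D /= subrr; exists 0, 0; rewrite cs00.
    - move=> t r; rewrite /D /= addrC addKr; apply: cspanZ; apply: cspanD => //; exact: cspanZ.
    apply: (@filterS _ (nbhs q) _ W); last exact: open_nbhs_nbhs.
    move=> z Wz Dz fz; have Nz : N z by apply/(fE z Wz).
    have Hz : H z.
      by have := bl_move hyp Hq Dz; rewrite addrC subrK; apply; exact: NC.
    rewrite /g xiE //; have [x [y ->]] := Hnu Nz Hz.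
    by rewrite /cs dotDl !dotZl dotC w1 (dotC (J b)) w2 !mulr0 addr0.
  have ww : dot w w = 0.
    have dw : dot d w = 0 by rewrite -gE.
    rewrite {1}/w dotDl dotNl dw.
    have [x [y ->]] := cproj_span b d.
    by rewrite /cs dotDl !dotZl dotC w1 (dotC (J b)) w2 !mulr0 addr0 subrr.
  have w0 : w = 0 by apply/eqP; rewrite -dot_eq0 ww.
  have -> : d = cproj b d by apply/eqP; rewrite -subr_eq0; apply/eqP.
  exact: cproj_span.
have in_span2 : cspan b (nabla xi q u).
  apply: cspanD => //; apply: cspanZ; rewrite xiE //.
  by do !apply: cspanD; apply: cspanZ => //; apply: cspanJ.
have orth : metric q (nabla xi q u) n = 0.
  pose g z := metric z (xi z) (xi z) - 1.
  have sg : Ck 1 W g.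
    have s0 := sxi 1%N; apply: Ck_add => //; last by ck.
    exact: (@Ck_metric R _ 1 W (fun z => z) xi xi oW WC (Ck_id 1 oW) s0 s0).
  have g0 z : W z -> N z -> g z = 0.
    by move=> Wz Nz; rewrite /g xiE // nu1 // subrr.
  have E := zeros_first u Hch oW sg g0 Nq Wq Wq.
  have E1 : metric q (nu q) u = 0 by rewrite metricuJ.
  have {E1}E : 'd g q u = 0 := etrans E (etrans (congr1 _ E1) (mulr0 _)).
  have D : is_derive (0 : R) 1 (fun t : R => q + t *: u) u.
    have H' := is_derive_add (is_derive_const q (0 : R))
      (is_derive_scale (is_derive_id (0 : R) 1) (is_derive_const u (0 : R))).
    by apply: (is_derive_eq H'); rewrite scaler0 scale1r !add0r.
  have q0 : q + (0 : R) *: u = q by rewrite scale0r addr0.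
  have D1 : is_derive (0 : R) 1 (fun t : R => g (q + t *: u)) ('d g q u).
    by apply: is_derive_diff_comp D; rewrite q0; apply: CkS_diff sg Wq.
  have D2 : is_derive (0 : R) 1 (fun t : R => xi (q + t *: u)) ('d xi q u).
    by apply: is_derive_diff_comp D; rewrite q0.
  have := @metric_curve _ _ _ _ 0 _ _ _ _ D D2 D2.
  rewrite q0 => /(_ hq) D3.
  have D4 := is_derive_add D3 (is_derive_const (- 1 : R) (0 : R)).
  have := is_derive_uniq D1 D4; rewrite E addr0.
  have -> : metric q ('d xi q u + christoffel q u (xi q)) (xi q) = metric q (nabla xi q u) n.
    by rewrite /nabla xiE.
  rewrite (metricC q (xi q)).
  have -> : metric q ('d xi q u + christoffel q u (xi q)) (xi q) = metric q (nabla xi q u) n.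
    by rewrite /nabla xiE.
  by move: (metric _ _ _) => X; lra.
have [e1 [e2 E]] : cspan n (nabla xi q u).
  exact: (bl_nu_span hyp Nq Hq).2 _ in_span2.
have e10 : e1 = 0.
  move: orth; rewrite E /cs metricDl !metricZl hn mulr1 metricJl metricuJ oppr0 mulr0 addr0.
  by [].
have k0 := Hsh u (metricuJ _ _) (unit_neq0 hu).
exists (- e2).
  move: k0; rewrite metricNl E e10 /cs scale0r add0r metricZl hu mulr1.
  by [].
move: E; rewrite e10 /cs scale0r add0r /nabla xiE // -/n -/u => E.
by rewrite scaleNr opprK -E addrK.
Qed.

Variable rad : R.
Hypotheses (rad0 : 0 < rad) (rad1 : rad < 1).
(** By [circ_norm], the left side is 1 - |x|^2 on the circle; so [N] meets [H] strictly inside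
    it. *)
Hypothesis Hrad : forall q, N q -> H q -> (1 - dot a a) * (1 - rad ^+ 2) < 1 - dot q q.

Definition circ (t : R) : V := a + cs (rad * cos t) (rad * sin t) b.

Lemma circ_derive (t : R) : is_derive t 1 circ (J (circ t - a)).
Proof.
have X : circ t - a = cs (rad * cos t) (rad * sin t) b by rewrite /circ addrC addKr.
have D1 := is_derive_mul (is_derive_const rad t) (is_derive_cos t).
have D2 := is_derive_mul (is_derive_const rad t) (is_derive_sin t).
have D := is_derive_add (is_derive_const a t) (is_derive_add (is_derive_scale D1 (is_derive_const b t))
  (is_derive_scale D2 (is_derive_const (J b) t))).
apply: (is_derive_eq D); rewrite X csJ !scaler0 !add0r !mul0r !add0r /cs.
by rewrite mulrN.
Qed.

Lemma circ_in t : H (circ t).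
Proof.
case: hyp => -[_ _ _ _ [Heq _]] _ _ _; apply/Heq; exists (rad * cos t), (rad * sin t); split=> //.
rewrite !exprMn -mulrDr cos2Dsin2 mulr1 expr_lt1 //; exact: ltW.
Qed.

Lemma circ_norm t : 1 - dot (circ t) (circ t) = (1 - dot a a) * (1 - rad ^+ 2).
Proof. by rewrite (bl_norm hyp) !exprMn -mulrDr cos2Dsin2 mulr1. Qed.

(** In the coordinates with respect to [b], and up to the factor [dot b b] squared, two vanishing
    conditions are those of [planar_transversal], which would make the unit vector [nu q] zero. *)
Lemma circ_transversal q t : N q -> H q -> gdir (circ t) q (nu q) = 0 ->
  gdirD (circ t) q (nu q) (J (circ t - a)) 0 0 != 0.
Proof.
move=> Nq Hq G; apply/eqP => G'.
have [_ [q1 [q2 qE]]] := (bl_HP hyp q).1 Hq.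
have [n1 [n2 nE]] := Hnu Nq Hq.
have qE' : q = a + cs q1 q2 b by rewrite -qE addrC subrK.
set x1 := rad * cos t; set x2 := rad * sin t.
have xE : x1 ^+ 2 + x2 ^+ 2 = rad ^+ 2 by rewrite !exprMn -mulrDr cos2Dsin2 mulr1.
have h1 : q1 ^+ 2 + q2 ^+ 2 < x1 ^+ 2 + x2 ^+ 2.
  have := Hrad Nq Hq; rewrite {1}qE' {1}qE' (bl_norm hyp) ltr_pM2l // xE; lra.
have h2 : x1 ^+ 2 + x2 ^+ 2 < 1 by rewrite xE expr_lt1 // ltW.
have be : dot b b != 0 by rewrite dot_eq0.
have X1 : circ t - a = cs x1 x2 b by rewrite /circ addrC addKr.
have X2 : circ t - q = cs (x1 - q1) (x2 - q2) b.
  by rewrite -csD -csN -qE -X1 opprB addrA subrK.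
have Q2 : 1 - dot q q = dot b b * (1 - (q1 ^+ 2 + q2 ^+ 2)) by rewrite qE' (bl_norm hyp) bb.
have aC (x y : R) : dot a (cs x y b) = 0 by rewrite /cs dotDr !dotZr ab aJb !mulr0 addr0.
have dcs (x y x' y' : R) : dot (cs x y b) (cs x' y' b) = dot b b * (x * x' + y * y').
  by rewrite /cs !dotE; ring.
have Qn : dot q (nu q) = dot b b * (q1 * n1 + q2 * n2) by rewrite nE {1}qE' dotDl aC add0r dcs.
have [||n10 n20] := planar_transversal (x1 := x1) (x2 := x2) (q1 := q1) (q2 := q2) (n1 := n1) (n2 := n2) h1 h2.
- apply: (mulfI be); apply: (mulfI be); rewrite !mulr0 -G /gdir X2 Q2 Qn nE !dcs; ring.
- apply: (mulfI be); apply: (mulfI be); rewrite !mulr0 -G' /gdirD X2 Q2 Qn X1 csJ nE !dot0r !dot0l subr0 !dcs; ring.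
have := unit_neq0 (nu_unit hN hnu Nq).
by rewrite nE n10 n20 cs00 eqxx.
Qed.

Variable c : R -> V.
Hypothesis Hc : forall t, [/\ N (c t), H (c t) & exists2 s : R, 0 < s & circ t = tangent_flow nu (c t, s)].

Lemma tangency_curve_cont t : {for t, continuous c}.
Proof.
have [Nq Hq [s s0 E]] := Hc t.
move=> O nO; have := tangency_cont_ext hyp Nq Hq s0 nO; rewrite -E => T.
have := is_derive_cont (circ_derive t) T.
apply: (@filterS _ (nbhs t)) => t'; have [Nq' Hq' [s' s0' E']] := Hc t'.
by apply; eauto.
Qed.

End Given.
End Curve.

(** * Smoothness and curvature of the curve of tangency points *)

Section CurveSmooth.
Variable R : realType.
Notation V := 'rV[R]_(2 + 2).
Implicit Types (p q u v w x y z : V) (N : set V).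

Section Given.
Variables (H : set V) (a b : V) (N : set V) (nu B : V -> V).
Hypothesis hyp : billiard_line H a b N nu B.
Let hN : submanifold 1 N. Proof. by case: hyp => _ []. Qed.
Let hnu : inward_normal N nu. Proof. by case: hyp => _ []. Qed.
Let Hnu q : N q -> H q -> cspan b (nu q). Proof. by case: hyp => _ _ + _; apply. Qed.
Let NC q : N q -> CH2 q. Proof. exact: nu_sub_CH2. Qed.
Variable rad : R.
Hypotheses (rad0 : 0 < rad) (rad1 : rad < 1).
Hypothesis Hrad : forall q, N q -> H q -> (1 - dot a a) * (1 - rad ^+ 2) < 1 - dot q q.
Notation circ := (circ a b rad).
Variable c : R -> V.
Hypothesis Hc : forall t, [/\ N (c t), H (c t) & exists2 s : R, 0 < s & circ t = tangent_flow nu (c t, s)].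
Let Nc t : N (c t). Proof. by case: (Hc t). Qed.
Let Hct t : H (c t). Proof. by case: (Hc t). Qed.
Let c_cont t : {for t, continuous c}. Proof. exact: (tangency_curve_cont hyp Hc). Qed.
Let G0 t : gdir (circ t) (c t) (nu (c t)) = 0.
Proof. by have [Nq _ [s s0 ->]] := Hc t; case: (flow_tangent hyp Nq s0). Qed.
Let G1 t : 0 < gdir (circ t) (c t) (J (nu (c t))).
Proof. by have [Nq _ [s s0 ->]] := Hc t; case: (flow_tangent hyp Nq s0). Qed.

Section Chart.
Variables (q0 : V) (W : set V) (f : V -> R) (xi : V -> V).
Hypothesis Hch : normal_chart N nu q0 W f xi.
Let oW : open W. Proof. by case: Hch => -[]. Qed.
Let sf k : Ck k W f. Proof. by case: Hch => -[]. Qed.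
Let sxi k : Ck k W xi. Proof. by case: Hch => _ []. Qed.
Let fE z : W z -> (N z <-> f z = 0). Proof. by case: Hch => -[_ _ _ _ +] _ _; apply. Qed.
Let xiE z : N z -> W z -> xi z = nu z. Proof. by case: Hch => _ [_ + _ _ _] _; apply. Qed.
Let dpos z : W z -> 0 < 'd f z (xi z). Proof. by case: Hch => _ [_ _ + _ _] _; apply. Qed.
Let dE z y : N z -> W z -> 'd f z y = 'd f z (nu z) * metric z (nu z) y.
Proof. by case: Hch => _ [_ _ _ _ +] _; apply. Qed.

(* Derivatives of the function gdir (circ t) q (xi q) of (q, t), which vanishes at
   q = c t, with respect to t and in the direction of N `&` H with respect to q. *)
Definition mm (t : R) : R := gdirD (circ t) (c t) (xi (c t)) (J (circ t - a)) 0 0.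
Definition dd (t : R) : R :=
  gdirD (circ t) (c t) (xi (c t)) 0 (J (xi (c t))) ('d xi (c t) (J (xi (c t)))).

(** In the real basis [n], [u] of the directions of [H], the equation of [N] controls the normal
    increment of the curve and [g] the tangential one; [implicit_real] combines the two. *)
Lemma curve_derive t : W (c t) -> dd t != 0 ->
  is_derive t 1 c (- (mm t / dd t) *: J (xi (c t))).
Proof.
move=> Wq d0; set q := c t; set n := xi q; set u := J n.
have Nq : N q := Nc t.
have Hq : H q := Hct t.
have nE : n = nu q by apply: xiE.
have dxi : is_diff q xi ('d xi q) := CkS_diff (sxi 1%N) Wq.
pose e0 : V * R^o := (q, (t : R^o)).
pose g (e : V * R^o) : R := gdir (circ e.2) e.1 (xi e.1).
have D1 : is_diff e0 (fun e : V * R^o => circ e.2) (fun e => e.2 *: J (circ t - a)).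
  exact: (is_diff_comp (is_diff_snd e0) ((is_diff_derive _ _ _).2 (circ_derive a b rad t))).
have D2 : is_diff e0 (fun e : V * R^o => xi e.1) (fun e => 'd xi q e.1).
  exact: (is_diff_comp (is_diff_fst e0) dxi).
have Dg := is_diff_gdir D1 (is_diff_fst e0) D2.
have Dgv (v : V) (s : R) := is_diffE ((v, s) : V * R^o) Dg.
have ED : 'd g e0 (u, (0 : R^o)) = dd t.
  by apply: (etrans (Dgv u 0)); rewrite /= scale0r.
have Em : 'd g e0 (0, (1 : R^o)) = mm t.
  by apply: (etrans (Dgv 0 1)); rewrite /= scale1r linear0.
pose E := 'd g e0 (n, (0 : R^o)).
have Elin (h1 h2 s : R) : 'd g e0 (h1 *: n + h2 *: u, (s : R^o)) = E * h1 + dd t * h2 + mm t * s.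
  have -> : (h1 *: n + h2 *: u, (s : R^o)) = h1 *: (n, (0 : R^o)) + (h2 *: (u, (0 : R^o)) + s *: ((0 : V), (1 : R^o))).
    by congr (_, _); rewrite /= ?scaler0 ?addr0 ?add0r // /GRing.scale /= ?mulr0 ?mulr1 ?add0r.
  apply: (etrans (linearD _ _ _)); rewrite -addrA; congr (_ + _).
    by apply: (etrans (diffZv _ _ _ _)); rewrite mulrC.
  apply: (etrans (linearD _ _ _)); congr (_ + _).
    by apply: (etrans (diffZv _ _ _ _)); rewrite ED mulrC.
  by apply: (etrans (diffZv _ _ _ _)); rewrite Em mulrC.
have A0 : 'd f q n != 0 by rewrite gt_eqF // dpos.
have Flin (h1 h2 : R) : 'd f q (h1 *: n + h2 *: u) = 'd f q n * h1.
  rewrite (dE _ Nq Wq) nE metricDr !metricZr /u nE metricuJ mulr0 addr0 (nu_unit hN hnu Nq) mulr1.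
  by [].
(* Converts between the norm of a vector and its coordinates in the basis [n], [u]. *)
pose K := `|n| + `|u| + 1.
have K1 : 1 <= K by rewrite lerDr addr_ge0.
have K0 : 0 < K by apply: lt_le_trans K1.
apply: is_derive_eps => e e0'.
have eK : 0 < e / K by rewrite divr_gt0.
have [s s0 Himp] := implicit_real E (mm t) A0 d0 eK.
have sK : 0 < s / K by rewrite divr_gt0.
have cq : c (t + h) - q @[h --> (0 : R)] --> (0 : V).
  rewrite -[X in _ --> X](subrr q); apply: cvgB; last exact: cvg_cst.
  have c1 : t + h @[h --> (0 : R)] --> t.
    by rewrite -[X in _ --> X]addr0; apply: cvgD; [exact: cvg_cst|exact: cvg_id].
  exact: (cvg_comp _ _ c1 (@c_cont t)).
have dfq : differentiable f q by have := CkS_diff (sf 1%N) Wq => /(@ex_diff _ _ _ _ _ _).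
have N1 : \forall h \near (0 : R), `|f (q + (c (t + h) - q)) - f q - 'd f q (c (t + h) - q)| <=
    s / K * `|c (t + h) - q|.
  exact: (cq _ (diff_eps dfq sK)).
have cp : (c (t + h) - q, (h : R^o)) @[h --> (0 : R)] --> (0 : V * R^o).
  exact: (cvg_pair cq cvg_id).
have dg : differentiable g e0 := @ex_diff _ _ _ _ _ _ _ Dg.
have N2 : \forall h \near (0 : R), `|g (e0 + (c (t + h) - q, (h : R^o))) - g e0 -
    'd g e0 (c (t + h) - q, (h : R^o))| <= s / K * `|(c (t + h) - q, (h : R^o))|.
  exact: (cp _ (diff_eps dg sK)).
have N3 : \forall h \near (0 : R), W (c (t + h)).
  have cW : c (t + h) @[h --> (0 : R)] --> q.
    have c1 : t + h @[h --> (0 : R)] --> t.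
      by rewrite -[X in _ --> X]addr0; apply: cvgD; [exact: cvg_cst|exact: cvg_id].
    exact: (cvg_comp _ _ c1 (@c_cont t)).
  exact: (cW _ (open_nbhs_nbhs (conj oW Wq))).
have gz h : W (c (t + h)) -> g (e0 + (c (t + h) - q, (h : R^o))) = 0.
  by move=> Wh; rewrite /g /= (addrC q) subrK xiE // G0.
have N4 : nbhs (0 : R) (fun h => (`|f (q + (c (t + h) - q)) - f q - 'd f q (c (t + h) - q)| <=
    s / K * `|c (t + h) - q| /\ `|g (e0 + (c (t + h) - q, (h : R^o))) - g e0 -
    'd g e0 (c (t + h) - q, (h : R^o))| <= s / K * `|(c (t + h) - q, (h : R^o))|) /\ W (c (t + h))).
  by apply: filterI => //; exact: filterI.
apply: (filterS _ N4) => h [[H1 H2] Wh].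
have [h1 [h2 hE]] : cspan n (c (t + h) - q).
  by rewrite nE; apply: (bl_nu_span hyp Nq Hq).2; apply: (bl_diff hyp).
have g00 : g e0 = 0 by rewrite /g /= -/n nE G0.
move: H1 H2; rewrite (gz h Wh) g00 subrr sub0r normrN [q + _]addrC subrK.
rewrite ((fE Wh).1 (Nc _)) ((fE Wq).1 Nq) subrr sub0r normrN.
rewrite hE /cs Flin Elin => H1 H2.
have Kh : `|h1 *: n + h2 *: u| <= K * (`|h1| + `|h2|).
  apply: le_trans (ler_normD _ _) _; rewrite !normrZ mulrDr.
  have Kn : `|n| <= K by rewrite /K -addrA lerDl addr_ge0.
  have Ku : `|u| <= K by rewrite /K addrAC lerDr addr_ge0.
  by apply: lerD; rewrite mulrC; apply: ler_wpM2r.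
have {}H1 : `|'d f q n * h1| <= s * (`|h1| + `|h2|).
  apply: le_trans H1 _; rewrite -mulrA ler_pM2l // ler_pdivrMl //; exact: Kh.
have {}H2 : `|E * h1 + dd t * h2 + mm t * h| <= s * (`|h1| + `|h2| + `|h|).
  apply: le_trans H2 _; rewrite -mulrA ler_pM2l // ler_pdivrMl //.
  rewrite [X in X <= _]prod_normE /= ge_max mulrDr; apply/andP; split.
    by apply: le_trans Kh _; rewrite lerDl mulr_ge0 // ltW.
  apply: (@le_trans _ _ (K * `|h|)); first by rewrite ler_peMl.
  by rewrite lerDr mulr_ge0 ?addr_ge0 // ltW.
have [R1 R2] := Himp h1 h2 h H1 H2.
have -> : h1 *: n + h2 *: J n - h *: (- (mm t / dd t) *: u) = h1 *: n + (h2 + mm t / dd t * h) *: u.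
  by rewrite scalerA mulrN scaleNr opprK -addrA -scalerDl [h * _]mulrC.
apply: le_trans (ler_normD _ _) _; rewrite !normrZ.
have -> : e * `|h| = e / K * `|h| * K by rewrite mulrAC divfK // gt_eqF.
apply: (@le_trans _ _ (e / K * `|h| * `|n| + e / K * `|h| * `|u|)).
  by apply: lerD; apply: ler_wpM2r.
have nK : `|n| + `|u| <= K by rewrite /K lerDl.
by rewrite -mulrDr ler_wpM2l // mulr_ge0 // ltW.
Qed.

Lemma mm_neq0 t : W (c t) -> mm t != 0.
Proof. by move=> Wt; rewrite /mm xiE //; apply: (circ_transversal hyp). Qed.

(** By [line_curvature] and [gdirD_shape], [dd t] is minus the curvature times a positive number.
    This is available at the centre of the chart; nearby, [dd] stays nonzero by continuity. *)
Lemma dd_center t : c t = q0 -> exists2 k : R, 0 < k &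
  'd xi (c t) (J (nu (c t))) = - (k *: J (nu (c t))) - christoffel (c t) (J (nu (c t))) (nu (c t)) /\
  dd t != 0.
Proof.
move=> E.
have Wq : W (c t) by rewrite E; case: Hch => -[].
have [||k k0 Ek] := line_curvature hyp _ _ Hch; rewrite -?E //.
exists k => //; split; rewrite -?E // in Ek *.
rewrite /dd xiE // Ek gdirD_shape ?G0 //; last 2 first.
- exact: NC.
- by apply: (bl_nu_span hyp (Nc t) (Hct t)).2; apply: (bl_diff hyp) => //; exact: (circ_in hyp).
by rewrite oppr_eq0 mulf_neq0 ?gt_eqF.
Qed.

Let O1 : set R^o := interior [set t : R^o | W (c t)].
Let O : set R^o := interior [set t : R^o | O1 t /\ dd t != 0].

Lemma Ck_circ k : Ck k (setT : set R^o) (circ : R^o -> V).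
Proof.
have oT := @openT R^o; have [h1 h2] := Ck_cos_sin R k.
by apply: Ck_add => //; [ck|apply: Ck_cs => //; [apply: Ck_mul|apply: Ck_mul|]; ck].
Qed.

Let oO1 : open O1. Proof. exact: open_interior. Qed.
Let oO : open O. Proof. exact: open_interior. Qed.
Let O1W t : O1 t -> W (c t). Proof. by move/interior_subset. Qed.
Let OO1 t : O t -> O1 t. Proof. by move/interior_subset => []. Qed.

Let Ck_parts k (A : set R^o) : open A -> A `<=` O1 -> Ck k A (c : R^o -> V) ->
  [/\ Ck k A (fun t : R^o => xi (c t)), Ck k A (mm : R^o -> R) & Ck k A (dd : R^o -> R)].
Proof.
move=> oA AO1 Hk.
have sx : Ck k A (fun t : R^o => xi (c t)).
  by apply: (@Ck_comp _ _ _ _ _ W) => // t /AO1 /O1W.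
have sc : Ck k A (circ : R^o -> V) by apply: Ck_sub (Ck_circ k).
have sd : Ck k A (fun t : R^o => 'd xi (c t) (J (xi (c t)))).
  apply: (@Ck_comp _ _ _ _ _ W _ (fun z => 'd xi z (J (xi z)))) => //; first by move=> t /AO1 /O1W.
  by apply: Ck_diffv => //; apply: Ck_J.
split=> //; apply: Ck_gdirD => //; ck.
Qed.

(** Bootstrapping: the derivative in [curve_derive] is a smooth expression in [c] and t, so each
    order of smoothness of [c] gives the next. *)
Lemma curve_smooth_chart t : c t = q0 -> exists2 O' : set R^o, open O' /\ O' t &
  (forall s, O' s -> W (c s) /\ dd s != 0) /\
    forall k, [/\ Ck k O' (c : R^o -> V), Ck k O' (mm : R^o -> R) & Ck k O' (dd : R^o -> R)].
Proof.
move=> E; exists O; first split => //.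
  have O1t : O1 t.
    have Wt : W (c t) by rewrite E; case: Hch => -[].
    exact: (@c_cont t _ (open_nbhs_nbhs (conj oW Wt))).
  have [_ _ [_ dt]] := dd_center E.
  have C0 : Ck 0 O1 (c : R^o -> V) by move=> s _; exact: c_cont.
  have [_ _ Cd] := Ck_parts oO1 (fun _ h => h) C0.
  have Cdt : dd s @[s --> t] --> dd t by exact: (Cd t O1t).
  have nd : \forall s \near t, dd s != 0 by exact: cvgr_neq0 Cdt dt.
  by apply: filterI => //; exact: (open_nbhs_nbhs (conj oO1 O1t)).
have OW s : O s -> W (c s) /\ dd s != 0 by move=> Os; split; [apply/O1W/OO1|have [] := interior_subset Os].
split=> // k; suff IH : Ck k O (c : R^o -> V) by have [] := Ck_parts oO (fun s => @OO1 s) IH.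
elim: k => [|k IH]; first by move=> s _; exact: c_cont.
have [sx sm sd] := Ck_parts oO (fun s => @OO1 s) IH.
apply: (CkS (df := fun (s h : R^o) => h *: (- (mm s / dd s) *: J (xi (c s))))) => // [s Os|v].
  by have [Ws ds] := OW s Os; apply/is_diff_derive; apply: curve_derive.
have si : Ck k O (fun s : R^o => (dd s)^-1) by apply: Ck_inv => // s /OW [].
apply: Ck_scale => //; first exact: Ck_cst.
apply: Ck_scale => //; last exact: Ck_J.
by apply: Ck_opp => //; apply: Ck_mul.
Qed.

End Chart.

Lemma curve_smooth : smooth_curve c.
Proof.
move=> k; apply: Ck_cover => t _.
have [W [f [xi Hch]]] := normal_chart_exists hN hnu (Nc t).
by have [A [oA At] [_ sA]] := curve_smooth_chart Hch (erefl (c t)); exists A => //; have [] := sA k.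
Qed.

(** [mu] is nonzero by transversality of the circle. In the covariant derivative of mu J nu the
    connection commutes with [J], and J (- k J nu) = k nu produces the normal component mu^2 k. *)
Lemma curve_regular (t : R) : exists mu (mu' k : R), [/\ mu != 0, 0 < k,
  is_derive t 1 c (mu *: J (nu (c t))) &
  cov_accel c t = mu' *: J (nu (c t)) + (mu ^+ 2 * k) *: nu (c t)].
Proof.
have [W [f [xi Hch]]] := normal_chart_exists hN hnu (Nc t).
have [k k0 [Ek d0]] := dd_center Hch (erefl (c t)).
have [A [oA At] [AW sA]] := curve_smooth_chart Hch (erefl (c t)).
have [[oW Wq _ _ _] [sxi xiE _ _ _] _] := Hch.
pose mu (s : R) := - (mm xi s / dd xi s).
have D (s : R) : A s -> is_derive s 1 c (mu s *: J (xi (c s))).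
  by move=> /AW [Ws ds]; apply: (curve_derive Hch).
have Dt := D t At.
have D1 : is_derive t 1 c (mu t *: J (nu (c t))) by move: Dt; rewrite xiE.
have dc : \forall s \near t, mu s *: J (xi (c s)) = derive1 c s.
  apply: (@filterS _ (nbhs t) _ A); last exact: open_nbhs_nbhs.
  by move=> s /D Ds; rewrite (is_derive1 Ds).
have [mu' Dmu] : exists mu', is_derive t 1 mu mu'.
  have s1 : Ck 1 A (mu : R^o -> R).
    have [_ sm sd] := sA 1%N.
    have dn (s : R^o) : A s -> dd xi s != 0 by move=> /AW [].
    exact: (Ck_opp oA (Ck_mul oA sm (Ck_inv oA dn sd))).
  exists ('d (mu : R^o -> R) t 1); have D2 := CkS_diff s1 At.
  apply/is_diff_derive; apply: is_diff_ext D2 _ _ => // h.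
  by rewrite -[in LHS](mulr1 h) -[h * 1]/(h *: (1 : R^o)) diffZv.
exists (mu t), mu', k; split=> //.
  by rewrite oppr_eq0 mulf_neq0 ?invr_neq0 // (mm_neq0 Hch).
have dxi : is_diff (c t) xi ('d xi (c t)) := CkS_diff (sxi 1%N) Wq.
have D3 := is_derive_J (is_derive_diff_comp dxi D1).
have D4 := is_derive_scale Dmu D3.
have D5 := near_eq_is_derive dc D4.
rewrite /cov_accel (is_derive1 D5) (is_derive1 D1).
have E1 : 'd xi (c t) (mu t *: J (nu (c t))) = mu t *: (- (k *: J (nu (c t))) - christoffel (c t) (J (nu (c t))) (nu (c t))).
  by apply: (etrans (diffZv _ _ _ _)); rewrite Ek.
rewrite E1 xiE // christoffelZl christoffelZr christoffelJ.
move: (christoffel _ _ _) => G.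
rewrite !(JZ, JD, JN) JJ scalerN opprK scalerBr !scalerA.
apply/rowP => i; rewrite !mxE; ring.
Qed.

End Given.
End CurveSmooth.

(** * The billiard in one complex line *)

Section CoreConclusion.
Variable R : realType.
Notation V := 'rV[R]_(2 + 2).
Implicit Types (p q u v w x y z : V) (N : set V).

Lemma polar (x y : R) : x ^+ 2 + y ^+ 2 = 1 -> exists t : R, x = cos t /\ y = sin t.
Proof.
move=> h; have x1 : -1 <= x <= 1 by have := sqr_ge0 y; move: h; clear; nra.
have c1 : cos (acos x) = x by rewrite acosK // in_itv.
have s1 : sin (acos x) ^+ 2 = y ^+ 2 by rewrite sin_acos // sqr_sqrtr -h; [ring|rewrite addrC addKr sqr_ge0].
have /eqP := s1; rewrite eqf_sqr => /orP[/eqP e|/eqP e].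
  by exists (acos x); rewrite c1 e.
by exists (- acos x); rewrite cosN sinN c1 e opprK.
Qed.

Lemma cos_sin_inj (s t : R) : 0 <= s < pi *+ 2 -> 0 <= t < pi *+ 2 ->
  cos s = cos t -> sin s = sin t -> s = t.
Proof.
wlog st : s t / s <= t.
  move=> W hs ht hc hsn; case: (leP s t) => h; first exact: W.
  by apply/esym; apply: W => //; exact: ltW.
move=> /andP[s0 s1] /andP[t0 t1] hc hs.
apply/eqP; rewrite eq_le st /= leNgt; apply/negP => lt.
pose d := (t - s) / 2.
have d1 : 0 < d < pi by rewrite /d; move: t1; rewrite mulr2n; lra.
have sd := sin_gt0_pi d1.
have : cos (d + d) = 1.
  have -> : d + d = t - s by rewrite /d; field.
  by rewrite cosB hc hs -!expr2 cos2Dsin2.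
rewrite cosD -!expr2 => h; have := cos2Dsin2 d.
have : 0 < sin d ^+ 2 by rewrite exprn_gt0.
lra.
Qed.

Section Given.
Variables (H : set V) (a b : V) (N : set V) (nu B : V -> V).
Hypothesis hyp : billiard_line H a b N nu B.
Let ab : dot a b = 0. Proof. by case: hyp => -[]. Qed.
Let aJb : dot a (J b) = 0. Proof. by case: hyp => -[]. Qed.
Let bb : dot b b = 1 - dot a a. Proof. by case: hyp => -[]. Qed.
Let ha : CH2 a. Proof. by case: hyp => -[]. Qed.
Let P0 : 0 < 1 - dot a a. Proof. exact: CH2_gt0. Qed.
Let b0 : b != 0. Proof. by rewrite -dot_eq0 bb gt_eqF. Qed.
Let HT q : H q -> forall w, tangent 2 H q w <-> cspan b w.
Proof. by case: hyp => -[_ _ _ _ [_ +]] _ _ _; apply. Qed.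
Let hN : submanifold 1 N. Proof. by case: hyp => _ []. Qed.
Let hnu : inward_normal N nu. Proof. by case: hyp => _ []. Qed.
Let hB : outer_billiard_map N nu B. Proof. by case: hyp => _ []. Qed.
Let Hnu q : N q -> H q -> cspan b (nu q). Proof. by case: hyp => _ _ + _; apply. Qed.
Let Hback q (t : R) : N q -> t != 0 -> H (tangent_flow nu (q, t)) -> H q.
Proof. by case: hyp => _ _ _; apply. Qed.
Let NC q : N q -> CH2 q. Proof. exact: nu_sub_CH2. Qed.
Notation U := (exterior N nu).

Let flow_norm q (t : R) : N q ->
  1 - dot (tangent_flow nu (q, t)) (tangent_flow nu (q, t)) = (1 - dot q q) / omd q (J (nu q)) t.
Proof. by move=> Nq; rewrite (flowE _ hN hnu Nq) geoE_norm ?(flow_unit hN hnu) //; exact: NC. Qed.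

Section Circle.
Variable rad : R.
Hypotheses (rad0 : 0 < rad) (rad1 : rad < 1).
Hypothesis Hrad : forall q, N q -> H q -> (1 - dot a a) * (1 - rad ^+ 2) < 1 - dot q q.
Notation circ := (circ a b rad).

Let E0 : 0 < (1 - dot a a) * (1 - rad ^+ 2).
Proof. by rewrite mulr_gt0 // subr_gt0 expr_lt1 // ltW. Qed.

Lemma flow_circ q : N q -> H q -> exists2 s : R, 0 < s & exists t, circ t = tangent_flow nu (q, s).
Proof.
move=> Nq Hq; have hq := NC Nq; have hu := flow_unit hN hnu Nq.
(* By [geoE_norm], [omd] takes this value exactly when the geodesic has the Euclidean norm of the
   circle. *)
have [|s s0 Es] := omd_exists hq hu (A := (1 - dot q q) / ((1 - dot a a) * (1 - rad ^+ 2))).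
  by rewrite ltr_pdivlMr // mul1r; exact: Hrad.
exists s => //.
have HF := bl_flow hyp s Nq Hq.
have [hF [x [y E]]] := (bl_HP hyp _).1 HF.
have FE : tangent_flow nu (q, s) = a + cs x y b by rewrite -E addrC subrK.
have xy : x ^+ 2 + y ^+ 2 = rad ^+ 2.
  have := flow_norm s Nq; rewrite Es invf_div mulrCA mulfV ?mulr1; last by rewrite gt_eqF ?CH2_gt0.
  rewrite FE (bl_norm hyp) => /(mulfI (lt0r_neq0 P0)); lra.
have rn : rad != 0 by rewrite gt_eqF.
have [|t [ex ey]] := @polar (x / rad) (y / rad).
  by rewrite !expr_div_n -mulrDl xy mulfV // expf_neq0.
by exists t; rewrite FE /circ -ex -ey !(mulrC rad) !divfK.
Qed.

Lemma circ_inj (s t : R) : 0 <= s < pi *+ 2 -> 0 <= t < pi *+ 2 -> circ s = circ t -> s = t.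
Proof.
move=> hs ht /addrI E; have rn : rad != 0 by rewrite gt_eqF.
have : cs (rad * cos s - rad * cos t) (rad * sin s - rad * sin t) b = 0.
  by rewrite -csD -csN E subrr.
move=> /(cs_inj b0) [/eqP + /eqP]; rewrite !subr_eq0 => /eqP /(mulfI rn) e1 /eqP /(mulfI rn) e2.
exact: cos_sin_inj.
Qed.

Variable c : R -> V.
Hypothesis Hc : forall t, [/\ N (c t), H (c t) & exists2 s : R, 0 < s & circ t = tangent_flow nu (c t, s)].

Lemma curve_unique (t s : R) q : N q -> 0 < s -> circ t = tangent_flow nu (q, s) -> q = c t.
Proof.
move=> Nq s0 E; have [Nc _ [s' s0' E']] := Hc t.
by move: E; rewrite E' => /esym /(flow_inj hyp Nq Nc s0 s0') [].
Qed.

Lemma curve_range : range c = N `&` H.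
Proof.
apply/seteqP; split=> [_ [t _ <-]|q [Nq Hq]]; first by have [] := Hc t.
have [s s0 [t E]] := flow_circ Nq Hq.
by exists t => //; rewrite -(curve_unique Nq s0 E).
Qed.

Lemma curve_period t : c (t + pi *+ 2) = c t.
Proof.
have [Nq _ [s s0 E]] := Hc (t + pi *+ 2); apply: (curve_unique Nq s0).
by rewrite -E /circ cosD2pi sinD2pi.
Qed.

(** Both points of the circle are on the ray from the same point, and by [omd_inj] this ray crosses
    the circle only once. *)
Lemma curve_inj (s t : R) : 0 <= s < pi *+ 2 -> 0 <= t < pi *+ 2 -> c s = c t -> s = t.
Proof.
move=> hs ht E; apply: circ_inj => //.
have [Nq Hq [s' s0' Es]] := Hc s; have [_ _ [t' t0' Et]] := Hc t.
rewrite Es Et -E; congr (tangent_flow nu (_, _)); rewrite -E in Et.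
have hq := NC Nq; have hu := flow_unit hN hnu Nq.
have os := omd_gt0 hq hu s'; have ot := omd_gt0 hq hu t'.
have n1 := circ_norm hyp rad s; rewrite Es flow_norm // in n1.
have n2 := circ_norm hyp rad t; rewrite Et flow_norm // in n2.
have Q0 := CH2_gt0 hq.
apply: (omd_inj (q := c s) (u := J (nu (c s)))) => //.
  by have := Hrad Nq Hq; rewrite -n1 ltr_pdivrMr // -{1}(mulr1 (1 - dot (c s) (c s))) ltr_pM2l.
apply: invr_inj; apply: (mulfI (lt0r_neq0 Q0)); exact: etrans n1 (esym n2).
Qed.

Lemma curve_simple : simple_closed_curve H c (pi *+ 2).
Proof.
split.
- by rewrite pmulrn_lgt0 // pi_gt0.
- exact: (curve_smooth hyp rad0 rad1 Hc).
- by move=> t; have [] := Hc t.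
- exact: curve_period.
split; first by move=> s t; exact: curve_inj.
move=> t; have [mu [_ [_ [mu0 _ D _]]]] := curve_regular hyp rad0 rad1 Hrad Hc t.
rewrite (is_derive1 D) scaler_eq0 negb_or mu0 /=.
by have [Nq _ _] := Hc t; apply: unit_neq0 (flow_unit hN hnu Nq).
Qed.

Variable rho : R.
Hypothesis rho1 : rho < 1.
Hypothesis shell : forall z, rho < dot z z < 1 -> U z.

(** A component outside the curve reaches the shell, which is exterior, without meeting [N].
    Conversely, from an exterior point of [H] the tangent ray leads in [H] to points of norm
    arbitrarily close to 1. *)
Lemma outside_eq : outside H c = H `&` U.
Proof.
apply/seteqP; split=> x.
  move=> Hx.
  have [y Cy ry] : exists2 y, connected_component (H `\` range c) x y & rho < dot y y.
    apply: contrapT => h; apply: Hx; exists rho => // y Cy /=.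
    by rewrite leNgt; apply/negP => ry; apply: h; exists y.
  have [A [Ax AH cA] Ay] := Cy.
  have Hy : H y by have [] := AH _ Ay.
  have Hxx : H x by have [] := AH _ Ax.
  split=> //.
  have Uy : U y by apply: shell; rewrite ry /=; have [] := (bl_HP hyp y).1 Hy.
  apply: (exterior_connected cA _ Ay Uy) => //.
  move=> z Az; have [Hz nz] := AH _ Az; split; first by have [] := (bl_HP hyp z).1 Hz.
  by move=> Nz; apply: nz; rewrite curve_range.
move=> [Hx Ux] [r r1 Hr].
have [q [t [Nq Hq t0 E]]] := bl_exterior hyp Hx Ux.
have hq := NC Nq; have hu := flow_unit hN hnu Nq.
have [T T0 HT'] := geoE_near_boundary hq hu r1.
pose s := Num.max t T.
have ts : t <= s by rewrite /s le_max lexx.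
have Ts : T <= s by rewrite /s le_max lexx orbT.
have /andP[hs _] := HT' s Ts.
suff : connected_component (H `\` range c) x (geoE q (J (nu q)) s).
  by move/Hr => /=; rewrite leNgt hs.
exists (geoE q (J (nu q)) @` `[t, s]); last by exists s => //; rewrite /= in_itv /= ts lexx.
split.
- by exists t; [rewrite /= in_itv /= ts lexx|rewrite E (flowE _ hN hnu Nq)].
- move=> _ [r' + <-]; rewrite /= in_itv /= => /andP[tr _].
  rewrite -(flowE _ hN hnu Nq); split; first exact: (bl_flow hyp r' Nq Hq).
  have CR z : range c z -> N z /\ H z by rewrite curve_range.
  move=> /CR [Nz _].
  have := flow_exterior hyp Nq (lt_le_trans t0 tr).
  by move/exterior_sub => [].
apply: connected_continuous_connected; first exact: segment_connected.
apply: continuous_subspaceT => r'.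
exact: (is_derive_cont (is_derive_geoE hq hu r')).
Qed.

Lemma curve_inward : inward_unit_normal_in H c nu.
Proof.
move=> t /=; have [Nq Hq _] := Hc t.
split.
- by apply/(HT Hq); apply: Hnu.
- exact: (nu_unit hN hnu Nq).
- have [mu [_ [_ [_ _ D _]]]] := curve_regular hyp rad0 rad1 Hrad Hc t.
  by rewrite (is_derive1 D) metricZr metricuJ mulr0.
have [e e0 He] := inward_not_exterior hyp Nq Hq.
exists e => // s /He [Hs Ns Us]; split; last by rewrite outside_eq => -[].
by split=> //; rewrite curve_range => -[].
Qed.

Lemma curve_convex : convex_curve H c (pi *+ 2) nu.
Proof.
split; [exact: curve_simple|exact: curve_inward|move=> t].
have [Nq Hq _] := Hc t.
have [mu [mu' [k [mu0 k0 D Dc]]]] := curve_regular hyp rad0 rad1 Hrad Hc t.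
rewrite /geodesic_curvature Dc (is_derive1 D) metricDl !metricZl metricJl metricuJ oppr0 mulr0 add0r.
rewrite (nu_unit hN hnu Nq) mulr1 metricZr (flow_unit hN hnu Nq) mulr1.
by rewrite -expr2 mulrAC mulfV ?mul1r // expf_neq0.
Qed.

Lemma curve_billiard x y : (H `&` U) x -> (usual_outer_billiard H c nu x y <-> y = B x).
Proof.
move=> HUx; have [_ [_ _ surj] HBx] := hB.
split=> [[_ [q [t [rq t0 -> ->]]]]|->].
  by rewrite HBx //; move: rq; rewrite curve_range => -[].
split; first by rewrite outside_eq.
have [Hx Ux] := HUx.
(* The source of the billiard map lies at a negative time, so the bijection for negative times
   provides the point of tangency. *)
have [[q t] [Nq /= t0] E] := surj x Ux.
have Hq : H q by apply: (Hback Nq (t := t)); [rewrite lt_eqF|rewrite E].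
have xE : x = geod q (J (nu q)) (- - t) by rewrite opprK -E.
exists q, (- t); split=> //.
- by have [_] := (seteqP _ _).1 curve_range; apply; split.
- by rewrite oppr_gt0.
- by rewrite xE HBx // oppr_gt0.
Qed.

End Circle.

Theorem core_billiard : B @` (H `&` U) = H `&` U /\ usual_outer_billiard_on H (N `&` H) U B.
Proof.
have [_ [_ cN N0 _ _] _ _] := hyp.
have [rho /andP[r0 r1] [Nr shell]] := exists_shell hN cN N0 hnu hB.
split.
  have [_ [_ _ surj] HBx] := hB.
  apply/seteqP; split=> [_ [x [Hx Ux] <-]|y [Hy Uy]].
    have [[q t] [Nq /= t0] E] := surj x Ux.
    have Hq : H q by apply: (Hback Nq (t := t)); [rewrite lt_eqF|rewrite E].
    have xE : x = geod q (J (nu q)) (- - t) by rewrite opprK -E.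
    have t1 : 0 < - t by rewrite oppr_gt0.
    rewrite xE HBx //; split; first exact: (bl_flow hyp (- t) Nq Hq).
    exact: (flow_exterior hyp Nq t1).
  have [q [t [Nq Hq t0 ->]]] := bl_exterior hyp Hy Uy.
  exists (tangent_flow nu (q, - t)); last exact: HBx.
  by split; [exact: (bl_flow hyp (- t) Nq Hq)|apply: (flow_exteriorN hyp Nq); rewrite oppr_lt0].
(* This is 1 - rad^2: being below 1 - rho it puts the circle into the shell, and the bound 1/2 keeps
   the radius positive. *)
pose s := Num.min (2^-1) ((1 - rho) / 2).
have s0 : 0 < s by rewrite lt_min invr_gt0 ltr0n divr_gt0 // subr_gt0.
have s1 : s <= 2^-1 by rewrite ge_min lexx.
have s2 : s < 1 - rho.
  by apply: (@le_lt_trans _ _ ((1 - rho) / 2)); [rewrite ge_min lexx orbT|lra].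
clearbody s.
pose rad := Num.sqrt (1 - s).
have rE : rad ^+ 2 = 1 - s by rewrite sqr_sqrtr //; lra.
have rad0 : 0 < rad by rewrite sqrtr_gt0; lra.
have rad1 : rad < 1 by rewrite -(@expr_lt1 _ 2) ?rE ?ltW //; lra.
have aa := dot_ge0 a.
have E : (1 - dot a a) * (1 - rad ^+ 2) <= s.
  by rewrite rE (_ : 1 - (1 - s) = s); [rewrite ler_piMl //; lra|ring].
have Hrad q : N q -> H q -> (1 - dot a a) * (1 - rad ^+ 2) < 1 - dot q q.
  by move=> /Nr h _; apply: (le_lt_trans E); lra.
have circU t : U (circ a b rad t).
  have := circ_norm hyp rad t => h; apply: shell.
  have [h1 _] := (bl_HP hyp _).1 (circ_in hyp rad0 rad1 t).
  by rewrite [X in _ && X]h1 andbT; move: E; rewrite -h; lra.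
have ex t : exists q, [/\ N q, H q & exists2 s : R, 0 < s & circ a b rad t = tangent_flow nu (q, s)].
  have [q [r [Nq Hq r0' Er]]] := bl_exterior hyp (circ_in hyp rad0 rad1 t) (circU t).
  by exists q; split=> //; exists r.
have [c Hc] := choice ex.
exists c, (pi *+ 2), nu; split.
- exact: (curve_convex rad0 rad1 Hrad Hc r1 shell).
- exact: (curve_range rad0 rad1 Hrad Hc).
- exact: (outside_eq rad0 rad1 Hrad Hc r1 shell).
- by move=> x y; exact: (curve_billiard rad0 rad1 Hrad Hc r1 shell).
Qed.

End Given.
End CoreConclusion.

(** * Hypersurfaces invariant by a reflection *)

Section PartA.
Variable R : realType.
Notation V := 'rV[R]_(2 + 2).

Lemma mproj_span z b (w : V) : cspan b (mproj z b w).
Proof. by rewrite /mproj; do 2 eexists. Qed.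

Lemma reflection_billiard (H N : set V) (s nu B : V -> V) :
  complex_line H -> compact_connected_hypersurface N -> Defs.reflection H s -> s @` N = N ->
  inward_normal N nu -> outer_billiard_map N nu B ->
  B @` (H `&` exterior N nu) = H `&` exterior N nu /\
  usual_outer_billiard_on H (N `&` H) (exterior N nu) B.
Proof.
move=> HH [hN N0 cN _] Hr sN hnu hB.
have [a [b [ab aJb bb ha [Heq HT]]]] := line_normal_form HH.
have Hs : Defs.isometry s by case: Hr.
have sN' z : N z -> N (s z) by move=> Nz; rewrite -sN; exists z.
have sfix z : H z -> s z = z by case: Hr => _ + _; apply.
suff hyp : billiard_line H a b N nu B by exact: core_billiard hyp.
split; [by split|by split| |].
  move=> q Nq Hq.
  have E := nu_isometry Hs hN hnu sN' Nq.
  have := refl_diff HH Hr bb ha Heq HT (nu q) Hq.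
  rewrite E sfix // => E2.
  (* ['d s q] fixes [nu q], so the formula of [refl_diff] makes twice the vector equal to twice its
     projection. *)
  have -> : nu q = mproj q b (nu q).
    apply: (scalerI (a := 2)); first by rewrite pnatr_eq0.
    by rewrite scaler_nat mulr2n {2}E2 addrC subrK.
  exact: mproj_span.
move=> q t Nq t0 HF.
have hq := nu_sub_CH2 hN Nq; have hu := flow_unit hN hnu Nq.
have E : tangent_flow nu (s q, t) = tangent_flow nu (q, t).
  rewrite -[RHS]sfix // !(flowE _ hN hnu) //; last exact: sN'.
  rewrite (iso_geod Hs) // (refl_J HH Hr ab aJb bb ha Heq HT) //.
  by rewrite (nu_isometry Hs hN hnu sN' Nq).
have Es : s q = q.
  have [[_ inj1 _] [_ inj2 _] _] := hB.
  have [t1|t1] := ltP 0 t.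
    by have := inj1 (s q, t) (q, t); rewrite !inE => /(_ (conj (sN' q Nq) t1) (conj Nq t1) E) [].
  have t2 : t < 0 by rewrite lt_neqAle t0.
  by have := inj2 (s q, t) (q, t); rewrite !inE => /(_ (conj (sN' q Nq) t2) (conj Nq t2) E) [].
exact: (refl_fix HH Hr ab aJb bb ha Heq HT hq Es).
Qed.

End PartA.

(** * Complex lines through a point and geodesic spheres *)

Section ComplexLines.
Variable R : realType.
Notation V := 'rV[R]_(2 + 2).
Implicit Types (p q u v w x y z : V).

(** The Hermitian product with [n] as a point of the real plane; for n nonzero its kernel is a
    complex line. *)
Definition pair_dot (n w : V) : 'rV[R]_2 := dot w n *: delta_mx 0 ord0 + dot w (J n) *: delta_mx 0 ord_max.

Lemma pair_dot_linear n : linear (pair_dot n).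
Proof.
move=> k x y; rewrite /pair_dot !dotDl !dotZl !scalerDl -!scalerA scalerDr.
by rewrite addrACA.
Qed.

HB.instance Definition _ n := GRing.isLinear.Build R V 'rV[R]_2 _ (pair_dot n) (pair_dot_linear n).

Lemma pair_dotE n w : (pair_dot n w) ord0 ord0 = dot w n /\ (pair_dot n w) ord0 ord_max = dot w (J n).
Proof. by rewrite /pair_dot !mxE /= !mulr1 !mulr0 addr0 add0r. Qed.

Lemma pair_dot_eq0 n w : pair_dot n w = 0 <-> dot w n = 0 /\ dot w (J n) = 0.
Proof.
split=> [E|[h1 h2]]; last by rewrite /pair_dot h1 h2 !scale0r addr0.
by have [<- <-] := pair_dotE n w; rewrite E !mxE.
Qed.

Lemma pair_dot_surj n : n != 0 -> forall c, exists w, pair_dot n w = c.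
Proof.
move=> n0 c; have N0 : dot n n != 0 by rewrite dot_eq0.
exists (cs (c ord0 ord0 / dot n n) (c ord0 ord_max / dot n n) n).
apply/rowP => i; have [e1 e2] := pair_dotE n (cs (c ord0 ord0 / dot n n) (c ord0 ord_max / dot n n) n).
have d1 : dot (cs (c ord0 ord0 / dot n n) (c ord0 ord_max / dot n n) n) n = c ord0 ord0.
  by rewrite /cs !dotE; field.
have d2 : dot (cs (c ord0 ord0 / dot n n) (c ord0 ord_max / dot n n) n) (J n) = c ord0 ord_max.
  by rewrite /cs !dotE; field.
case: i => -[|[|//]] i1.
  by rewrite (_ : Ordinal i1 = ord0) ?e1 ?d1 //; exact: val_inj.
by rewrite (_ : Ordinal i1 = ord_max) ?e2 ?d2 //; exact: val_inj.
Qed.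

(** A nonzero vector Hermitian orthogonal to [v] provides one affine equation valid on the whole
    ball. *)
Lemma cline_equation p v : CH2 p -> v != 0 -> exists f : V -> 'rV[R]_2,
  (forall q, cline p v q -> @local_equation R 2 (cline p v) q (@CH2 R) f) /\
  (forall z w, 'd f z w = 0 <-> cspan v w).
Proof.
move=> hp v0; have [n n0 /pair_dot_eq0 [nv nJv]] := lin_kernel_nz (pair_dot v).
have vn : dot v n = 0 by rewrite dotC.
have vJn : dot v (J n) = 0 by rewrite -[LHS]opprK -dotJl dotC nJv oppr0.
have Lv : pair_dot n v = 0 by apply/pair_dot_eq0.
have LJv : pair_dot n (J v) = 0.
  by apply/pair_dot_eq0; rewrite dotJl vJn oppr0 dotJ vn.
have ker w : pair_dot n w = 0 <-> cspan v w.
  split=> [E|[a [b ->]]]; last exact: cs_lin.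
  have [a [b ->]] := lin_kernel_span (pair_dot_surj n0) v0 Lv LJv E.
  by exists a, b.
pose f z := pair_dot n (z - p).
have sf k : Ck k (@CH2 R) f.
  have oC := @CH2_open R.
  by apply: Ck_lin => //; ck.
have df z : is_diff z f (pair_dot n).
  have D : is_diff z (fun z => z - p) (fun w => w - 0).
    exact: (is_diffB (is_diff_id z) (is_diff_cst p z)).
  by apply: (is_diff_ext (is_diff_lin (pair_dot n) D)) => // w; rewrite subr0.
exists f; split; last by move=> z w; rewrite (is_diffE w (df z)); exact: ker.
move=> q [hq ql]; split=> //; first exact: CH2_open.
split=> [z _ b|z hz].
  by have [w E] := pair_dot_surj n0 b; exists w; rewrite (is_diffE w (df z)).
split=> [[_ h]|h]; first exact/ker.
by split=> //; apply/ker.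
Qed.

(** Any local equation vanishes along straight segments in the line, so its kernel, of dimension 2,
    is the span of [v]. *)
Lemma cline_tangentP p v q w : CH2 p -> v != 0 -> cline p v q ->
  tangent 2 (cline p v) q w <-> cspan v w.
Proof.
move=> hp v0 ql; have [f [Hf df]] := cline_equation hp v0.
split; last by move=> h; exists (@CH2 R), f; split; [exact: Hf|apply/df].
move=> [W [g [[oW Wq WC sg [surj gE]] dgw]]].
have dg : differentiable g q by have := CkS_diff (sg 1%N) Wq => /(@ex_diff _ _ _ _ _ _).
have kill y : cspan v y -> 'd g q y = 0.
  move=> vy.
  have D : is_derive (0 : R) 1 (fun t : R => q + t *: y) y.
    have H' := is_derive_add (is_derive_const q (0 : R))
      (is_derive_scale (is_derive_id (0 : R) 1) (is_derive_const y (0 : R))).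
    by apply: (is_derive_eq H'); rewrite scaler0 scale1r !add0r.
  apply: (curve_kills _ D dg); first by rewrite scale0r addr0.
  have cD := is_derive_cont D.
  have nW : \forall t \near (0 : R), W (q + t *: y).
    by apply: (cD _ (open_nbhs_nbhs (conj oW _))); rewrite scale0r addr0.
  apply: (@filterS _ (nbhs (0 : R)) _ (fun t => W (q + t *: y))) => // t Wt.
  apply/(gE _ Wt); split; first exact: WC.
  rewrite addrAC; apply: cspanD; first by have [] := ql.
  exact: cspanZ.
have [a [b ->]] := lin_kernel_span (surj q Wq) v0 (kill v (cspanv v)) (kill _ (cspanJ (cspanv v))) dgw.
by exists a, b.
Qed.

Lemma cline_self p v : CH2 p -> cline p v p.
Proof. by move=> hp; split=> //; exists 0, 0; rewrite subrr cs00. Qed.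

Lemma CH2_segment p z (t : R) : CH2 p -> CH2 z -> 0 <= t <= 1 -> CH2 (p + t *: (z - p)).
Proof.
move=> hp hz /andP[t0 t1]; rewrite /CH2 /=.
have -> : p + t *: (z - p) = (1 - t) *: p + t *: z.
  by rewrite scalerBr scalerBl scale1r addrA addrAC.
have h : dot p z <= (dot p p + dot z z) / 2.
  have := dot_ge0 (p - z); rewrite !(dotDl, dotDr, dotNl, dotNr) (dotC z p).
  by move: (dot p z) (dot p p) (dot z z) => X Y Z; lra.
rewrite !(dotDl, dotDr, dotZl, dotZr) (dotC z p).
have hp' : dot p p < 1 by []. have hz' : dot z z < 1 by [].
move: hp' hz' h; move: (dot p p) (dot z z) (dot p z) => X Y Z X1 Y1 h.
have e1 : 0 <= (1 - t) * t by rewrite mulr_ge0 // subr_ge0.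
have e2 : (1 - t) * t * Z <= (1 - t) * t * ((X + Y) / 2) by rewrite ler_wpM2l.
have e3 := convex_lt X1 Y1 t0 t1.
nra.
Qed.

Lemma cline_complex_line p v : CH2 p -> v != 0 -> complex_line (cline p v).
Proof.
move=> hp v0; have [f [Hf df]] := cline_equation hp v0.
split.
- by split=> [z []|q ql] //; exists (@CH2 R), f; exact: Hf.
- by exists p; exact: cline_self.
(* Connectedness: the line is a union of segments issuing from [p], as the ball is convex. *)
- pose A z := (fun t : R => p + t *: (z - p)) @` `[0, 1].
  have -> : cline p v = \bigcup_(z in cline p v) A z.
    apply/seteqP; split=> z.
      move=> zl; exists z => //; exists 1; first by rewrite /= in_itv /= ler01 lexx.
      by rewrite scale1r addrC subrK.
    move=> [y [hy yl] [t]]; rewrite /= in_itv /= => tI <-; split; first exact: CH2_segment.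
    by rewrite addrC addKr; exact: cspanZ.
  apply: bigcup_connected.
    exists p => z _; exists 0; first by rewrite /= in_itv /= ler01 lexx.
    by rewrite scale0r addr0.
  move=> z _; apply: connected_continuous_connected; first exact: segment_connected.
  apply: continuous_subspaceT => t.
  have D := is_derive_add (is_derive_const p t) (is_derive_scale (is_derive_id t 1) (is_derive_const (z - p) t)).
  exact: (is_derive_cont D).
- by move=> q w ql /(cline_tangentP _ hp v0 ql) h; apply/(cline_tangentP _ hp v0 ql); exact: cspanJ.
move=> q w t ql /(cline_tangentP _ hp v0 ql) h.
have [hq qs] := ql.
have mem u s : cspan v u -> metric q u u = 1 -> cline p v (geoE q u s).
  move=> vu hu; split; first exact: geoE_in.
  by rewrite /geoE addrAC; apply: cspanD => //; exact: cspan_cs.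
(* The zero velocity is written as 0 times a unit vector, for which [geodEZ] gives the constant
   geodesic. *)
have [->|w0] := eqVneq w 0.
  have [l _ lu] := unit_scale hq v0.
  by rewrite -(scale0r (l *: v)) geodEZ // mul0r geoE0.
have [l l0 lu] := unit_scale hq w0.
have -> : w = l^-1 *: (l *: w) by rewrite scalerA mulVf ?scale1r // gt_eqF.
by rewrite geodEZ //; apply: mem => //; exact: cspanZ.
Qed.

Lemma complex_lines_CP1 o : CH2 o ->
  set_bij [set H : set V | complex_line H /\ H o] (@CP1 R) (fun H => tangent 2 H o).
Proof.
move=> ho.
have TE (H : set V) v : complex_line H -> H o -> v != 0 -> tangent 2 H o v -> tangent 2 H o = cspan v.
  by move=> HH Ho v0 Tv; apply/seteqP; split=> w; apply (line_tangentP HH w Ho Tv v0).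
split=> [H [HH Ho]|H H'|L [v v0 ->]].
- have [v v0 Tv] := line_exists_tangent HH Ho.
  by exists v => //; rewrite (TE H v).
- rewrite !inE => -[HH Ho] [HH' Ho'] E.
  have [v v0 Tv] := line_exists_tangent HH Ho.
  have Tv' : tangent 2 H' o v by rewrite -E.
  by rewrite (line_eq HH Ho Tv v0) (line_eq HH' Ho' Tv' v0).
exists (cline o v); first by split; [exact: cline_complex_line|exact: cline_self].
by apply/seteqP; split=> w; apply (cline_tangentP w ho v0 (cline_self v ho)).
Qed.

End ComplexLines.

(** * Equation and normal directions of geodesic spheres *)

Section Sphere.
Variable R : realType.
Notation V := 'rV[R]_(2 + 2).
Implicit Types (p q u v w x y z : V).

Lemma sh_ge0 (t : R) : (0 <= sh t) = (0 <= t).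
Proof.
have E : sh (- t) = - sh t by exact: shN.
by rewrite leNgt [RHS]leNgt -oppr_gt0 -E sh_gt0 oppr_gt0.
Qed.

Lemma ch_inj (s t : R) : 0 <= s -> 0 <= t -> ch s ^+ 2 = ch t ^+ 2 -> s = t.
Proof.
move=> s0 t0 E.
have Es : sh s ^+ 2 = sh t ^+ 2 by have := ch_sh s; have := ch_sh t; lra.
have c0 := ch_gt0 s; have c1 := ch_gt0 t.
have s1 : 0 <= sh s by rewrite sh_ge0. have s2 : 0 <= sh t by rewrite sh_ge0.
apply: expR_inj2.
  by apply/eqP; rewrite -(@eqrXn2 _ 2%N) ?Es.
by apply/eqP; rewrite -(@eqrXn2 _ 2%N) ?ltW ?E.
Qed.

Section Given.
Variables (o : V) (r : R).
Hypotheses (ho : CH2 o) (r0 : 0 < r).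
Let A := 1 - dot o o.
Let A0 : 0 < A. Proof. exact: CH2_gt0. Qed.

(* (cosh of the distance to o)^2 = |1 - <z, o>|^2 / ((1 - |z|^2) (1 - |o|^2)). *)
Definition sphere_eq z : R :=
  (1 - dot z o) ^+ 2 + dot z (J o) ^+ 2 - ch r ^+ 2 * (1 - dot o o) * (1 - dot z z).

Lemma sphere_eq_geoE u (t : R) : metric o u u = 1 ->
  sphere_eq (geoE o u t) = A * (1 - dot (geoE o u t) (geoE o u t)) * (ch t ^+ 2 - ch r ^+ 2).
Proof.
move=> hu; have D0 : omd o u t != 0 by rewrite gt_eqF // omd_gt0.
have An : A != 0 by rewrite gt_eqF.
have E1 : dot u o = k1 o u * A by rewrite /k1 -/A mulfVK.
have E2 : dot u (J o) = k2 o u * A by rewrite /k2 -/A mulfVK.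
have e1 : 1 - dot (geoE o u t) o = A * (1 - (sg1 o u t * k1 o u - sg2 o u t * k2 o u)).
  rewrite /geoE /cs !dotDl !dotZl dotJl E1 E2 /A; ring.
have e2 : dot (geoE o u t) (J o) = A * (sg1 o u t * k2 o u + sg2 o u t * k1 o u).
  rewrite /geoE /cs !dotDl !dotZl dotJ E1 E2 dotuJ; ring.
rewrite /sphere_eq e1 e2 geoE_norm // -/A /sg1 /sg2.
have E : (1 - (sh t * om1 o u t / omd o u t * k1 o u - - (sh t * om2 o u t) / omd o u t * k2 o u)) ^+ 2
  + (sh t * om1 o u t / omd o u t * k2 o u + - (sh t * om2 o u t) / omd o u t * k1 o u) ^+ 2
  = ch t ^+ 2 / omd o u t.
  move: D0; rewrite /omd /om1 /om2.
  move: (k1 o u) (k2 o u) (ch t) (sh t) => a b C S D0; by field.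
have aux (x y : R) : (A * x) ^+ 2 + (A * y) ^+ 2 = A ^+ 2 * (x ^+ 2 + y ^+ 2) by ring.
rewrite aux E; move: (ch r) (ch t) (omd o u t) D0 => c c' d d0; by field.
Qed.

Lemma sphere_exp z : CH2 z -> exists u (t : R), [/\ metric o u u = 1, 0 <= t & z = geoE o u t].
Proof.
move=> hz; have [->|zo] := eqVneq z o.
  have [w w0 _] := lin_kernel_nz (@pair_dot R o).
  have [l _ lu] := unit_scale ho w0.
  by exists (l *: w), 0; rewrite geoE0.
have [a [b [t [hu t0 E _]]]] := exp_surj ho hz zo.
by exists (cs a b (z - o)), t; split=> //; exact: ltW.
Qed.

(** The equation forces 1 - |z|^2 >= 0, and equality would give [dot z o = 1] with |z| = 1 and |o| <
    1. Hence the sphere is the whole zero set of a polynomial, closed and bounded. *)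
Lemma sphere_eq_CH2 z : sphere_eq z = 0 -> CH2 z.
Proof.
rewrite /sphere_eq => /eqP; rewrite subr_eq0 => /eqP E.
have K0 : 0 < ch r ^+ 2 * A by rewrite mulr_gt0 // exprn_gt0 // ch_gt0.
have h : 0 <= 1 - dot z z by rewrite -(pmulr_rge0 _ K0) -E addr_ge0 ?sqr_ge0.
rewrite /CH2 /= -subr_gt0 lt_neqAle h andbT eq_sym; apply/eqP => z1.
move: E; rewrite z1 mulr0 => /eqP; rewrite paddr_eq0 ?sqr_ge0 // !sqrf_eq0 => /andP[/eqP e1 _].
have cs := @dot_CauchySchwarz R _ z o.
move: cs e1 z1 A0; rewrite /A; move: (dot z o) (dot z z) (dot o o) => X Y Z; nra.
Qed.

Lemma sphereP z : geodesic_sphere o r z <-> sphere_eq z = 0.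
Proof.
split=> [[u hu ->]|E].
  by rewrite geodE // sphere_eq_geoE // subrr mulr0.
have hz := sphere_eq_CH2 E.
have [u [t [hu t0 zE]]] := sphere_exp hz.
exists u => //; rewrite geodE //.
move: E; rewrite zE sphere_eq_geoE // => /eqP.
rewrite mulf_eq0 gt_eqF /=; last by apply: mulr_gt0 => //; exact: CH2_gt0 (geoE_in ho hu t).
rewrite subr_eq0 => /eqP h; congr (geoE o u _); apply: ch_inj => //; exact: ltW.
Qed.

Definition dsphere z w : R := - (2 * (1 - dot z o) * dot w o) + 2 * dot z (J o) * dot w (J o)
  + 2 * (ch r ^+ 2 * (1 - dot o o)) * dot z w.

Lemma is_diff_sphere z : is_diff z sphere_eq (dsphere z).
Proof.
have Dd y : is_diff z (fun z => dot z y) (fun w => dot w y).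
  apply: is_diff_ext (is_diff_dot (is_diff_id z) (is_diff_cst y z)) _ _ => // w.
  by rewrite dot0r addr0.
have D1 : is_diff z (fun z => 1 - dot z o) (fun w => - dot w o).
  apply: is_diff_ext (is_diffB (is_diff_cst (1 : R) z) (Dd o)) _ _ => // w.
  by rewrite !fctE sub0r.
have D3 : is_diff z (fun z => 1 - dot z z) (fun w => - (dot w z + dot z w)).
  apply: is_diff_ext (is_diffB (is_diff_cst (1 : R) z) (is_diff_dot (is_diff_id z) (is_diff_id z))) _ _ => // w.
  by rewrite !fctE sub0r.
have H1 := is_diff_scale D1 D1.
have H2 := is_diff_scale (Dd (J o)) (Dd (J o)).
have H3 : is_diff z (fun z => ch r ^+ 2 * (1 - dot o o) * (1 - dot z z))
    (fun w => ch r ^+ 2 * (1 - dot o o) * - (dot w z + dot z w)).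
  apply: is_diff_ext (is_diff_scale (is_diff_cst (ch r ^+ 2 * (1 - dot o o)) z) D3) _ _ => // w.
  by rewrite scale0r addr0.
apply: is_diff_ext (is_diffB (is_diffD H1 H2) H3) _ _ => w; first by rewrite !fctE /= /sphere_eq !expr2.
rewrite !fctE /GRing.scale /= /dsphere (dotC w z); ring.
Qed.

Lemma Ck_sphere k : Ck k (@CH2 R) sphere_eq.
Proof. by have oC := @CH2_open R; rewrite /sphere_eq /GRing.exp /=; ck. Qed.

(** The radial velocity is a witness: along the radial geodesic the equation is a positive function
    times cosh^2 t - cosh^2 r, with derivative 2 cosh r sinh r of the second factor at r. *)
Lemma dsphere_surj z : sphere_eq z = 0 -> exists w, dsphere z w != 0.
Proof.
move=> /sphereP [u hu]; rewrite geodE // => zE.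
exists (geoV o u r).
have D1 : is_derive r 1 (fun t => sphere_eq (geoE o u t)) (dsphere z (geoV o u r)).
  by apply: is_derive_diff_comp (is_derive_geoE ho hu r); rewrite -zE; exact: is_diff_sphere.
have Dn : is_derive r 1 (fun t => A * (1 - dot (geoE o u t) (geoE o u t)))
    (A * (0 - (dot (geoV o u r) (geoE o u r) + dot (geoE o u r) (geoV o u r)))).
  have Dg := is_derive_geoE ho hu r.
  have H := is_derive_mul (is_derive_const A r)
    (is_deriveB (is_derive_const (1 : R) r) (is_derive_dot Dg Dg)).
  by apply: (is_derive_eq H); rewrite mul0r add0r.
have Dc : is_derive r 1 (fun t => ch t ^+ 2 - ch r ^+ 2) (2 * ch r * sh r).
  have H := is_deriveB (is_derive_mul (is_derive_ch r) (is_derive_ch r)) (is_derive_const (ch r ^+ 2) r).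
  apply: is_derive_fext (is_derive_eq H _) _ => [|t]; last by rewrite !fctE expr2.
  ring.
have D2 := is_derive_fext (is_derive_mul Dn Dc) (fun t => esym (sphere_eq_geoE t hu)).
rewrite (is_derive_uniq D1 D2) subrr mulr0 add0r.
have X := CH2_gt0 (geoE_in ho hu r); have C := ch_gt0 r.
have S : 0 < sh r by rewrite sh_gt0.
by apply: lt0r_neq0; apply: mulr_gt0; apply: mulr_gt0 => //; apply: mulr_gt0.
Qed.

Lemma sphere_submanifold : submanifold 1 (geodesic_sphere o r).
Proof.
split=> [z /sphereP /sphere_eq_CH2 //|p /sphereP p0].
have [w0 dw0] := dsphere_surj p0.
have hp := sphere_eq_CH2 p0.
(* A single direction [w0] witnesses surjectivity of the differential at all points near [p]. *)
pose W := interior [set z | CH2 z /\ dsphere z w0 != 0].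
have WS z : W z -> CH2 z /\ dsphere z w0 != 0 by move/interior_subset.
have e1 : exists e : 'rV[R]_1, e ord0 ord0 = 1 by exists (const_mx 1); rewrite mxE.
have [e E] := e1.
pose f z : 'rV[R]_1 := sphere_eq z *: e.
have df z v : 'd f z v = dsphere z v *: e.
  have D := is_diff_scale (is_diff_sphere z) (is_diff_cst e z).
  by apply: (etrans (is_diffE v D)); rewrite scaler0 add0r.
exists W, f; split.
- exact: open_interior.
- apply: filterI; first exact: (open_nbhs_nbhs (conj (@CH2_open R) hp)).
  have C : dsphere z w0 @[z --> p] --> dsphere p w0.
    have oT : open [set: V] by exact: openT.
    have sd : Ck 0 setT (dsphere^~ w0) by rewrite /dsphere; ck.
    exact: (sd p I).
  exact: cvgr_neq0 C dw0.
- by move=> z /WS [].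
- move=> k; apply: (@Ck_sub _ _ _ _ (@CH2 R)); first by move=> z /WS [].
  have oC := @CH2_open R.
  by apply: Ck_scale => //; [exact: Ck_sphere|exact: Ck_cst].
split=> [z /WS [hz n0] c|z /WS [hz _]].
  exists ((c ord0 ord0 / dsphere z w0) *: w0); rewrite df.
  have -> : dsphere z ((c ord0 ord0 / dsphere z w0) *: w0) = c ord0 ord0.
    rewrite -[RHS](divfK n0); rewrite {1}/dsphere !dotZl dotZr /dsphere; ring.
  by apply/rowP => i; rewrite (ord1 i) mxE E mulr1.
apply: (iff_trans (sphereP z)); split=> [h|/rowP /(_ ord0)]; first by rewrite /f h scale0r.
by rewrite !mxE E mulr1.
Qed.

Lemma sphere_compact : compact (geodesic_sphere o r).
Proof.
have -> : geodesic_sphere o r = sphere_eq @^-1` [set 0] by apply/seteqP; split=> z /sphereP.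
apply: bounded_closed_compact.
  exists 1; split; first exact: num_real.
  move=> M M1 z /sphere_eq_CH2 hz /=.
  apply: le_trans (norm_le_enorm z) _; apply: le_trans (ltW M1).
  by rewrite -(sqrtr1 R) ler_wsqrtr // ltW.
apply: closed_comp => [z _|].
  exact: (differentiable_continuous (ex_diff (is_diff_def := is_diff_sphere z))).
by apply: accessible_closed_set1; apply: hausdorff_accessible; exact: Rhausdorff.
Qed.

Lemma sphere_nonempty : geodesic_sphere o r !=set0.
Proof.
have [w w0 _] := lin_kernel_nz (@pair_dot R o).
have [l _ lu] := unit_scale ho w0.
by exists (geod o (l *: w) r), (l *: w).
Qed.

(** Directions orthogonal at [q] to a complex line through [o] and [q] are tangent to the sphere;
    hence the normal of the sphere is tangent to that line. *)
Lemma dsphere_line a b (x y x' y' : R) w : let q := a + cs x y b in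
  dot a b = 0 -> dot a (J b) = 0 -> dot b b = 1 - dot a a -> CH2 a -> o = a + cs x' y' b ->
  CH2 q -> sphere_eq q = 0 -> metric q w b = 0 -> metric q w (J b) = 0 -> dsphere q w = 0.
Proof.
move=> q ab aJb bb ha oE hq Sq m1 m2.
have B0 : dot b b != 0 by rewrite bb gt_eqF ?CH2_gt0.
have q0 : 1 - dot q q != 0 by rewrite gt_eqF ?CH2_gt0.
have ba : dot b a = 0 by rewrite dotC.
have bJa : dot b (J a) = 0 by rewrite -[LHS]opprK -dotJl dotC aJb oppr0.
set be := dot b b in B0.
have Qn : 1 - dot q q = be * (1 - (x ^+ 2 + y ^+ 2)).
  rewrite /q /cs !dotE ab aJb ba bJa -/be; have : dot a a = 1 - be by rewrite /be bb; ring.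
  move=> ->; ring.
pose w1 := dot w b; pose w2 := dot w (J b); pose al := dot w a; pose al' := dot w (J a).
have wq : dot w q = al + x * w1 + y * w2 by rewrite /q /cs !dotDr !dotZr addrA.
have wJq : dot w (J q) = al' + x * w2 - y * w1.
  by rewrite /q /cs !JD !JZ JJ !dotDr !dotZr dotNr -/al' -/w1 -/w2; ring.
have bq : dot b q = x * be by rewrite /q /cs !dotE ba -/be; ring.
have bJq : dot b (J q) = - (y * be) by rewrite /q /cs !dotE bJa -/be; ring.
have Jbq : dot (J b) q = y * be by rewrite dotJl bJq opprK.
have JbJq : dot (J b) (J q) = x * be by rewrite dotJ bq.
have num (v : V) : metric q w v = 0 -> (1 - dot q q) * dot w v + dot w q * dot v q + dot w (J q) * dot v (J q) = 0.
  move=> /eqP; rewrite /metric mulf_eq0 invr_eq0 expf_eq0 (negbTE q0) orbF => /eqP //.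
have := num _ m1; have := num _ m2.
rewrite wq wJq bq bJq Jbq JbJq Qn -/w1 -/w2 => F2 F1.
(* Orthogonality determines the products of [w] with [b] and [J b] by those with [a] and [J a];
   after substitution [dsphere q w] is a multiple of [sphere_eq q]. *)
have E1 : w1 = - x * al + y * al'.
  apply: (mulfI B0); apply/eqP; rewrite -subr_eq0 -F1; apply/eqP; ring.
have E2 : w2 = - y * al - x * al'.
  apply: (mulfI B0); apply/eqP; rewrite -subr_eq0 -F2; apply/eqP; ring.
have qo : 1 - dot q o = be * (1 - x * x' - y * y').
  rewrite /q oE /cs !dotE ab aJb ba bJa -/be; have : dot a a = 1 - be by rewrite /be bb; ring.
  move=> ->; ring.
have qJo : dot q (J o) = be * (y * x' - x * y').
  rewrite /q oE /cs !dotE ab aJb ba bJa -/be; ring.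
have wo : dot w o = al + x' * w1 + y' * w2 by rewrite oE /cs !dotDr !dotZr addrA.
have wJo : dot w (J o) = al' + x' * w2 - y' * w1.
  by rewrite oE /cs !JD !JZ JJ !dotDr !dotZr dotNr -/al' -/w1 -/w2; ring.
have := Sq; rewrite /sphere_eq qo qJo Qn => Sq'.
rewrite /dsphere qo qJo wo wJo (dotC q w) wq E1 E2.
apply: (mulfI B0); rewrite mulr0.
transitivity (- 2 * al * ((be * (1 - x * x' - y * y')) ^+ 2 + (be * (y * x' - x * y')) ^+ 2 -
  ch r ^+ 2 * (1 - dot o o) * (be * (1 - (x ^+ 2 + y ^+ 2))))); last by rewrite Sq' mulr0.
by move: (ch r ^+ 2 * _) => K; ring.
Qed.

(** Eliminating cosh^2 r through the equation of the sphere turns [dsphere q u] into a nonzero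
    multiple of sinh t cosh t, so a tangent geodesic can be at the centre only at time 0. *)
Lemma sphere_flow_neq q u (t : R) : CH2 q -> metric q u u = 1 -> sphere_eq q = 0 -> dsphere q u = 0 ->
  geoE q u t = o -> t = 0.
Proof.
move=> hq hu Sq dq oE.
have Q0 : 1 - dot q q != 0 by rewrite gt_eqF ?CH2_gt0.
have D0 : omd q u t != 0 by rewrite gt_eqF // omd_gt0.
set Q := 1 - dot q q in Q0.
have u1 : dot u q = k1 q u * Q by rewrite /k1 mulfVK.
have u2 : dot u (J q) = k2 q u * Q by rewrite /k2 mulfVK.
have u3 : dot q (J u) = - (k2 q u * Q) by rewrite -u2 dotC dotJl.
have un := unit_norm hq hu.
set s1 := sg1 q u t; set s2 := sg2 q u t.
have e1 : 1 - dot q o = Q * (1 - s1 * k1 q u + s2 * k2 q u).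
  rewrite -oE /geoE -/s1 -/s2 /cs !dotDr !dotZr u3 (dotC q u) u1 /Q; ring.
have e2 : dot q (J o) = - Q * (s1 * k2 q u + s2 * k1 q u).
  rewrite -oE /geoE -/s1 -/s2 /cs !JD !JZ JJ !dotDr !dotZr dotNr u3 (dotC q u) u1 dotuJ; ring.
have e3 : dot u o = Q * (k1 q u + s1 * (1 - k1 q u ^+ 2 - k2 q u ^+ 2)).
  rewrite -oE /geoE -/s1 -/s2 /cs !dotDr !dotZr dotuJ u1 un -/Q; ring.
have e4 : dot u (J o) = Q * (k2 q u - s2 * (1 - k1 q u ^+ 2 - k2 q u ^+ 2)).
  rewrite -oE /geoE -/s1 -/s2 /cs !JD !JZ JJ !dotDr !dotZr dotNr dotuJ u2 un -/Q; ring.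
move: Sq dq; rewrite /sphere_eq /dsphere e1 e2 e3 e4 (dotC q u) u1 -/Q.
move: (ch r ^+ 2 * _) => K SK DK.
have KE : K = Q * ((1 - s1 * k1 q u + s2 * k2 q u) ^+ 2 + (s1 * k2 q u + s2 * k1 q u) ^+ 2).
  by apply: (mulIf Q0); apply/eqP; rewrite eq_sym -subr_eq0 -SK; apply/eqP; ring.
have Z : sh t * ch t / omd q u t * (2 * Q ^+ 2) = 0.
  rewrite -[RHS]oppr0 -[in RHS]DK KE /s1 /s2 /sg1 /sg2.
  move: D0; rewrite /omd /om1 /om2.
  move: (k1 q u) (k2 q u) (ch t) (sh t) (Q) => k1 k2 C S Q' D0; by field.
have Zn : 2 * Q ^+ 2 != 0 by apply: mulf_neq0; [rewrite pnatr_eq0|rewrite expf_neq0].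
move/eqP: Z; rewrite mulf_eq0 (negbTE Zn) orbF mulf_eq0 invr_eq0 (negbTE D0) orbF.
rewrite mulf_eq0 (gt_eqF (ch_gt0 t)) orbF => /eqP s0.
have : 0 <= t by rewrite -sh_ge0 s0.
have : 0 <= - t by rewrite -sh_ge0 shN s0 oppr0.
by rewrite oppr_ge0 => h1 h2; apply/eqP; rewrite eq_le h1 h2.
Qed.

End Given.
End Sphere.

(** * Billiards outside geodesic spheres *)

Section PartB.
Variable R : realType.
Notation V := 'rV[R]_(2 + 2).
Implicit Types (p q u v w x y z : V).

(** The chord from [p] to the point reached is nonzero and is a complex multiple of [u]; it also
    spans the direction of [H]. *)
Lemma geoE_line_dir (H : set V) p u (t : R) : complex_line H -> H p -> metric p u u = 1 ->
  0 < t -> H (geoE p u t) -> tangent 2 H p u.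
Proof.
move=> HH Hp hu t0 Hx; have hp := line_CH2 HH Hp.
have xp : geoE p u t - p != 0.
  rewrite -dot_eq0; apply/eqP => E.
  have := geoE_dist t hp hu; rewrite E mul0r => /esym/eqP.
  have S0 : 0 < sh t by rewrite sh_gt0.
  have U0 := dot_gt0 (unit_neq0 hu).
  have X0 := CH2_gt0 (geoE_in hp hu t).
  by rewrite gt_eqF //; apply: mulr_gt0 => //; apply: mulr_gt0 => //; exact: exprn_gt0.
have [v v0 Tv] := line_exists_tangent HH Hp.
have [_ vx] : cline p v (geoE p u t) by rewrite -(line_eq HH Hp Tv v0).
apply/(line_tangentP HH _ Hp Tv v0).
apply: (cspan_sym xp vx).1; apply: (cspan_sym xp _).2; last exact: cspanv.
by rewrite /geoE addrC addKr; do 2 eexists.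
Qed.

Section Given.
Variables (o : V) (r : R) (nu B : V -> V).
Hypotheses (ho : CH2 o) (r0 : 0 < r).
Notation N := (geodesic_sphere o r).
Hypotheses (hnu : inward_normal N nu) (hB : outer_billiard_map N nu B).
Notation U := (exterior N nu).
Let hN : submanifold 1 N. Proof. exact: sphere_submanifold. Qed.
Let NC q : N q -> CH2 q. Proof. exact: nu_sub_CH2. Qed.
Let SE q : N q -> sphere_eq o r q = 0. Proof. by move/(sphereP ho r0). Qed.

Lemma sphere_geoE u (s : R) : metric o u u = 1 -> 0 <= s -> s != r -> ~ N (geoE o u s).
Proof.
move=> hu s0 sr /SE; rewrite sphere_eq_geoE // => /eqP; rewrite mulf_eq0 gt_eqF /=; last first.
  by apply: mulr_gt0; [exact: CH2_gt0|exact: CH2_gt0 (geoE_in ho hu s)].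
by rewrite subr_eq0 => /eqP /(ch_inj s0 (ltW r0)) /eqP; apply/negP.
Qed.

Lemma center_notin : ~ N o.
Proof.
have [w w0 _] := lin_kernel_nz (@pair_dot R o).
have [l _ lu] := unit_scale ho w0.
have := sphere_geoE lu (lexx 0); rewrite geoE0; apply; by rewrite lt_eqF.
Qed.

(** By [zeros_first] the differential of [sphere_eq] is a multiple of the product with [nu q], and
    the factor is nonzero by [dsphere_surj]. *)
Lemma sphere_normal q y : N q -> metric q (nu q) y = 0 <-> dsphere o r q y = 0.
Proof.
move=> Nq; have [W [f [xi Hch]]] := normal_chart_exists hN hnu Nq.
have [[oW Wq _ _ _] _ _] := Hch.
have Z x := zeros_first x Hch (@CH2_open R) (@Ck_sphere R o r 1) (fun z _ => @SE z) Nq Wq (NC Nq).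
have DE x : dsphere o r q x = dsphere o r q (nu q) * metric q (nu q) x.
  have E y' := is_diffE y' (is_diff_sphere o r q).
  by rewrite -!E; exact: Z.
have [w dw] := dsphere_surj ho r0 (SE Nq).
have d0 : dsphere o r q (nu q) != 0.
  by apply: contra dw => /eqP E; rewrite DE E mul0r.
rewrite DE; split=> [->|/eqP]; first by rewrite mulr0.
by rewrite mulf_eq0 (negbTE d0) => /eqP.
Qed.

(** The component [w] of the normal orthogonal to [H] is tangent to the sphere by [dsphere_line],
    hence orthogonal to the normal and to itself. *)
Lemma sphere_normal_tangent (H : set V) a b q : complex_line H -> H o ->
  dot a b = 0 -> dot a (J b) = 0 -> dot b b = 1 - dot a a -> CH2 a ->
  (forall z, H z <-> exists x y : R, z = a + cs x y b /\ x ^+ 2 + y ^+ 2 < 1) ->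
  N q -> H q -> cspan b (nu q).
Proof.
move=> HH Ho ab aJb bb ha Heq Nq Hq; have hq := NC Nq.
have b0 : b != 0 by rewrite -dot_eq0 bb gt_eqF // CH2_gt0.
pose w := nu q - mproj q b (nu q).
have w1 v : cspan b v -> metric q w v = 0 by move=> h; exact: mproj_orth.
have [x [y [qE _]]] := (Heq q).1 Hq; have [x' [y' [oE _]]] := (Heq o).1 Ho.
have dw : dsphere o r q w = 0.
  have := @dsphere_line R o r a b x y x' y' w; rewrite -qE.
  apply=> //; [exact: SE|exact/w1/cspanv|exact/w1/cspanJ/cspanv].
have nw := (sphere_normal w Nq).2 dw.
have ww : metric q w w = 0.
  rewrite {1}/w metricDl metricNl nw (metricC q (mproj _ _ _)) w1 ?subrr //.
  exact: mproj_span.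
have w0 : w = 0 by exact: metric_eq0 hq ww.
have -> : nu q = mproj q b (nu q) by apply/eqP; rewrite -subr_eq0; apply/eqP.
exact: mproj_span.
Qed.

Lemma sphere_flow_center q (t : R) : N q -> t != 0 -> tangent_flow nu (q, t) != o.
Proof.
move=> Nq t0; apply/eqP => E; move/eqP: t0; apply.
have hu := flow_unit hN hnu Nq.
apply: (sphere_flow_neq (NC Nq) hu (SE Nq)); last by rewrite -(flowE _ hN hnu Nq).
by apply/(sphere_normal _ Nq); rewrite metricuJ.
Qed.

Lemma sphere_flow_back (H : set V) q (t : R) : complex_line H -> H o -> N q -> t != 0 ->
  H (tangent_flow nu (q, t)) -> H q.
Proof.
move=> HH Ho Nq t0 Hx; have hq := NC Nq; have hu := flow_unit hN hnu Nq.
have qo : q - o != 0.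
  by rewrite subr_eq0; apply/eqP => E; apply: center_notin; move: Nq; rewrite E.
have Lq : cline o (q - o) q by split=> //; exact: cspanv.
have LL := cline_complex_line ho qo.
have Lo := cline_self (q - o) ho.
have [a [b [ab aJb bb ha [Heq HT]]]] := line_normal_form LL.
have bn := sphere_normal_tangent LL Lo ab aJb bb ha Heq Nq Lq.
have Tn : tangent 2 (cline o (q - o)) q (nu q) by apply/(HT q Lq).
have vn : cspan (q - o) (nu q) by apply/(cline_tangentP _ ho qo Lq).
have xo := sphere_flow_center Nq t0.
set x := tangent_flow nu (q, t) in Hx xo.
have xE : x = geoE q (J (nu q)) t by exact: (flowE t hN hnu Nq).
have vx : cspan (q - o) (x - o).
  rewrite xE /geoE addrAC; apply: cspanD; first exact: cspanv.
  by apply: cspan_cs; exact: cspanJ.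
have xo' : x - o != 0 by rewrite subr_eq0.
have [v v0 Tv] := line_exists_tangent HH Ho.
have HE := line_eq HH Ho Tv v0.
have [hx vx'] : cline o v x by rewrite -HE.
rewrite HE; split=> //.
apply: (cspan_sym xo' vx').1.
by apply: (cspan_sym xo' vx).2; exact: cspanv.
Qed.

Lemma sphere_billiard (H : set V) : complex_line H -> H o ->
  B @` (H `&` U) = H `&` U /\ usual_outer_billiard_on H (N `&` H) U B.
Proof.
move=> HH Ho; have [a [b [ab aJb bb ha [Heq HT]]]] := line_normal_form HH.
suff hyp : billiard_line H a b N nu B by exact: core_billiard hyp.
split=> //.
- by split=> //; [exact: sphere_compact|exact: sphere_nonempty].
- by move=> q; apply: (sphere_normal_tangent HH Ho ab aJb bb ha Heq).
- by move=> q t; exact: sphere_flow_back.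
Qed.

Lemma sphere_circle (H : set V) : complex_line H -> H o -> circle_in H o r = N `&` H.
Proof.
move=> HH Ho; apply/seteqP; split=> [x [u [Tu hu ->]]|x [[u hu ->] Hx]].
  split; first by exists u.
  by case: (HH) => _ _ _ _; apply.
exists u; split=> //; apply: (geoE_line_dir HH Ho hu r0).
by rewrite -(geodE ho hu).
Qed.

Lemma geoE_path u (s t : R) : metric o u u = 1 -> (forall x : R, x \in `[s, t] -> 0 <= x /\ x != r) ->
  forall x y : R, x \in `[s, t] -> y \in `[s, t] -> U (geoE o u x) -> U (geoE o u y).
Proof.
move=> hu h; apply: exterior_path => x xI.
  exact: (is_derive_cont (is_derive_geoE ho hu x)).
have [x0 xr] := h x xI; split; first exact: (geoE_in ho hu x).
exact: sphere_geoE.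
Qed.

(** Radial geodesics connect within the complement of the sphere. A point of U in the disc would put
    [o] into U, yet no tangent ray reaches [o]; a point off the disc is joined outwards to the
    shell. *)
Lemma sphere_exterior (H : set V) : complex_line H -> H o -> H `&` U = H `\` disc_in H o r.
Proof.
move=> HH Ho; apply/seteqP; split=> [x [Hx Ux]|x [Hx nD]]; split=> //.
  move=> [s /andP[s0 sr] [u [Tu hu xE]]].
  move: xE; rewrite (geodE ho hu) => xE.
  have [_ nN] := exterior_sub Ux.
  have sr' : s < r.
    rewrite lt_neqAle sr andbT; apply/eqP => E; apply: nN.
    by exists u => //; rewrite geodE // xE E.
  have Uo : U o.
    have h (y : R) : y \in `[0, s] -> 0 <= y /\ y != r.
      by rewrite in_itv /= => /andP[y0 ys]; rewrite y0 lt_eqF // (le_lt_trans ys).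
    have I0 : (0 : R) \in `[0, s] by rewrite in_itv /= lexx.
    have Is : s \in `[0, s] by rewrite in_itv /= s0 lexx.
    by have := geoE_path hu h Is I0; rewrite -xE geoE0; apply.
  have [[_ _ surj] _ _] := hB.
  have [[q t] [Nq t0] E] := surj o Uo.
  have : tangent_flow nu (q, t) != o by apply: sphere_flow_center => //; rewrite gt_eqF.
  by rewrite E eqxx.
have hx := line_CH2 HH Hx.
have [u [s [hu s0 xE]]] := sphere_exp ho hx.
have rs : r < s.
  rewrite ltNge; apply/negP => sr; apply: nD; exists s; first by rewrite s0.
  move: s0; rewrite le_eqVlt => /predU1P[s0|s0].
    have [v v0 Tv] := line_exists_tangent HH Ho.
    have [l _ lu] := unit_scale ho v0.
    exists (l *: v); split=> //; first exact/(line_tangentP HH _ Ho Tv v0)/cspanZ/cspanv.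
    by rewrite geodE // xE -s0 !geoE0.
  exists u; split=> //; last by rewrite geodE.
  by apply: (geoE_line_dir HH Ho hu s0); rewrite -xE.
have [rho /andP[rho0 rho1] [_ shell]] := exists_shell hN (sphere_compact ho r0) (sphere_nonempty r ho) hnu hB.
have [T T0 HT] := geoE_near_boundary ho hu rho1.
pose S := Num.max s T.
have sS : s <= S by rewrite /S le_max lexx.
have TS : T <= S by rewrite /S le_max lexx orbT.
have h (y : R) : y \in `[s, S] -> 0 <= y /\ y != r.
  rewrite in_itv /= => /andP[sy _]; split; first exact: le_trans sy.
  by rewrite gt_eqF // (lt_le_trans rs).
have Is : s \in `[s, S] by rewrite in_itv /= lexx.
have IS : S \in `[s, S] by rewrite in_itv /= sS lexx.
by rewrite xE; apply: (geoE_path hu h IS Is); apply: shell; exact: HT.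
Qed.

End Given.

Lemma dot2 (u v : 'rV[R]_2) : dot u v = u ord0 ord0 * v ord0 ord0 + u ord0 ord_max * v ord0 ord_max.
Proof.
rewrite /dot !big_ord_recl big_ord0 addr0; congr (_ + _ * _); congr (_ _ _); exact: val_inj.
Qed.

(** Since |b|^2 = 1 - |a|^2 in the normal form, the affine coordinate w on [H] runs over the unit
    disc and 1 - |z|^2 = |b|^2 (1 - |w|^2). *)
Lemma complex_line_m4 (H : set V) : complex_line H -> hyperbolic_plane_m4 H.
Proof.
move=> HH; have [a [b [ab aJb bb ha [Heq HT]]]] := line_normal_form HH.
have b1 : 0 < dot b b by rewrite bb CH2_gt0.
have b0 : b != 0 by rewrite -dot_eq0 gt_eqF.
pose phi (w : 'rV[R]_2) := a + cs (w ord0 ord0) (w ord0 ord_max) b.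
have oD : open [set w : 'rV[R]_2 | dot w w < 1].
  have -> : [set w : 'rV[R]_2 | dot w w < 1] = (fun w : 'rV[R]_2 => dot w w) @^-1` [set x : R | x < 1] by [].
  apply: open_comp => [z _|]; last exact: open_lt.
  exact: (differentiable_continuous (ex_diff (is_diff_def := is_diff_dot (is_diff_id z) (is_diff_id z)))).
have dphi (w h : 'rV[R]_2) : 'd phi w h = cs (h ord0 ord0) (h ord0 ord_max) b.
  have D1 := is_diff_scale (is_diff_coord ord0 (is_diff_id w)) (is_diff_cst b w).
  have D2 := is_diff_scale (is_diff_coord ord_max (is_diff_id w)) (is_diff_cst (J b) w).
  have D := is_diffD (is_diff_cst a w) (is_diffD D1 D2).
  by apply: (etrans (is_diffE h D)); rewrite !fctE !scaler0 !add0r.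
exists phi; split.
- move=> k; apply: Ck_add => //; first exact: Ck_cst.
  by apply: Ck_cs => //; [apply: Ck_coord|apply: Ck_coord|]; ck.
- split=> [w wD|w w'|z].
  + apply/Heq; exists (w ord0 ord0), (w ord0 ord_max); split=> //.
    by move: wD; rewrite /= dot2 !expr2.
  + rewrite !inE => _ _ /addrI E.
    have : cs (w ord0 ord0 - w' ord0 ord0) (w ord0 ord_max - w' ord0 ord_max) b = 0.
      by rewrite -csD -csN E subrr.
    move=> /(cs_inj b0) [/eqP + /eqP]; rewrite !subr_eq0 => /eqP e1 /eqP e2.
    apply/rowP => -[[|[|//]] i].
      by rewrite (_ : Ordinal i = ord0) //; exact: val_inj.
    by rewrite (_ : Ordinal i = ord_max) //; exact: val_inj.
  move=> /Heq [x [y [-> xy]]].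
  exists (x *: delta_mx 0 ord0 + y *: delta_mx 0 ord_max).
    by rewrite /= dot2 !mxE /= !mulr1 !mulr0 addr0 add0r -!expr2.
  by rewrite /phi !mxE /= !mulr1 !mulr0 addr0 add0r.
move=> w u v wD; rewrite !dphi /metric /phi.
have ba : dot b a = 0 by rewrite dotC.
have bJa : dot b (J a) = 0 by rewrite -[LHS]opprK -dotJl dotC aJb oppr0.
have N1 : 1 - dot (a + cs (w ord0 ord0) (w ord0 ord_max) b) (a + cs (w ord0 ord0) (w ord0 ord_max) b) =
    dot b b * (1 - dot w w).
  have aa : dot a a = 1 - dot b b by rewrite bb; ring.
  rewrite [dot w w]dot2 /cs !dotE ab aJb ba bJa aa; ring.
have n0 : 1 - dot w w != 0 by rewrite subr_eq0 eq_sym lt_eqF.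
have bn : dot b b != 0 by rewrite gt_eqF.
rewrite N1; move: n0; rewrite !dot2 /cs !dotE ba bJa => n0.
by field; rewrite n0 bn.
Qed.

End PartB.

Theorem proposition4 (R : realType) :
  (forall (H N : set 'rV[R]_(2 + 2)) (s nu B : 'rV[R]_(2 + 2) -> 'rV[R]_(2 + 2)),
     complex_line H ->
     compact_connected_hypersurface N ->
     quadratically_convex N ->
     reflection H s ->
     s @` N = N ->
     inward_normal N nu ->
     outer_billiard_map N nu B ->
     B @` (H `&` exterior N nu) = H `&` exterior N nu /\
     usual_outer_billiard_on H (N `&` H) (exterior N nu) B) /\
  (forall (o : 'rV[R]_(2 + 2)) (r : R) (nu B : 'rV[R]_(2 + 2) -> 'rV[R]_(2 + 2)),
     CH2 o -> 0 < r ->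
     inward_normal (geodesic_sphere o r) nu ->
     outer_billiard_map (geodesic_sphere o r) nu B ->
     let U := exterior (geodesic_sphere o r) nu in
     (forall H : set 'rV[R]_(2 + 2), complex_line H -> H o ->
        [/\ B @` (H `&` U) = H `&` U,
            hyperbolic_plane_m4 H,
            H `&` U = H `\` disc_in H o r &
            usual_outer_billiard_on H (circle_in H o r) U B]) /\
     set_bij [set H : set 'rV[R]_(2 + 2) | complex_line H /\ H o] (@CP1 R)
       (fun H => tangent 2 H o)).
Proof.
split=> [H N s nu B HH hN _ Hr sN hnu hB|o r nu B ho r0 hnu hB U]; first exact: reflection_billiard HH hN Hr sN hnu hB.
split=> [H HH Ho|]; last exact: complex_lines_CP1.
have [BU HU] := sphere_billiard ho r0 hnu hB HH Ho.
split=> //; [exact: complex_line_m4|exact: (sphere_exterior ho r0 hnu hB)|].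
by rewrite (sphere_circle ho r0 HH Ho).
Qed.
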